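(* The following operator identities hold on finitely supported functions of one occupation number (on all functions on $\{0,\dots,2j\}$ in item 2). 1. For $k>0$, $0<p<1$, $\hat\alpha=\pi$, $\hat\beta=\sqrt p\,\operatorname{arctanh}(\sqrt p)$: $$\exp\Big(\hat\beta\big(-K^{+}+\tfrac1pK^{-}\big)\Big)\exp\big(\mathrm i\hat\alpha K^0\big)=e^{K^-}\,e^{\log(p-1)K^0}\,e^{pK^+}.$$ 2. For $2j\in\{1,2,\dots\}$, $0<p<1$, $\hat\alpha=\pi$, $\hat\beta=\sqrt{\tfrac p{1-p}}\arctan\Big(\sqrt{\tfrac p{1-p}}\Big)$: $$\exp\Big(\hat\beta\big(-J^{+}+\tfrac{1-p}{p}J^{-}\big)\Big)\exp\big(\mathrm i\hat\alpha J^0\big)=e^{J^-}\,e^{\log\left(\frac1{p-1}\right)J^0}\,e^{\frac{p}{1-p}J^+}.$$ 3. For $p>0$, $\hat\alpha=\pi$, $\hat\beta=1$: $$\exp\big(\hat\beta(-p\,a^\dagger+a)\big)\exp\big(\mathrm i\hat\alpha\,aa^\dagger\big)=e^{a}\,e^{-p/2+\mathrm i\pi aa^\dagger}\,e^{p\,a^\dagger}.$$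
   Context: $\mathbb N=\{0,1,2,\dots\}$. The operators act on (complex-valued) functions $f$ of one variable, with the convention $f(-1)=0$ (and $f(2j+1)=0$ in the $J$ case): - on functions on $\mathbb N$, $k>0$: $(K^+f)(x)=(2k+x)f(x+1)$, $(K^-f)(x)=xf(x-1)$, $(K^0f)(x)=(x+k)f(x)$; - on functions on $\{0,\dots,2j\}$: $(J^+f)(x)=(2j-x)f(x+1)$, $(J^-f)(x)=xf(x-1)$, $(J^0f)(x)=(x-j)f(x)$; - on functions on $\mathbb N$: $(a^\dagger f)(x)=f(x+1)$, $(af)(x)=xf(x-1)$; so $(aa^\dagger f)(x)=xf(x)$. Exponentials of diagonal operators are diagonal. On finitely supported functions $e^{sK^+},e^{sa^\dagger}$ are given by terminating power series; $e^{sK^-},e^{sa}$ are given by power series that are finite sums at each point. For $A=-K^++\frac1pK^-$ (resp. $A=-pa^\dagger+a$) and finitely supported $f$, $e^{\beta A}f$ is the value at time $\beta$ of the solution $g_\beta$ of $\frac{d}{d\beta}g_\beta=Ag_\beta$, $g_0=f$ (pointwise on $\mathbb N$), for which the generating function $\sum_y g_\beta(y)\frac{\Gamma(2k+y)}{y!\,\Gamma(2k)}t^y$ (resp. $\sum_y g_\beta(y)\frac{t^y}{y!}$) is jointly real-analytic in $(\beta,t)$ near $\mathbb R\times\{0\}$. For operators on functions on $\{0,\dots,2j\}$ exponentials are matrix exponentials. Branches of the logarithm: $\log(p-1)=\log(1-p)+\mathrm i\pi$ and $\log\frac{1}{p-1}=-\log(1-p)+\mathrm i\pi$. *)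

(* Defs.v *)
From mathcomp Require Import ssreflect ssrfun ssrbool eqtype ssrnat fintype.
From Stdlib Require Import Reals Factorial.
From Coquelicot Require Import Coquelicot.

Open Scope R_scope.
Open Scope C_scope.

Definition arctanh (x : R) : R := (ln ((1 + x) / (1 - x)) / 2)%R.

Definition Gamma (x : R) : R :=
  RInt_gen (fun t : R => (Rpower t (x - 1) * exp (- t))%R)
           (at_right 0) (Rbar_locally p_infty).

Definition op (T : Type) : Type := (T -> C) -> (T -> C).

Definition opadd {T : Type} (A B : op T) : op T := fun f x => A f x + B f x.
Definition opscal {T : Type} (c : C) (A : op T) : op T := fun f x => c * A f x.
Definition opid {T : Type} : op T := fun f => f.
Definition opcomp {T : Type} (A B : op T) : op T := fun f => A (B f).

Definition CSeries (u : nat -> C) : C :=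
  (Series (fun n => Re (u n)), Series (fun n => Im (u n))).

(* (e^A f)(x) = sum_n (A^n f)(x) / n!.  This is the matrix exponential when T is
   finite, multiplication by e^{d(x)} when A is multiplication by d(x), and a
   finite sum at each x for the lowering and (on finitely supported f) the
   raising operators below. *)
Definition opexp {T : Type} (A : op T) : op T :=
  fun f x => CSeries (fun n => RtoC (/ INR (fact n)) * Nat.iter n A f x).

Definition finitely_supported (f : nat -> C) : Prop :=
  exists M : nat, forall x : nat, (M <= x)%coq_nat -> f x = 0.

(* f(x - 1), with f(-1) = 0 *)
Definition prev (f : nat -> C) (x : nat) : C :=
  match x with O => 0 | S y => f y end.

Definition Kplus (k : R) : op nat :=
  fun f x => RtoC (2 * k + INR x) * f (S x).
Definition Kminus : op nat :=
  fun f x => RtoC (INR x) * prev f x.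
Definition Kzero (k : R) : op nat :=
  fun f x => RtoC (INR x + k) * f x.

Definition adag : op nat := fun f x => f (S x).
Definition aop : op nat := fun f x => RtoC (INR x) * prev f x.

(* Functions on {0, ..., N}, N = 2j, extended by 0 to all of nat. *)
Definition ext0 {N : nat} (f : 'I_N.+1 -> C) (m : nat) : C :=
  match insub m with Some i => f i | None => 0 end.

Definition Jplus (N : nat) : op 'I_N.+1 :=
  fun f x => RtoC (INR N - INR x) * ext0 f (S x).
Definition Jminus (N : nat) : op 'I_N.+1 :=
  fun f x => RtoC (INR x) * prev (ext0 f) x.
Definition Jzero (N : nat) : op 'I_N.+1 :=
  fun f x => RtoC (INR x - INR N / 2) * f x.

(* Absolutely convergent double series with sum l. *)
Definition is_double_series (u : nat -> nat -> C) (l : C) : Prop :=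
  (exists M : R, forall m n : nat,
     (sum_n (fun i => sum_n (fun j => Cmod (u i j)) n) m <= M)%R) /\
  filterlim (fun n : nat => sum_n (fun i => sum_n (fun j => u i j) n) n)
            eventually (locally l).

Definition analytic_at (G : R -> R -> C) (b0 t0 : R) : Prop :=
  exists (c : nat -> nat -> C) (r : R), (0 < r)%R /\
    forall b t : R, (Rabs (b - b0) < r)%R -> (Rabs (t - t0) < r)%R ->
      is_double_series
        (fun m n => c m n * RtoC ((b - b0) ^ m * (t - t0) ^ n)) (G b t).

(* The generating function sum_y g_b(y) w(y) t^y converges and is jointly
   real-analytic on an open neighbourhood of R x {0}. *)
Definition analytic_generating_function (w : nat -> R) (g : R -> nat -> C)
  : Prop :=
  exists (U : R * R -> Prop) (G : R -> R -> C),
    open U /\ (forall b : R, U (b, 0%R)) /\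
    forall b t : R, U (b, t) ->
      is_series (V := C_R_NormedModule)
        (fun y => g b y * RtoC (w y * t ^ y)) (G b t) /\
      analytic_at G b t.

Definition is_solution (w : nat -> R) (A : op nat) (f : nat -> C)
  (g : R -> nat -> C) : Prop :=
  g 0%R = f /\
  (forall (b : R) (x : nat),
     is_derive (V := C_R_NormedModule) (fun s : R => g s x) b (A (g b) x)) /\
  analytic_generating_function w g.

(* h = e^{b A} f: the value at time b of the unique solution with analytic
   generating function; existence and uniqueness are part of the assertion. *)
Definition is_flow (w : nat -> R) (A : op nat) (b : R) (f h : nat -> C)
  : Prop :=
  exists g : R -> nat -> C, unique (is_solution w A f) g /\ g b = h.

(* Weights of the generating functions: Gamma(2k+y) / (y! Gamma(2k)) and 1/y!. *)
Definition weightK (k : R) (y : nat) : R :=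
  (Gamma (2 * k + INR y) / (INR (fact y) * Gamma (2 * k)))%R.
Definition weighta (y : nat) : R := (/ INR (fact y))%R.

(* log(p - 1) and log(1 / (p - 1)) for 0 < p < 1; both branches have imaginary
   part +pi, so they are not opposite to each other. *)
Definition log_pm1 (p : R) : C := RtoC (ln (1 - p)) + Ci * RtoC PI.
Definition log_inv_pm1 (p : R) : C := - RtoC (ln (1 - p)) + Ci * RtoC PI.

(* Main.v *)
Require Import Defs.
From Stdlib Require Import Reals Factorial Lra Lia FunctionalExtensionality.
From Coquelicot Require Import Coquelicot.
Open Scope R_scope.

(* Weight the occupation-number functions by w(n) = prod_(i < n) (nu + delta i) / n!,
   where (nu, delta) is (2k, 1), (2j, -1), (1, 0) in the three items.  On generating
   functions in t, the raising operator becomes d/dt and the lowering one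
   delta t^2 d/dt + nu t, so d/db g = (-p X^+ + q X^-) g is a first-order linear PDE
   whose solutions are found by characteristics: the monomial t^y evolves into
   P^y Q^(- nu / delta - y) (read exp(q b t - p q b^2 / 2) P^y if delta = 0), where
   P = C t - p S, Q = C - q delta S t, S' = C and C' = p q delta S, i.e. C and S are
   hyperbolic, trigonometric or affine functions of b.  At the time b = beta the
   right-hand side of the identity is recognised by expanding
   (r - t)^y = (r (1 - delta t) - (1 - delta r) t)^y.  Uniqueness of the flow: near each
   time b0 the components of a solution are power series in b - b0 whose
   coefficients are powers of the operator applied to the value at b0, so the
   set of times at which two solutions agree is open and closed. *)

(** * Absolutely summable double series *)

(** The time beta is the one at which q S / C = 1: tanh (beta / sqrt p) = sqrt p in item 1, tan
    (sqrt q beta) = sqrt (p / (1 - p)) with q = (1 - p) / p in item 2, and S = b, C = 1 in item 3.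
    The evolved monomial is then a constant times (t - r)^y (1 - dl t)^(- nu / dl - y) with r = p S
    / C, and the sign (-1)^y contributed by exp(i pi X^0) turns t - r into r - t. In the general
    lemmas p and q are the coefficients of X^+ and X^-, not the parameter p of the theorem. The
    evolved monomial is written as z C^(-y) (C t - p S)^y W(q S t / C), with z given by a
    differential equation; nothing is divided by dl, so the three items share one computation. Two
    obstacles shape the proof. Existence of the flow in items 1 and 3 requires the generating
    function to be an absolutely convergent double series around every point of an open set, hence a
    calculus of double series closed under products and composition. In item 2 the function C is a
    cosine with zeros; there the matrix exponential is obtained from Taylor's formula along
    [0, beta], where C is positive. *)

Lemma sum_n_le (a b : nat -> R) (n : nat) :
  (forall i, (i <= n)%nat -> a i <= b i) -> sum_n a n <= sum_n b n.
Proof.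
  induction n as [|n IH]; intros H.
  - rewrite !sum_O. apply H; lia.
  - rewrite !sum_Sn. apply Rplus_le_compat.
    + apply IH; intros; apply H; lia.
    + apply H; lia.
Qed.

Lemma sum_n_nonneg (a : nat -> R) (n : nat) :
  (forall i, 0 <= a i) -> 0 <= sum_n a n.
Proof.
  intros H. induction n as [|n IH]; [rewrite sum_O | rewrite sum_Sn]; auto.
  apply Rplus_le_le_0_compat; auto.
Qed.

Lemma sum_n_incr (a : nat -> R) (m n : nat) :
  (forall i, 0 <= a i) -> (m <= n)%nat -> sum_n a m <= sum_n a n.
Proof.
  intros H Hmn. induction Hmn as [|n _ IH]; [lra|].
  rewrite sum_Sn. unfold plus; simpl. specialize (H (S n)). lra.
Qed.

Lemma sum_n_term_le (a : nat -> R) (i n : nat) :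
  (forall i, 0 <= a i) -> (i <= n)%nat -> a i <= sum_n a n.
Proof.
  intros H Hin. apply Rle_trans with (2 := sum_n_incr a i n H Hin).
  destruct i; [rewrite sum_O; lra|].
  rewrite sum_Sn. generalize (sum_n_nonneg a i H). unfold plus; simpl. lra.
Qed.

Lemma Rabs_sum_n (a : nat -> R) (n : nat) :
  Rabs (sum_n a n) <= sum_n (fun i => Rabs (a i)) n.
Proof.
  induction n as [|n IH]; [rewrite !sum_O; lra|].
  rewrite !sum_Sn. eapply Rle_trans; [apply Rabs_triang|].
  apply Rplus_le_compat; auto; lra.
Qed.

Lemma ex_series_of_bounded (a : nat -> R) (M : R) :
  (forall n, 0 <= a n) -> (forall n, sum_n a n <= M) -> ex_series a.
Proof.
  intros H0 HM.
  destruct (ex_finite_lim_seq_incr (sum_n a) M) as [l Hl]; auto.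
  - intros n. apply sum_n_incr; auto.
  - exists l. exact Hl.
Qed.

Lemma Series_le_bound (a : nat -> R) (M : R) :
  ex_series a -> (forall n, sum_n a n <= M) -> Series a <= M.
Proof.
  intros Ha HM. apply Series_correct in Ha.
  exact (is_lim_seq_le (sum_n a) (fun _ => M) (Series a) M HM Ha
           (is_lim_seq_const M)).
Qed.

Lemma sum_n_le_Series (a : nat -> R) (m : nat) :
  (forall n, 0 <= a n) -> ex_series a -> sum_n a m <= Series a.
Proof.
  intros H0 Ha. apply Series_correct in Ha.
  apply (is_lim_seq_incr_compare (sum_n a) (Series a)); auto.
  intros n. apply sum_n_incr; auto.
Qed.

Lemma is_series_sum_n (u : nat -> nat -> R) (m : nat) :
  (forall i, ex_series (u i)) ->
  is_series (fun j => sum_n (fun i => u i j) m) (sum_n (fun i => Series (u i)) m).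
Proof.
  intros H. induction m as [|m IH].
  - rewrite sum_O. apply is_series_ext with (u 0%nat).
    + intros n. now rewrite sum_O.
    + apply Series_correct; auto.
  - rewrite sum_Sn.
    apply is_series_ext with (fun j => plus (sum_n (fun i => u i j) m) (u (S m) j)).
    + intros n. now rewrite sum_Sn.
    + apply (is_series_plus (V := R_NormedModule)); auto. apply Series_correct; auto.
Qed.

Lemma sum_n_Rmult_l (c : R) (a : nat -> R) (n : nat) :
  sum_n (fun k => c * a k) n = c * sum_n a n.
Proof. exact (sum_n_mult_l (K := R_Ring) c a n). Qed.

(** The bound is an explicit parameter because it plays the part of an l^1 norm: composition with a
    power series compares it with a radius of convergence. *)
Definition summable2 (u : nat -> nat -> R) (M : R) : Prop :=
  forall m n, sum_n (fun i => sum_n (fun j => Rabs (u i j)) n) m <= M.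

Definition dseries (u : nat -> nat -> R) : R := Series (fun i => Series (u i)).

Lemma summable2_le (u v : nat -> nat -> R) (M : R) :
  (forall i j, Rabs (u i j) <= Rabs (v i j)) -> summable2 v M -> summable2 u M.
Proof.
  intros H Hv m n. eapply Rle_trans; [|apply (Hv m n)].
  apply sum_n_le; intros i _. apply sum_n_le; intros j _. apply H.
Qed.

Lemma summable2_ext (u v : nat -> nat -> R) (M : R) :
  (forall i j, u i j = v i j) -> summable2 v M -> summable2 u M.
Proof. intros H. apply summable2_le. intros; rewrite H; lra. Qed.

Lemma summable2_abs (u : nat -> nat -> R) (M : R) :
  summable2 u M -> summable2 (fun i j => Rabs (u i j)) M.
Proof. apply summable2_le. intros; rewrite Rabs_Rabsolu; lra. Qed.

Lemma summable2_swap (u : nat -> nat -> R) (M : R) :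
  summable2 u M -> summable2 (fun j i => u i j) M.
Proof. intros H m n. rewrite sum_n_switch. apply H. Qed.

Lemma summable2_plus (u v : nat -> nat -> R) (M N : R) :
  summable2 u M -> summable2 v N -> summable2 (fun i j => u i j + v i j) (M + N).
Proof.
  intros Hu Hv m n.
  apply Rle_trans with
    (plus (sum_n (fun i => sum_n (fun j => Rabs (u i j)) n) m)
       (sum_n (fun i => sum_n (fun j => Rabs (v i j)) n) m)).
  - rewrite <- sum_n_plus. apply sum_n_le; intros i _.
    rewrite <- sum_n_plus. apply sum_n_le; intros j _. apply Rabs_triang.
  - apply Rplus_le_compat; auto.
Qed.

Lemma summable2_scal (c : R) (u : nat -> nat -> R) (M : R) :
  summable2 u M -> summable2 (fun i j => c * u i j) (Rabs c * M).
Proof.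
  intros Hu m n.
  rewrite (sum_n_ext _ (fun i => Rabs c * sum_n (fun j => Rabs (u i j)) n)).
  - rewrite sum_n_Rmult_l. apply Rmult_le_compat_l; [apply Rabs_pos | auto].
  - intros i. rewrite <- sum_n_Rmult_l. apply sum_n_ext; intros j. apply Rabs_mult.
Qed.

Lemma summable2_row_bound (u : nat -> nat -> R) (M : R) (i n : nat) :
  summable2 u M -> sum_n (fun j => Rabs (u i j)) n <= M.
Proof.
  intros H. eapply Rle_trans; [|apply (H i n)].
  apply (sum_n_term_le (fun i => sum_n (fun j => Rabs (u i j)) n)); auto.
  intros k. apply sum_n_nonneg; intros; apply Rabs_pos.
Qed.

Lemma summable2_term (u : nat -> nat -> R) (M : R) (i j : nat) :
  summable2 u M -> Rabs (u i j) <= M.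
Proof.
  intros H. eapply Rle_trans; [|apply (summable2_row_bound u M i j H)].
  apply (sum_n_term_le (fun j => Rabs (u i j))); auto. intros; apply Rabs_pos.
Qed.

Lemma summable2_pos (u : nat -> nat -> R) (M : R) : summable2 u M -> 0 <= M.
Proof.
  intros H. eapply Rle_trans; [apply Rabs_pos | apply (summable2_term u M 0 0 H)].
Qed.

Lemma summable2_row_abs (u : nat -> nat -> R) (M : R) (i : nat) :
  summable2 u M -> ex_series (fun j => Rabs (u i j)).
Proof.
  intros H. apply ex_series_of_bounded with M.
  - intros; apply Rabs_pos.
  - intros n. apply summable2_row_bound; auto.
Qed.

Lemma summable2_row (u : nat -> nat -> R) (M : R) (i : nat) :
  summable2 u M -> ex_series (u i).
Proof. intros H. apply ex_series_Rabs. eapply summable2_row_abs; eauto. Qed.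

Lemma summable2_sum_rows (u : nat -> nat -> R) (M : R) (m : nat) :
  summable2 u M -> sum_n (fun i => Series (fun j => Rabs (u i j))) m <= M.
Proof.
  intros H.
  assert (Hs := is_series_sum_n (fun i j => Rabs (u i j)) m
                  (fun i => summable2_row_abs u M i H)).
  rewrite <- (is_series_unique _ _ Hs). apply Series_le_bound.
  - eexists; exact Hs.
  - intros n. rewrite sum_n_switch. apply H.
Qed.

Lemma Series_nonneg (a : nat -> R) :
  (forall n, 0 <= a n) -> ex_series a -> 0 <= Series a.
Proof.
  intros H0 Ha. eapply Rle_trans; [|apply (sum_n_le_Series a 0 H0 Ha)].
  rewrite sum_O; auto.
Qed.

Lemma summable2_rows_abs (u : nat -> nat -> R) (M : R) :
  summable2 u M ->
  ex_series (fun i => Series (fun j => Rabs (u i j))) /\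
  dseries (fun i j => Rabs (u i j)) <= M.
Proof.
  intros H.
  assert (E : ex_series (fun i => Series (fun j => Rabs (u i j)))).
  { apply ex_series_of_bounded with M.
    - intros i. apply Series_nonneg; [intros; apply Rabs_pos|].
      eapply summable2_row_abs; eauto.
    - intros n. apply summable2_sum_rows; auto. }
  split; auto.
  apply Series_le_bound; auto. intros n. apply summable2_sum_rows; auto.
Qed.

Lemma summable2_rows_Rabs (u : nat -> nat -> R) (M : R) :
  summable2 u M -> ex_series (fun i => Rabs (Series (u i))).
Proof.
  intros H.
  apply (ex_series_le (V := R_CompleteNormedModule)) with
    (fun i => Series (fun j => Rabs (u i j))).
  - intros i. unfold norm; simpl. unfold abs; simpl. rewrite Rabs_Rabsolu.
    apply Series_Rabs. eapply summable2_row_abs; eauto.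
  - eapply summable2_rows_abs; eauto.
Qed.

Lemma summable2_rows (u : nat -> nat -> R) (M : R) :
  summable2 u M -> ex_series (fun i => Series (u i)).
Proof. intros H. apply ex_series_Rabs. eapply summable2_rows_Rabs; eauto. Qed.

Lemma is_lim_square_nonneg (u : nat -> nat -> R) (M : R) :
  (forall i j, 0 <= u i j) -> summable2 u M ->
  is_lim_seq (fun n => sum_n (fun i => sum_n (u i) n) n) (dseries u).
Proof.
  intros H0 H.
  assert (Hle : forall m n m' n', (m <= m')%nat -> (n <= n')%nat ->
    sum_n (fun i => sum_n (u i) n) m <= sum_n (fun i => sum_n (u i) n') m').
  { intros m n m' n' Hm Hn.
    apply Rle_trans with (sum_n (fun i => sum_n (u i) n') m).
    - apply sum_n_le; intros; apply sum_n_incr; auto.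
    - apply sum_n_incr; auto. intros; apply sum_n_nonneg; auto. }
  assert (HS : forall i, ex_series (u i)) by (intros; eapply summable2_row; eauto).
  assert (Hex : ex_series (fun i => Series (u i))) by (eapply summable2_rows; eauto).
  assert (Hup : forall n, sum_n (fun i => sum_n (u i) n) n <= dseries u).
  { intros n. apply Rle_trans with (sum_n (fun i => Series (u i)) n).
    - apply sum_n_le; intros. apply sum_n_le_Series; auto.
    - apply (sum_n_le_Series (fun i => Series (u i))); auto.
      intros; apply Series_nonneg; auto. }
  destruct (ex_finite_lim_seq_incr (fun n => sum_n (fun i => sum_n (u i) n) n)
              (dseries u)) as [L HL]; auto.
  assert (L1 : L <= dseries u).
  { exact (is_lim_seq_le _ (fun _ => dseries u) L (dseries u) Hup HL
             (is_lim_seq_const _)). }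
  (* For a fixed number m of rows, the m by n rectangle lies inside the n by n square as soon as n
     >= m. *)
  assert (L2 : dseries u <= L).
  { apply Series_le_bound; auto. intros m.
    assert (Hm := is_series_sum_n u m HS).
    refine (is_lim_seq_le_loc _ _ (sum_n (fun i => Series (u i)) m) L _ Hm HL).
    exists m. intros n Hn. rewrite sum_n_switch. apply Hle; auto. }
  replace (dseries u) with L by lra. exact HL.
Qed.

Lemma is_lim_square (u : nat -> nat -> R) (M : R) :
  summable2 u M ->
  is_lim_seq (fun n => sum_n (fun i => sum_n (u i) n) n) (dseries u).
Proof.
  intros H.
  assert (Ha := summable2_abs u M H).
  (* [u] is the difference of the nonnegative arrays |u| and [v], to which the previous lemma
     applies. *)
  set (v := fun i j => Rabs (u i j) + - u i j).
  assert (Hopp : summable2 (fun i j => - u i j) M).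
  { revert H. apply summable2_le. intros; rewrite Rabs_Ropp; lra. }
  assert (Hv : summable2 v (M + M)) by (apply summable2_plus; auto).
  assert (L1 := is_lim_square_nonneg _ _ (fun i j => Rabs_pos (u i j)) Ha).
  assert (L2 : is_lim_seq (fun n => sum_n (fun i => sum_n (v i) n) n) (dseries v)).
  { apply is_lim_square_nonneg with (M + M); auto.
    intros i j. unfold v. generalize (Rle_abs (u i j)). lra. }
  assert (L3 := is_lim_seq_minus' _ _ _ _ L1 L2).
  replace (dseries u) with (dseries (fun i j => Rabs (u i j)) - dseries v).
  - eapply is_lim_seq_ext; [|exact L3]. intros n. cbv beta.
    enough (sum_n (fun i => sum_n (fun j => Rabs (u i j)) n) n =
            plus (sum_n (fun i => sum_n (u i) n) n) (sum_n (fun i => sum_n (v i) n) n)) as ->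
      by (unfold plus; simpl; ring).
    rewrite <- sum_n_plus. apply sum_n_ext; intros i.
    rewrite <- sum_n_plus. apply sum_n_ext; intros j.
    unfold v, plus; simpl; ring.
  - unfold dseries. rewrite <- Series_minus.
    + apply Series_ext; intros i. rewrite <- Series_minus.
      * apply Series_ext; intros j. unfold v; ring.
      * eapply summable2_row_abs; eauto.
      * eapply summable2_row; eauto.
    + eapply summable2_rows_abs; eauto.
    + eapply summable2_rows; eauto.
Qed.

(** Both iterated sums are limits of the same square partial sums. *)
Lemma dseries_swap (u : nat -> nat -> R) (M : R) :
  summable2 u M -> dseries (fun j i => u i j) = dseries u.
Proof.
  intros H.
  assert (L1 := is_lim_square u M H).
  assert (L2 := is_lim_square _ M (summable2_swap u M H)).
  assert (E : Finite (dseries (fun j i => u i j)) = Finite (dseries u)).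
  { rewrite <- (is_lim_seq_unique _ _ L1), <- (is_lim_seq_unique _ _ L2).
    apply Lim_seq_ext; intros n. apply sum_n_switch. }
  injection E; auto.
Qed.

Lemma dseries_ext (u v : nat -> nat -> R) :
  (forall i j, u i j = v i j) -> dseries u = dseries v.
Proof. intros H. apply Series_ext; intros i. apply Series_ext; intros j. auto. Qed.

Lemma dseries_scal (c : R) (u : nat -> nat -> R) :
  dseries (fun i j => c * u i j) = c * dseries u.
Proof.
  unfold dseries. rewrite <- Series_scal_l. apply Series_ext; intros i.
  apply Series_scal_l.
Qed.

Lemma dseries_plus (u v : nat -> nat -> R) (M N : R) :
  summable2 u M -> summable2 v N ->
  dseries (fun i j => u i j + v i j) = dseries u + dseries v.
Proof.
  intros Hu Hv. unfold dseries. rewrite <- Series_plus.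
  - apply Series_ext; intros i. apply Series_plus; eapply summable2_row; eauto.
  - eapply summable2_rows; eauto.
  - eapply summable2_rows; eauto.
Qed.

Lemma summable2_of_rows (u : nat -> nat -> R) (L : R) :
  (forall i, ex_series (fun j => Rabs (u i j))) ->
  is_series (fun i => Series (fun j => Rabs (u i j))) L -> summable2 u L.
Proof.
  intros H1 H2 m n. rewrite <- (is_series_unique _ _ H2).
  apply Rle_trans with (sum_n (fun i => Series (fun j => Rabs (u i j))) m).
  - apply sum_n_le; intros i _.
    apply (sum_n_le_Series (fun j => Rabs (u i j))); auto. intros; apply Rabs_pos.
  - apply (sum_n_le_Series (fun i => Series (fun j => Rabs (u i j)))).
    + intros i. apply Series_nonneg; auto. intros; apply Rabs_pos.
    + eexists; eauto.
Qed.

(** * Cauchy products, powers and compositions of double series *)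

Definition dconv (u v : nat -> nat -> R) (i j : nat) : R :=
  sum_n (fun k => sum_n (fun l => u k l * v (i - k)%nat (j - l)%nat) j) i.

Lemma is_series_cauchy_abs (a b : nat -> R) :
  ex_series (fun n => Rabs (a n)) -> ex_series (fun n => Rabs (b n)) ->
  is_series (fun n => sum_n (fun k => a k * b (n - k)%nat) n) (Series a * Series b).
Proof.
  intros Ha Hb.
  eapply is_series_ext; [intros n; symmetry; apply sum_n_Reals|].
  apply is_series_mult; auto; apply Series_correct; apply ex_series_Rabs; auto.
Qed.

(** Two one-variable Cauchy products in succession: row i of the product is a finite sum of products
    of rows, and its sum is the i-th term of the Cauchy product of the series of row sums. *)
Lemma dconv_series (u v : nat -> nat -> R) (M N : R) :
  summable2 u M -> summable2 v N ->
  (forall i, ex_series (dconv u v i)) /\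
  is_series (fun i => Series (dconv u v i)) (dseries u * dseries v).
Proof.
  intros Hu Hv.
  assert (R1 : forall i, is_series (dconv u v i)
    (sum_n (fun k => Series (u k) * Series (v (i - k)%nat)) i)).
  { intros i.
    assert (Hk : forall k, is_series
              (fun j => sum_n (fun l => u k l * v (i - k)%nat (j - l)%nat) j)
              (Series (u k) * Series (v (i - k)%nat))).
    { intros k. apply is_series_cauchy_abs; eapply summable2_row_abs; eauto. }
    assert (Hs := is_series_sum_n
       (fun k j => sum_n (fun l => u k l * v (i - k)%nat (j - l)%nat) j) i
       (fun k => ex_intro _ _ (Hk k))).
    rewrite (sum_n_ext _ (fun k => Series (u k) * Series (v (i - k)%nat))) in Hs.
    - exact Hs.
    - intros k. apply is_series_unique, Hk. }
  split.
  - intros i. eexists; apply R1.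
  - eapply is_series_ext.
    + intros i. symmetry. apply is_series_unique, R1.
    + apply is_series_cauchy_abs; eapply summable2_rows_Rabs; eauto.
Qed.

Lemma dseries_conv (u v : nat -> nat -> R) (M N : R) :
  summable2 u M -> summable2 v N -> dseries (dconv u v) = dseries u * dseries v.
Proof. intros Hu Hv. apply is_series_unique. eapply dconv_series; eauto. Qed.

(** For the arrays of moduli [dconv_series] gives the exact sum of the nonnegative product array,
    and this array dominates the product of [u] and [v] entrywise. *)
Lemma summable2_conv (u v : nat -> nat -> R) (M N : R) :
  summable2 u M -> summable2 v N -> summable2 (dconv u v) (M * N).
Proof.
  intros Hu Hv.
  set (u' := fun i j => Rabs (u i j)). set (v' := fun i j => Rabs (v i j)).
  assert (Hu' : summable2 u' M) by (apply summable2_abs; auto).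
  assert (Hv' : summable2 v' N) by (apply summable2_abs; auto).
  assert (P : forall i j, 0 <= dconv u' v' i j).
  { intros i j. apply sum_n_nonneg; intros k. apply sum_n_nonneg; intros l.
    apply Rmult_le_pos; apply Rabs_pos. }
  destruct (dconv_series u' v' M N Hu' Hv') as [E1 E2].
  assert (HL : dseries u' * dseries v' <= M * N).
  { assert (A := proj2 (summable2_rows_abs u M Hu)).
    assert (B := proj2 (summable2_rows_abs v N Hv)).
    fold u' in A. fold v' in B.
    apply Rmult_le_compat; auto; apply Series_nonneg;
      try (intros; apply Series_nonneg; [intros; apply Rabs_pos|]);
      try (eapply summable2_row; eassumption); eapply summable2_rows; eassumption. }
  intros m n. eapply Rle_trans; [|exact HL].
  assert (S1 : summable2 (dconv u' v') (dseries u' * dseries v')).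
  { assert (Q : forall i j, Rabs (dconv u' v' i j) = dconv u' v' i j)
      by (intros; apply Rabs_pos_eq, P).
    apply summable2_of_rows.
    - intros i. eapply ex_series_ext; [|apply (E1 i)]. intros; symmetry; apply Q.
    - eapply is_series_ext; [|exact E2]. intros i. apply Series_ext. intros; symmetry; apply Q. }
  revert m n. fold (summable2 (dconv u v) (dseries u' * dseries v')).
  revert S1. apply summable2_le. intros i j.
  rewrite (Rabs_pos_eq _ (P i j)).
  eapply Rle_trans; [apply Rabs_sum_n|]. apply sum_n_le; intros k _.
  eapply Rle_trans; [apply Rabs_sum_n|]. apply sum_n_le; intros l _.
  rewrite Rabs_mult. apply Rle_refl.
Qed.

(** The summation over k is moved outside by two exchanges: with j inside each row, then with i. *)
Lemma dseries_sum (v : nat -> nat -> nat -> R) (c : nat -> R) :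
  (forall k, summable2 (v k) (c k)) -> ex_series c ->
  summable2 (fun i j => Series (fun k => v k i j)) (Series c) /\
  dseries (fun i j => Series (fun k => v k i j)) = Series (fun k => dseries (v k)).
Proof.
  intros Hv Hc.
  assert (Hc0 : forall k, 0 <= c k) by (intros; eapply summable2_pos; eauto).
  assert (Ea : forall i j, ex_series (fun k => Rabs (v k i j))).
  { intros i j.
    apply (ex_series_le (V := R_CompleteNormedModule)) with (2 := Hc).
    intros k. unfold norm; simpl; unfold abs; simpl. rewrite Rabs_Rabsolu.
    apply summable2_term; auto. }
  assert (Hrow : forall i, summable2 (fun k j => v k i j) (Series c)).
  { intros i m n. apply Rle_trans with (sum_n c m).
    - apply sum_n_le; intros k _. apply summable2_row_bound; auto.
    - apply sum_n_le_Series; auto. }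
  assert (Hmid : summable2 (fun k i => Series (v k i)) (Series c)).
  { intros m n. apply Rle_trans with (sum_n c m).
    - apply sum_n_le; intros k _.
      eapply Rle_trans; [|apply (summable2_sum_rows (v k) (c k) n (Hv k))].
      apply sum_n_le; intros i _. apply Series_Rabs.
      eapply summable2_row_abs; eauto.
    - apply sum_n_le_Series; auto. }
  split.
  - intros m n.
    apply Rle_trans with
      (sum_n (fun i => Series (fun k => sum_n (fun j => Rabs (v k i j)) n)) m).
    { apply sum_n_le; intros i _.
      rewrite (is_series_unique _ _
                 (is_series_sum_n (fun j k => Rabs (v k i j)) n (Ea i))).
      apply sum_n_le; intros j _. apply Series_Rabs; auto. }
    assert (E1 : forall i, ex_series (fun k => sum_n (fun j => Rabs (v k i j)) n)).
    { intros i. eexists; apply (is_series_sum_n (fun j k => Rabs (v k i j)) n (Ea i)). }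
    rewrite <- (is_series_unique _ _
       (is_series_sum_n (fun i k => sum_n (fun j => Rabs (v k i j)) n) m E1)).
    apply Series_le; auto. intros k; split.
    + apply sum_n_nonneg; intros; apply sum_n_nonneg; intros; apply Rabs_pos.
    + apply Hv.
  - unfold dseries at 1.
    rewrite (Series_ext _ (fun i => Series (fun k => Series (v k i)))).
    + exact (dseries_swap _ _ Hmid).
    + intros i. exact (dseries_swap _ _ (Hrow i)).
Qed.

Fixpoint dpow (u : nat -> nat -> R) (n : nat) : nat -> nat -> R :=
  match n with
  | O => fun i j => match i, j with O, O => 1 | _, _ => 0 end
  | S n => dconv u (dpow u n)
  end.

Lemma sum_n_single (a : nat -> R) (n : nat) :
  (forall k, a (S k) = 0) -> sum_n a n = a 0%nat.
Proof.
  intros H. induction n as [|n IH]; [apply sum_O|].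
  rewrite sum_Sn, IH, H. unfold plus; simpl; ring.
Qed.

Lemma is_series_single (a : nat -> R) :
  (forall k, a (S k) = 0) -> is_series a (a 0%nat).
Proof.
  intros H. change (is_lim_seq (sum_n a) (a 0%nat)).
  apply (is_lim_seq_ext (fun _ => a 0%nat) (sum_n a)).
  - intros n. symmetry. apply sum_n_single; auto.
  - apply is_lim_seq_const.
Qed.

Lemma dseries_single (u : nat -> nat -> R) :
  (forall i j, u (S i) j = 0) -> (forall j, u 0%nat (S j) = 0) ->
  summable2 u (Rabs (u 0%nat 0%nat)) /\ dseries u = u 0%nat 0%nat.
Proof.
  intros H1 H2. split.
  - intros m n. rewrite sum_n_single.
    + rewrite sum_n_single; [lra|]. intros; rewrite H2. apply Rabs_R0.
    + intros i. rewrite sum_n_single; intros; rewrite H1; apply Rabs_R0.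
  - unfold dseries. rewrite (is_series_unique (fun i => Series (u i)) (Series (u 0%nat))).
    + apply is_series_unique, is_series_single; auto.
    + apply (is_series_single (fun i => Series (u i))). intros i.
      rewrite (is_series_unique (u (S i)) (u (S i) 0%nat)); auto.
      apply is_series_single; auto.
Qed.

Lemma dpow_sum (u : nat -> nat -> R) (M : R) (n : nat) :
  summable2 u M ->
  summable2 (dpow u n) (M ^ n) /\ dseries (dpow u n) = dseries u ^ n.
Proof.
  intros Hu. induction n as [|n [IH1 IH2]]; simpl.
  - destruct (dseries_single (dpow u 0)) as [A B]; auto.
    simpl in A. rewrite Rabs_R1 in A. auto.
  - split; [apply summable2_conv; auto|].
    rewrite <- IH2. eapply dseries_conv; eauto.
Qed.

(** An infinite series even for one coefficient: the constant term of [u] may be nonzero, so every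
    power of [u] can contribute at (i, j). *)
Definition dcomp (f : nat -> R) (u : nat -> nat -> R) (i j : nat) : R :=
  Series (fun n => f n * dpow u n i j).

(** The l^1 norm is submultiplicative, so the n-th power of [u] has norm at most M^n, and the sum
    over n converges because M is inside the disc of convergence. *)
Lemma dseries_comp (f : nat -> R) (u : nat -> nat -> R) (M : R) :
  summable2 u M -> Rbar_lt M (CV_radius f) ->
  summable2 (dcomp f u) (Series (fun n => Rabs (f n) * M ^ n)) /\
  dseries (dcomp f u) = PSeries f (dseries u).
Proof.
  intros Hu HM.
  assert (M0 := summable2_pos u M Hu).
  destruct (dseries_sum (fun n i j => f n * dpow u n i j)
              (fun n => Rabs (f n) * M ^ n)) as [A B].
  - intros n. apply summable2_scal. apply dpow_sum; auto.
  - rewrite <- (Rabs_pos_eq M M0) in HM.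
    apply CV_disk_inside in HM. eapply ex_series_ext; [|exact HM].
    intros n; simpl. rewrite Rabs_mult, (Rabs_pos_eq (M ^ n)); auto.
    apply pow_le; auto.
  - split; [exact A|]. unfold dcomp. rewrite B. unfold PSeries.
    apply Series_ext; intros n. rewrite dseries_scal.
    rewrite (proj2 (dpow_sum u M n Hu)). ring.
Qed.

(** * Real-analytic functions of two variables *)

(** Sums in abstract structures leave equations in a carrier that is only convertible to [C] or [R];
    restating the type lets [ring] and [field] recognise it. *)
Ltac C_eq := match goal with |- @eq _ ?x ?y => change (@eq C x y) end.
Ltac R_eq := match goal with |- @eq _ ?x ?y => change (@eq R x y) end.

Definition dscale (a : nat -> nat -> R) (x y : R) (i j : nat) : R :=
  a i j * (x ^ i * y ^ j).

Lemma Rabs_pow_le (x r : R) (i : nat) : Rabs x <= r -> Rabs (x ^ i) <= r ^ i.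
Proof. intros H. rewrite <- RPow_abs. apply pow_incr. split; auto. apply Rabs_pos. Qed.

Lemma summable2_dscale (a : nat -> nat -> R) (r M x y : R) :
  summable2 (dscale a r r) M -> Rabs x <= r -> Rabs y <= r ->
  summable2 (dscale a x y) M.
Proof.
  intros H Hx Hy. revert H. apply summable2_le. intros i j. unfold dscale.
  assert (0 <= r) by (apply Rle_trans with (2 := Hx), Rabs_pos).
  rewrite !Rabs_mult. apply Rmult_le_compat_l; [apply Rabs_pos|].
  rewrite (Rabs_pos_eq (r ^ i)), (Rabs_pos_eq (r ^ j)) by (apply pow_le; auto).
  apply Rmult_le_compat; auto using Rabs_pos, Rabs_pow_le.
Qed.

Lemma dscale_conv (a b : nat -> nat -> R) (x y : R) (i j : nat) :
  dscale (dconv a b) x y i j = dconv (dscale a x y) (dscale b x y) i j.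
Proof.
  unfold dscale, dconv. rewrite Rmult_comm, <- sum_n_Rmult_l.
  apply sum_n_ext_loc; intros k Hk. rewrite <- sum_n_Rmult_l.
  apply sum_n_ext_loc; intros l Hl.
  replace (x ^ i) with (x ^ k * x ^ (i - k)) by (rewrite <- pow_add; f_equal; lia).
  replace (y ^ j) with (y ^ l * y ^ (j - l)) by (rewrite <- pow_add; f_equal; lia).
  R_eq; ring.
Qed.

Lemma dconv_ext (u u' v v' : nat -> nat -> R) (i j : nat) :
  (forall i j, u i j = u' i j) -> (forall i j, v i j = v' i j) ->
  dconv u v i j = dconv u' v' i j.
Proof.
  intros H1 H2. apply sum_n_ext; intros k. apply sum_n_ext; intros l.
  now rewrite H1, H2.
Qed.

Lemma dscale_pow (a : nat -> nat -> R) (x y : R) (n i j : nat) :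
  dscale (dpow a n) x y i j = dpow (dscale a x y) n i j.
Proof.
  revert i j. induction n as [|n IH]; intros i j; simpl.
  - unfold dscale. destruct i as [|i], j as [|j]; simpl; ring.
  - rewrite dscale_conv. apply dconv_ext; auto.
Qed.

Lemma dscale_comp (f : nat -> R) (a : nat -> nat -> R) (x y : R) (i j : nat) :
  dscale (dcomp f a) x y i j = dcomp f (dscale a x y) i j.
Proof.
  unfold dcomp. unfold dscale at 1. rewrite <- Series_scal_r.
  apply Series_ext; intros n. rewrite <- dscale_pow. unfold dscale. ring.
Qed.

(** Unlike [analytic_at], summability is asked at the corner (r, r) itself: one bound then serves
    the whole bidisc and survives shrinking, which products and compositions rely on. *)
Definition real_analytic2 (G : R -> R -> R) (b0 t0 : R) : Prop :=
  exists (a : nat -> nat -> R) (r M : R), 0 < r /\ summable2 (dscale a r r) M /\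
    forall b t : R, Rabs (b - b0) < r -> Rabs (t - t0) < r ->
      G b t = dseries (dscale a (b - b0) (t - t0)).

Lemma real_analytic2_ext_loc (G H : R -> R -> R) (b0 t0 d : R) :
  0 < d ->
  (forall b t, Rabs (b - b0) < d -> Rabs (t - t0) < d -> H b t = G b t) ->
  real_analytic2 G b0 t0 -> real_analytic2 H b0 t0.
Proof.
  intros Hd E (a & r & M & Hr & Ha & HG).
  exists a, (Rmin r d), M. split; [apply Rmin_glb_lt; auto|split].
  - apply summable2_dscale with r; auto;
      rewrite Rabs_pos_eq by (left; apply Rmin_glb_lt; auto); apply Rmin_l.
  - intros b t Hb Ht.
    assert (A := Rmin_l r d). assert (B := Rmin_r r d).
    rewrite E by lra. apply HG; lra.
Qed.

Lemma real_analytic2_ext (G H : R -> R -> R) (b0 t0 : R) :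
  (forall b t, H b t = G b t) -> real_analytic2 G b0 t0 -> real_analytic2 H b0 t0.
Proof. intros E. apply (real_analytic2_ext_loc G H b0 t0 1); auto. lra. Qed.

Lemma real_analytic2_common (G H : R -> R -> R) (b0 t0 : R) :
  real_analytic2 G b0 t0 -> real_analytic2 H b0 t0 ->
  exists a b r M N, 0 < r /\ summable2 (dscale a r r) M /\
    summable2 (dscale b r r) N /\
    forall s t : R, Rabs (s - b0) < r -> Rabs (t - t0) < r ->
      G s t = dseries (dscale a (s - b0) (t - t0)) /\
      H s t = dseries (dscale b (s - b0) (t - t0)).
Proof.
  intros (a & r & M & Hr & Ha & HG) (b & r' & N & Hr' & Hb & HH).
  assert (P : 0 < Rmin r r') by (apply Rmin_glb_lt; auto).
  assert (A := Rmin_l r r'). assert (B := Rmin_r r r').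
  exists a, b, (Rmin r r'), M, N. split; auto. split; [|split].
  - apply summable2_dscale with r; auto; rewrite Rabs_pos_eq; lra.
  - apply summable2_dscale with r'; auto; rewrite Rabs_pos_eq; lra.
  - intros s t Hs Ht. split; [apply HG | apply HH]; lra.
Qed.

Lemma real_analytic2_plus (G H : R -> R -> R) (b0 t0 : R) :
  real_analytic2 G b0 t0 -> real_analytic2 H b0 t0 ->
  real_analytic2 (fun b t => G b t + H b t) b0 t0.
Proof.
  intros HG HH.
  destruct (real_analytic2_common G H b0 t0 HG HH)
    as (a & b & r & M & N & Hr & Ha & Hb & E).
  exists (fun i j => a i j + b i j), r, (M + N). split; auto. split.
  - eapply summable2_ext; [|apply (summable2_plus _ _ _ _ Ha Hb)].
    intros i j; unfold dscale; ring.
  - intros s t Hs Ht. destruct (E s t Hs Ht) as [-> ->].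
    rewrite <- (dseries_plus _ _ M N).
    + apply dseries_ext; intros i j; unfold dscale; ring.
    + apply summable2_dscale with r; auto; lra.
    + apply summable2_dscale with r; auto; lra.
Qed.

Lemma real_analytic2_mult (G H : R -> R -> R) (b0 t0 : R) :
  real_analytic2 G b0 t0 -> real_analytic2 H b0 t0 ->
  real_analytic2 (fun b t => G b t * H b t) b0 t0.
Proof.
  intros HG HH.
  destruct (real_analytic2_common G H b0 t0 HG HH)
    as (a & b & r & M & N & Hr & Ha & Hb & E).
  exists (dconv a b), r, (M * N). split; auto. split.
  - eapply summable2_ext; [apply dscale_conv|]. apply summable2_conv; auto.
  - intros s t Hs Ht. destruct (E s t Hs Ht) as [-> ->].
    rewrite <- (dseries_conv _ _ M N).
    + apply dseries_ext; intros i j. symmetry; apply dscale_conv.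
    + apply summable2_dscale with r; auto; lra.
    + apply summable2_dscale with r; auto; lra.
Qed.

Definition delta (p : nat) (c : R) (i : nat) : R := if Nat.eqb i p then c else 0.

Lemma is_series_delta (p : nat) (c : R) : is_series (delta p c) c.
Proof.
  induction p as [|p IH].
  - change c with (delta 0 c 0) at 2. apply is_series_single. reflexivity.
  - apply is_series_decr_1. unfold delta; simpl.
    change (is_series (delta p c) (c + - 0)). now rewrite Ropp_0, Rplus_0_r.
Qed.

Lemma delta_pos (p i : nat) (c : R) : 0 <= c -> 0 <= delta p c i.
Proof. unfold delta; destruct (Nat.eqb i p); lra. Qed.

Lemma delta2_sum (p q : nat) (c : R) (u : nat -> nat -> R) :
  (forall i j, u i j = delta p (delta q c j) i) ->
  summable2 u (Rabs c) /\ dseries u = c.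
Proof.
  intros H. split.
  - intros m n.
    assert (D : forall p c i, Rabs (delta p c i) = delta p (Rabs c) i).
    { intros p' c' i. unfold delta. destruct (Nat.eqb i p'); auto using Rabs_R0. }
    assert (B : forall p c n, 0 <= c -> sum_n (delta p c) n <= c).
    { intros p' c' n' Hc. rewrite <- (is_series_unique _ _ (is_series_delta p' c')) at 2.
      apply sum_n_le_Series; [intros; apply delta_pos; auto|].
      eexists; apply is_series_delta. }
    apply Rle_trans with (2 := B p _ m (Rabs_pos c)). apply sum_n_le; intros i _.
    unfold delta at 1. destruct (Nat.eqb i p) eqn:E.
    + apply Rle_trans with (2 := B q _ n (Rabs_pos c)). apply sum_n_le; intros j _.
      rewrite H. unfold delta at 1. rewrite E, D. lra.
    + right. rewrite (sum_n_ext _ (fun _ => 0)).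
      * rewrite sum_n_const; ring.
      * intros j. rewrite H. unfold delta. rewrite E. apply Rabs_R0.
  - unfold dseries. rewrite (Series_ext _ (delta p c)).
    + apply is_series_unique, is_series_delta.
    + intros i. rewrite (Series_ext _ (delta q (delta p c i))).
      * apply is_series_unique, is_series_delta.
      * intros j. rewrite H. unfold delta.
        destruct (Nat.eqb i p), (Nat.eqb j q); auto.
Qed.

Lemma real_analytic2_monomial (p q : nat) (c b0 t0 : R) :
  real_analytic2 (fun b t => c * ((b - b0) ^ p * (t - t0) ^ q)) b0 t0.
Proof.
  assert (E : forall x y i j, dscale (fun i j => delta p (delta q c j) i) x y i j =
              delta p (delta q (c * (x ^ p * y ^ q)) j) i).
  { intros x y i j. unfold dscale, delta.
    destruct (Nat.eqb i p) eqn:E1; destruct (Nat.eqb j q) eqn:E2; try ring.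
    apply Nat.eqb_eq in E1, E2. subst; auto. }
  exists (fun i j => delta p (delta q c j) i), 1, (Rabs (c * (1 ^ p * 1 ^ q))).
  split; [lra|split].
  - eapply delta2_sum. apply E.
  - intros b t _ _. symmetry. eapply delta2_sum. apply E.
Qed.

Lemma real_analytic2_const (c b0 t0 : R) : real_analytic2 (fun _ _ => c) b0 t0.
Proof.
  eapply real_analytic2_ext; [|apply (real_analytic2_monomial 0 0 c)].
  intros; simpl; ring.
Qed.

Lemma real_analytic2_fst (b0 t0 : R) : real_analytic2 (fun b _ => b) b0 t0.
Proof.
  eapply real_analytic2_ext;
    [|apply (real_analytic2_plus _ _ b0 t0 (real_analytic2_const b0 b0 t0)
               (real_analytic2_monomial 1 0 1 b0 t0))].
  intros; simpl; ring.
Qed.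

Lemma real_analytic2_snd (b0 t0 : R) : real_analytic2 (fun _ t => t) b0 t0.
Proof.
  eapply real_analytic2_ext;
    [|apply (real_analytic2_plus _ _ b0 t0 (real_analytic2_const t0 b0 t0)
               (real_analytic2_monomial 0 1 1 b0 t0))].
  intros; simpl; ring.
Qed.

Lemma real_analytic2_scal (c : R) (G : R -> R -> R) (b0 t0 : R) :
  real_analytic2 G b0 t0 -> real_analytic2 (fun b t => c * G b t) b0 t0.
Proof. intros. apply real_analytic2_mult; auto. apply real_analytic2_const. Qed.

Lemma real_analytic2_pow (G : R -> R -> R) (n : nat) (b0 t0 : R) :
  real_analytic2 G b0 t0 -> real_analytic2 (fun b t => G b t ^ n) b0 t0.
Proof.
  intros H. induction n as [|n IH]; simpl.
  - apply real_analytic2_const.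
  - apply real_analytic2_mult; auto.
Qed.

Lemma real_analytic2_sum_n (G : nat -> R -> R -> R) (n : nat) (b0 t0 : R) :
  (forall i, real_analytic2 (G i) b0 t0) ->
  real_analytic2 (fun b t => sum_n (fun i => G i b t) n) b0 t0.
Proof.
  intros H. induction n as [|n IH].
  - eapply real_analytic2_ext; [|apply (H 0%nat)]. intros; now rewrite sum_O.
  - eapply real_analytic2_ext; [|apply (real_analytic2_plus _ _ _ _ IH (H (S n)))].
    intros; now rewrite sum_Sn.
Qed.

(* The constant term of the Taylor array is the value at the centre, and the
   remaining terms are O(r'), so the l^1 norm on a small bidisc is close to the
   modulus of that value. *)
Lemma summable2_small (a : nat -> nat -> R) (r M e : R) :
  0 < r -> 0 < e -> summable2 (dscale a r r) M ->
  exists r', 0 < r' <= r /\ summable2 (dscale a r' r') (Rabs (a 0%nat 0%nat) + e).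
Proof.
  intros Hr He Ha. assert (M0 := summable2_pos _ _ Ha).
  set (th := Rmin 1 (e / (M + 1))).
  assert (T0 : 0 < th).
  { apply Rmin_glb_lt; [lra|]. apply Rdiv_lt_0_compat; lra. }
  assert (T1 : th <= 1) by apply Rmin_l.
  assert (T2 : th * M <= e).
  { apply Rle_trans with (e / (M + 1) * M).
    - apply Rmult_le_compat_r; auto. apply Rmin_r.
    - apply Rmult_le_reg_r with (M + 1); [lra|].
      replace (e / (M + 1) * M * (M + 1)) with (e * M) by (field; lra). nra. }
  exists (th * r). split; [nra|].
  destruct (delta2_sum 0 0 (a 0%nat 0%nat) _ (fun i j => eq_refl)) as [D _].
  assert (P := summable2_plus _ _ _ _ (summable2_abs _ _ D)
                 (summable2_abs _ _ (summable2_scal th _ _ Ha))).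
  rewrite (Rabs_pos_eq th) in P by lra.
  intros m n. apply Rle_trans with (Rabs (a 0%nat 0%nat) + th * M); [|lra].
  revert m n. fold (summable2 (dscale a (th * r) (th * r)) (Rabs (a 0%nat 0%nat) + th * M)).
  revert P. apply summable2_le. intros i j.
  rewrite (Rabs_pos_eq (_ + _)) by
    (apply Rplus_le_le_0_compat; apply Rabs_pos).
  unfold dscale. rewrite !Rpow_mult_distr.
  replace (a i j * (th ^ i * r ^ i * (th ^ j * r ^ j))) with
    (th ^ (i + j) * (a i j * (r ^ i * r ^ j))) by (rewrite pow_add; ring).
  rewrite (Rabs_mult (th ^ (i + j))), (Rabs_mult th), (Rabs_pos_eq (th ^ (i + j))),
    (Rabs_pos_eq th) by (try apply pow_le; lra).
  set (z := Rabs (a i j * (r ^ i * r ^ j))).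
  assert (Hz : 0 <= z) by apply Rabs_pos.
  destruct (i + j)%nat as [|k] eqn:E.
  - assert (i = 0%nat) by lia. assert (j = 0%nat) by lia. subst.
    unfold z, delta; simpl. rewrite !Rmult_1_r. fold z.
    assert (0 <= th * Rabs (a 0%nat 0%nat)) by (apply Rmult_le_pos; [lra|apply Rabs_pos]).
    lra.
  - assert (th ^ S k <= th).
    { simpl. assert (th ^ k <= 1).
      { rewrite <- (pow1 k). apply pow_incr; lra. }
      assert (0 <= th ^ k) by (apply pow_le; lra). nra. }
    assert (0 <= Rabs (delta 0 (delta 0 (a 0%nat 0%nat) j) i)) by apply Rabs_pos.
    nra.
Qed.

(** Only the value at the centre is compared with the radius of convergence: on a small bidisc the
    l^1 norm of the Taylor array of [G] exceeds the modulus of that value by as little as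
    desired. *)
Lemma real_analytic2_PSeries (f : nat -> R) (G : R -> R -> R) (b0 t0 : R) :
  real_analytic2 G b0 t0 -> Rbar_lt (Rabs (G b0 t0)) (CV_radius f) ->
  real_analytic2 (fun b t => PSeries f (G b t)) b0 t0.
Proof.
  intros (a & r & M & Hr & Ha & HG) Hf.
  assert (E0 : G b0 t0 = a 0%nat 0%nat).
  { rewrite HG by (rewrite Rminus_diag, Rabs_R0; auto). rewrite !Rminus_diag.
    destruct (dseries_single (dscale a 0 0)) as [_ ->].
    - intros; unfold dscale; simpl; ring.
    - intros; unfold dscale; simpl; ring.
    - unfold dscale; simpl; ring. }
  rewrite E0 in Hf.
  assert (Ee : exists e, 0 < e /\ Rbar_lt (Rabs (a 0%nat 0%nat) + e) (CV_radius f)).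
  { destruct (CV_radius f) as [c| |]; simpl in Hf |- *.
    - exists ((c - Rabs (a 0%nat 0%nat)) / 2). split; lra.
    - exists 1. split; auto; lra.
    - contradiction. }
  destruct Ee as (e & He & Hlt).
  destruct (summable2_small a r M e Hr He Ha) as (r' & Hr' & Ha').
  destruct (dseries_comp f _ _ Ha' Hlt) as [S _].
  exists (dcomp f a), r', (Series (fun n => Rabs (f n) * (Rabs (a 0%nat 0%nat) + e) ^ n)).
  split; [lra|split].
  - eapply summable2_ext; [apply dscale_comp | exact S].
  - intros b t Hb Ht. rewrite HG by lra.
    rewrite (dseries_ext _ _ (dscale_comp f a (b - b0) (t - t0))).
    symmetry. eapply dseries_comp; [|exact Hlt].
    apply summable2_dscale with r'; auto; lra.
Qed.

(** * Reduction of complex limits, series and derivatives to real and imaginary parts *)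

Lemma Re_sum_n (u : nat -> C) (n : nat) :
  Re (sum_n u n) = sum_n (fun i => Re (u i)) n.
Proof. induction n as [|n IH]; [now rewrite !sum_O | rewrite !sum_Sn, <- IH; reflexivity]. Qed.

Lemma Im_sum_n (u : nat -> C) (n : nat) :
  Im (sum_n u n) = sum_n (fun i => Im (u i)) n.
Proof. induction n as [|n IH]; [now rewrite !sum_O | rewrite !sum_Sn, <- IH; reflexivity]. Qed.

Lemma filterlim_C {T : Type} (F : (T -> Prop) -> Prop) {FF : Filter F}
  (f : T -> C) (l : C) :
  filterlim f F (locally (l : C_R_NormedModule)) <->
  filterlim (fun x => Re (f x)) F (locally (Re l)) /\
  filterlim (fun x => Im (f x)) F (locally (Im l)).
Proof.
  split.
  - intros H. split; apply filterlim_locally; intros eps;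
      generalize (proj1 (filterlim_locally (U := C_R_NormedModule) _ _) H eps);
      apply filter_imp; intros x [H1 H2]; assumption.
  - intros [H1 H2]. apply filterlim_locally. intros eps.
    generalize (filter_and _ _ (proj1 (filterlim_locally _ _) H1 eps)
                  (proj1 (filterlim_locally _ _) H2 eps)).
    apply filter_imp. intros x [A B]. split; assumption.
Qed.

Lemma is_series_C (u : nat -> C) (l : C) :
  is_series (V := C_R_NormedModule) u l <->
  is_series (fun n => Re (u n)) (Re l) /\ is_series (fun n => Im (u n)) (Im l).
Proof.
  unfold is_series. etransitivity; [apply (filterlim_C eventually)|].
  split; intros [A B]; split.
  - eapply filterlim_ext; [|exact A]. intros n. apply (Re_sum_n u n).
  - eapply filterlim_ext; [|exact B]. intros n. apply (Im_sum_n u n).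
  - eapply filterlim_ext; [|exact A]. intros n. symmetry. apply (Re_sum_n u n).
  - eapply filterlim_ext; [|exact B]. intros n. symmetry. apply (Im_sum_n u n).
Qed.

Lemma is_derive_C (g : R -> C) (x : R) (l : C) :
  is_derive (V := C_R_NormedModule) g x l <->
  is_derive (fun s => Re (g s)) x (Re l) /\ is_derive (fun s => Im (g s)) x (Im l).
Proof.
  split.
  - intros H. split.
    + apply (filterdiff_ext_lin (K := R_AbsRing) (U := R_NormedModule) (V := R_NormedModule)
               _ (fun y : R => fst (scal y (l : C_R_NormedModule)))).
      * apply (filterdiff_comp' (U := R_NormedModule) (V := C_R_NormedModule)
                 (W := R_NormedModule) g (fun z : C_R_NormedModule => fst z)); auto.
        apply filterdiff_linear, is_linear_fst.
      * reflexivity.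
    + apply (filterdiff_ext_lin (K := R_AbsRing) (U := R_NormedModule) (V := R_NormedModule)
               _ (fun y : R => snd (scal y (l : C_R_NormedModule)))).
      * apply (filterdiff_comp' (U := R_NormedModule) (V := C_R_NormedModule)
                 (W := R_NormedModule) g (fun z : C_R_NormedModule => snd z)); auto.
        apply filterdiff_linear, is_linear_snd.
      * reflexivity.
  - intros [H1 H2].
    (* The converse recombines the parts as Re g times 1 plus Im g times i. *)
    assert (H := is_derive_plus (V := C_R_NormedModule) _ _ _ _ _
      (is_derive_scal_l (V := C_R_NormedModule) _ _ _ ((1, 0) : C) H1)
      (is_derive_scal_l (V := C_R_NormedModule) _ _ _ ((0, 1) : C) H2)).
    assert (E : forall z : C, plus (scal (Re z) (((1, 0) : C) : C_R_NormedModule))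
        (scal (Im z) (((0, 1) : C) : C_R_NormedModule)) = z).
    { intros [a b]. unfold plus, scal; simpl. unfold prod_plus, prod_scal; simpl.
      unfold plus, scal; simpl. unfold mult; simpl. f_equal; ring. }
    rewrite E in H. eapply is_derive_ext; [|exact H]. intros t. apply E.
Qed.

Lemma Rabs_Re_le_Cmod (z : C) : Rabs (Re z) <= Cmod z.
Proof. eapply Rle_trans; [apply Rmax_l | apply Rmax_Cmod]. Qed.

Lemma Rabs_Im_le_Cmod (z : C) : Rabs (Im z) <= Cmod z.
Proof. eapply Rle_trans; [apply Rmax_r | apply Rmax_Cmod]. Qed.

Lemma Cmod_le_Rabs (z : C) : Cmod z <= Rabs (Re z) + Rabs (Im z).
Proof.
  destruct z as [a b]. simpl.
  replace (a, b) with (Cplus (RtoC a) (Cmult Ci (RtoC b)))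
    by (unfold RtoC, Ci, Cplus, Cmult; simpl; f_equal; ring).
  eapply Rle_trans; [apply Cmod_triangle|].
  rewrite Cmod_mult, !Cmod_R.
  replace (Cmod Ci) with 1; [lra|].
  rewrite <- sqrt_1. unfold Cmod, Ci. f_equal. simpl. ring.
Qed.

(** The limit along squares in the definition is traded for iterated sums by [is_lim_square],
    applied to each part. *)
Lemma is_double_series_C (u : nat -> nat -> C) (l : C) :
  is_double_series u l <->
  exists M, summable2 (fun i j => Re (u i j)) M /\
    summable2 (fun i j => Im (u i j)) M /\
    Re l = dseries (fun i j => Re (u i j)) /\ Im l = dseries (fun i j => Im (u i j)).
Proof.
  assert (Hre : forall n, Re (sum_n (fun i => sum_n (fun j => u i j) n) n) =
                sum_n (fun i => sum_n (fun j => Re (u i j)) n) n).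
  { intros n. rewrite Re_sum_n. apply sum_n_ext; intros i. apply Re_sum_n. }
  assert (Him : forall n, Im (sum_n (fun i => sum_n (fun j => u i j) n) n) =
                sum_n (fun i => sum_n (fun j => Im (u i j)) n) n).
  { intros n. rewrite Im_sum_n. apply sum_n_ext; intros i. apply Im_sum_n. }
  split.
  - intros [[M HM] HL]. apply (filterlim_C eventually) in HL. destruct HL as [H1 H2].
    assert (A : summable2 (fun i j => Re (u i j)) M).
    { intros m n. eapply Rle_trans; [|apply (HM m n)].
      apply sum_n_le; intros i _; apply sum_n_le; intros j _. apply Rabs_Re_le_Cmod. }
    assert (B : summable2 (fun i j => Im (u i j)) M).
    { intros m n. eapply Rle_trans; [|apply (HM m n)].
      apply sum_n_le; intros i _; apply sum_n_le; intros j _. apply Rabs_Im_le_Cmod. }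
    exists M. split; [|split; [|split]]; auto.
    + assert (L := is_lim_square _ _ A). assert (L' : is_lim_seq
        (fun n => sum_n (fun i => sum_n (fun j => Re (u i j)) n) n) (Re l)).
      { eapply filterlim_ext; [|exact H1]. exact Hre. }
      apply is_lim_seq_unique in L, L'. rewrite L in L'. injection L'; auto.
    + assert (L := is_lim_square _ _ B). assert (L' : is_lim_seq
        (fun n => sum_n (fun i => sum_n (fun j => Im (u i j)) n) n) (Im l)).
      { eapply filterlim_ext; [|exact H2]. exact Him. }
      apply is_lim_seq_unique in L, L'. rewrite L in L'. injection L'; auto.
  - intros (M & A & B & E1 & E2). split.
    + exists (M + M). intros m n.
      apply Rle_trans with
        (plus (sum_n (fun i => sum_n (fun j => Rabs (Re (u i j))) n) m)
           (sum_n (fun i => sum_n (fun j => Rabs (Im (u i j))) n) m)).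
      * rewrite <- sum_n_plus. apply sum_n_le; intros i _.
        rewrite <- sum_n_plus. apply sum_n_le; intros j _. apply Cmod_le_Rabs.
      * apply Rplus_le_compat; auto.
    + apply (filterlim_C eventually). rewrite E1, E2. split.
      * eapply filterlim_ext; [intros n; symmetry; apply Hre|].
        exact (is_lim_square _ _ A).
      * eapply filterlim_ext; [intros n; symmetry; apply Him|].
        exact (is_lim_square _ _ B).
Qed.

Lemma analytic_at_of_real (G : R -> R -> C) (b0 t0 : R) :
  real_analytic2 (fun b t => Re (G b t)) b0 t0 ->
  real_analytic2 (fun b t => Im (G b t)) b0 t0 -> analytic_at G b0 t0.
Proof.
  intros HG HH.
  destruct (real_analytic2_common _ _ b0 t0 HG HH)
    as (a & b & r & M & N & Hr & Ha & Hb & E).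
  exists (fun i j => (a i j, b i j)), r. split; auto. intros s t Hs Ht.
  destruct (E s t Hs Ht) as [E1 E2].
  apply is_double_series_C. exists (Rmax M N).
  assert (R1 : forall i j, Re (Cmult (a i j, b i j) (RtoC ((s - b0) ^ i * (t - t0) ^ j))) =
               dscale a (s - b0) (t - t0) i j).
  { intros; unfold dscale; simpl; ring. }
  assert (R2 : forall i j, Im (Cmult (a i j, b i j) (RtoC ((s - b0) ^ i * (t - t0) ^ j))) =
               dscale b (s - b0) (t - t0) i j).
  { intros; unfold dscale; simpl; ring. }
  split; [|split; [|split]].
  - apply summable2_ext with (1 := R1). intros m n.
    apply Rle_trans with M; [|apply Rmax_l].
    apply (summable2_dscale a r M); auto; lra.
  - apply summable2_ext with (1 := R2). intros m n.
    apply Rle_trans with N; [|apply Rmax_r].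
    apply (summable2_dscale b r N); auto; lra.
  - rewrite E1. symmetry. apply dseries_ext, R1.
  - rewrite E2. symmetry. apply dseries_ext, R2.
Qed.

(** * Uniqueness of analytic solutions *)

Lemma CV_radius_ge (a : nat -> R) (r M : R) :
  (forall n, Rabs (a n * r ^ n) <= M) -> Rbar_le r (CV_radius a).
Proof. intros H. apply (proj1 (CV_radius_bounded a)). exists M. exact H. Qed.

Lemma CV_radius_pos_of_ex_series (a : nat -> R) (r : R) :
  0 < r -> ex_series (fun n => a n * r ^ n) -> Rbar_lt 0 (CV_radius a).
Proof.
  intros Hr H. apply ex_series_lim_0 in H.
  assert (H' : is_lim_seq (fun n => a n * r ^ n) (Finite 0)) by exact H.
  destruct (filterlim_bounded (fun n => a n * r ^ n)) as [M HM].
  { exists 0. exact H'. }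
  apply Rbar_lt_le_trans with r; [exact Hr|]. apply CV_radius_ge with M. exact HM.
Qed.

(** Connectedness of the line: the supremum of the times below x up to which [P] holds satisfies [P]
    by closedness, and openness would let it be passed if it were smaller than x. Negative times
    follow by reflection. *)
Lemma clopen_R (P : R -> Prop) :
  P 0 ->
  (forall b, P b -> exists r, 0 < r /\ forall s, Rabs (s - b) < r -> P s) ->
  (forall b, (forall r, 0 < r -> exists s, Rabs (s - b) < r /\ P s) -> P b) ->
  forall b, P b.
Proof.
  assert (Hpos : forall P : R -> Prop, P 0 ->
    (forall b, P b -> exists r, 0 < r /\ forall s, Rabs (s - b) < r -> P s) ->
    (forall b, (forall r, 0 < r -> exists s, Rabs (s - b) < r /\ P s) -> P b) ->
    forall b, 0 <= b -> P b).
  { clear P. intros P P0 Ho Hc x Hx.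
    set (E := fun b => 0 <= b <= x /\ forall s, 0 <= s <= b -> P s).
    destruct (completeness E) as [m [Hm1 Hm2]].
    - exists x. intros b [[_ Hb] _]. exact Hb.
    - exists 0. split; [lra|]. intros s Hs. replace s with 0 by lra. exact P0.
    - assert (m0 : 0 <= m).
      { apply Hm1. split; [lra|]. intros s Hs. replace s with 0 by lra. exact P0. }
      assert (mx : m <= x) by (apply Hm2; intros b [[_ Hb] _]; exact Hb).
      assert (Hnear : forall r, 0 < r -> exists b, E b /\ m - r < b <= m).
      { intros r Hr. apply Classical_Prop.NNPP. intros Hn.
        assert (m <= m - r); [|lra]. apply Hm2. intros b Hb.
        apply Rnot_lt_le. intros Hlt. apply Hn. exists b. split; auto. }
      assert (Pm : P m).
      { apply Hc. intros r Hr. destruct (Hnear r Hr) as (b & [Hb1 Hb2] & Hb3).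
        exists b. split; [apply Rabs_def1; lra|]. apply Hb2; lra. }
      assert (Pall : forall s, 0 <= s <= m -> P s).
      { intros s Hs. destruct (Req_dec s m) as [->|Hne]; auto.
        destruct (Hnear (m - s)) as (b & [Hb1 Hb2] & Hb3); [lra|].
        apply Hb2; lra. }
      destruct (Req_dec m x) as [<-|Hne]; auto. exfalso.
      destruct (Ho m Pm) as (r & Hr & HP).
      set (d := Rmin (r / 2) (x - m)).
      assert (d <= r / 2) by apply Rmin_l. assert (d <= x - m) by apply Rmin_r.
      assert (0 < d) by (apply Rmin_glb_lt; lra).
      assert (m + d <= m); [|lra]. apply Hm1. split; [lra|].
      intros s Hs. destruct (Rle_dec s m) as [Hsm|Hsm]; [apply Pall; lra|].
      apply HP. apply Rabs_def1; lra. }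
  intros P0 Ho Hc b. destruct (Rle_dec 0 b) as [Hb|Hb]; [apply Hpos; auto|].
  replace b with (- - b) by ring.
  apply (Hpos (fun s => P (- s))); try lra.
  - rewrite Ropp_0; auto.
  - intros s Hs. destruct (Ho _ Hs) as (r & Hr & HP). exists r. split; auto.
    intros t Ht. apply HP. replace (- t - - s) with (- (t - s)) by ring.
    now rewrite Rabs_Ropp.
  - intros s Hs. apply Hc. intros r Hr. destruct (Hs r Hr) as (t & Ht & HP).
    exists (- t). split; auto. replace (- t - - s) with (- (t - s)) by ring.
    now rewrite Rabs_Ropp.
Qed.

(** * Solutions of tridiagonal systems *)

Definition prevR (h : nat -> R) (x : nat) : R :=
  match x with O => 0 | S y => h y end.

(** A Jacobi (tridiagonal) matrix with zero diagonal, the common shape of all the operators -p X^+ +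
    q X^-. Its entries are real, so real and imaginary parts of a solution evolve separately. *)
Definition jacobi (u v : nat -> R) (h : nat -> R) (x : nat) : R :=
  u x * h (S x) + v x * prevR h x.

Definition jacobi_op (u v : nat -> R) : op nat :=
  fun f x => Cplus (Cmult (RtoC (u x)) (f (S x))) (Cmult (RtoC (v x)) (prev f x)).

Lemma Re_jacobi_op (u v : nat -> R) (f : nat -> C) (x : nat) :
  Re (jacobi_op u v f x) = jacobi u v (fun y => Re (f y)) x.
Proof. unfold jacobi_op, jacobi, Re, Im. destruct x; simpl; ring. Qed.

Lemma Im_jacobi_op (u v : nat -> R) (f : nat -> C) (x : nat) :
  Im (jacobi_op u v f x) = jacobi u v (fun y => Im (f y)) x.
Proof. unfold jacobi_op, jacobi, Re, Im. destruct x; simpl; ring. Qed.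

Lemma is_derive_jacobi (u v : nat -> R) (h : R -> nat -> R) (dh : nat -> R) (b : R) :
  (forall x, is_derive (fun s => h s x) b (dh x)) ->
  forall x, is_derive (fun s => jacobi u v (h s) x) b (jacobi u v dh x).
Proof.
  intros H x. unfold jacobi.
  apply (is_derive_plus (V := R_NormedModule)).
  - apply is_derive_scal, H.
  - apply is_derive_scal. destruct x as [|x]; simpl; [|apply H].
    apply (is_derive_const (V := R_NormedModule)).
Qed.

Definition jacobi_solution (u v : nat -> R) (h : R -> nat -> R) : Prop :=
  forall b x, is_derive (fun s => h s x) b (jacobi u v (h b) x).

Lemma Derive_n_jacobi (u v : nat -> R) (h : R -> nat -> R) (m : nat) (b : R) (x : nat) :
  jacobi_solution u v h ->
  Derive_n (fun s => h s x) m b = Nat.iter m (jacobi u v) (h b) x.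
Proof.
  intros H.
  assert (D : forall m b x, is_derive (fun s => Nat.iter m (jacobi u v) (h s) x) b
                              (Nat.iter (S m) (jacobi u v) (h b) x)).
  { induction m0 as [|n IH]; intros b' x'; [apply H|].
    apply (is_derive_jacobi u v (fun s => Nat.iter n (jacobi u v) (h s))).
    intros y. apply IH. }
  revert b. induction m as [|m IH]; intros b; [reflexivity|].
  simpl Derive_n. rewrite (Derive_ext _ (fun s => Nat.iter m (jacobi u v) (h s) x)).
  - apply is_derive_unique, D.
  - intros t; apply IH.
Qed.

(** The radius r is chosen before x: agreement of two solutions at one time has to spread to a
    neighbourhood common to all components. *)
Definition locally_power_series (h : R -> nat -> R) : Prop :=
  forall b0, exists (c : nat -> nat -> R) (r : R), 0 < r /\
    forall x, Rbar_lt 0 (CV_radius (c x)) /\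
      forall b, Rabs (b - b0) < r -> h b x = PSeries (c x) (b - b0).

Lemma power_series_coef (h : R -> nat -> R) (u v : nat -> R) (c : nat -> R)
  (b0 r : R) (x m : nat) :
  jacobi_solution u v h -> 0 < r -> Rbar_lt 0 (CV_radius c) ->
  (forall b, Rabs (b - b0) < r -> h b x = PSeries c (b - b0)) ->
  c m = Nat.iter m (jacobi u v) (h b0) x / INR (fact m).
Proof.
  intros H Hr Hc E.
  rewrite <- (Derive_n_jacobi u v h m b0 x H).
  assert (D := Derive_n_coef c m Hc).
  rewrite (Derive_n_ext_loc _ (fun s => h (s + b0) x)) in D.
  - assert (T := Derive_n_comp_trans (fun s => h s x) m 0 b0). cbv beta in T.
    rewrite Rplus_0_l in T. rewrite <- T. R_eq. etransitivity; [|apply (f_equal (fun z => z / INR (fact m)) (eq_sym D))].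
    field. apply INR_fact_neq_0.
  - assert (Q : forall y : R, y + b0 - b0 = y) by (intros; ring).
    exists (mkposreal r Hr). intros y Hy. rewrite E.
    + now rewrite Q.
    + rewrite Q, <- (Rminus_0_r y). exact Hy.
Qed.

(* At a time where the two solutions agree all their time derivatives agree, since
   these are powers of the operator applied to the common value; hence the
   set of such times is open. *)
Lemma jacobi_solution_unique (u v : nat -> R) (h1 h2 : R -> nat -> R) :
  jacobi_solution u v h1 -> jacobi_solution u v h2 ->
  locally_power_series h1 -> locally_power_series h2 ->
  (forall x, h1 0 x = h2 0 x) -> forall b x, h1 b x = h2 b x.
Proof.
  intros S1 S2 L1 L2 H0.
  apply (clopen_R (fun b => forall x, h1 b x = h2 b x)); auto.
  - intros b Hb.
    destruct (L1 b) as (c1 & r1 & Hr1 & E1). destruct (L2 b) as (c2 & r2 & Hr2 & E2).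
    exists (Rmin r1 r2). split; [apply Rmin_glb_lt; auto|].
    intros s Hs x. assert (A := Rmin_l r1 r2). assert (B := Rmin_r r1 r2).
    destruct (E1 x) as [C1 F1]. destruct (E2 x) as [C2 F2].
    rewrite F1, F2 by lra. apply PSeries_ext. intros m.
    rewrite (power_series_coef h1 u v (c1 x) b r1 x m); auto.
    rewrite (power_series_coef h2 u v (c2 x) b r2 x m); auto.
    replace (h1 b) with (h2 b); auto. apply functional_extensionality; auto.
  - intros b Hb x. apply Classical_Prop.NNPP. intros Hne.
    (* Closedness: if the difference is nonzero at b, continuity keeps it within |d b| of d b, hence
       away from 0, at all nearby times. *)
    set (d := fun s => h1 s x - h2 s x).
    assert (Cd : continuous d b).
    { apply (continuous_minus (V := R_NormedModule) (fun s => h1 s x) (fun s => h2 s x));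
        apply ex_derive_continuous; eexists; [apply S1 | apply S2]. }
    assert (Hd : 0 < Rabs (d b)) by (apply Rabs_pos_lt; unfold d; lra).
    destruct (proj1 (filterlim_locally _ _) Cd (mkposreal _ Hd)) as [r Hr].
    destruct (Hb r (cond_pos r)) as (s & Hs & Es).
    specialize (Hr s Hs). unfold ball in Hr; simpl in Hr. unfold AbsRing_ball in Hr.
    unfold abs, minus, plus, opp in Hr; simpl in Hr.
    replace (d s) with 0 in Hr by (unfold d; rewrite Es; ring).
    rewrite Rplus_0_l, Rabs_Ropp in Hr. lra.
Qed.

(* Comparing the coefficients of t^x in the generating function and in its
   Taylor expansion around (b0, 0), summed over the powers of b - b0 first. *)
Lemma coefficients_power_series (w : nat -> R) (g : R -> nat -> R) (b0 d r : R)
  (G : R -> R -> R) (a : nat -> nat -> R) :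
  (forall x, w x <> 0) -> 0 < d -> 0 < r ->
  (forall b t, Rabs (b - b0) < d -> Rabs t < d ->
     is_series (fun y => g b y * (w y * t ^ y)) (G b t)) ->
  (forall b t, Rabs (b - b0) < r -> Rabs t < r ->
     exists M, summable2 (dscale a (b - b0) t) M /\ G b t = dseries (dscale a (b - b0) t)) ->
  exists (c : nat -> nat -> R) (r : R), 0 < r /\
    forall x, Rbar_lt 0 (CV_radius (c x)) /\
      forall b, Rabs (b - b0) < r -> g b x = PSeries (c x) (b - b0).
Proof.
  intros Hw Hd Hr HS HG.
  exists (fun x m => a m x * / w x), (Rmin d r).
  assert (Rm := Rmin_l d r). assert (Rm' := Rmin_r d r).
  assert (R0 : 0 < Rmin d r) by (apply Rmin_glb_lt; auto).
  split; auto. intros x. split.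
  - destruct (HG (b0 + r / 2) (r / 2)) as (M & HM & _).
    + rewrite Rabs_pos_eq; lra.
    + rewrite Rabs_pos_eq; lra.
    + replace (b0 + r / 2 - b0) with (r / 2) in HM by ring.
      assert (P : 0 < r / 2) by lra.
      apply Rbar_lt_le_trans with (r / 2); [exact P|].
      apply CV_radius_ge with (M * Rabs (/ w x * / (r / 2) ^ x)). intros n.
      assert (Q := summable2_term _ _ n x HM). unfold dscale in Q.
      replace (a n x * / w x * (r / 2) ^ n) with
        (a n x * ((r / 2) ^ n * (r / 2) ^ x) * (/ w x * / (r / 2) ^ x)).
      * rewrite Rabs_mult. apply Rmult_le_compat_r; auto. apply Rabs_pos.
      * field. split; auto. apply pow_nonzero; lra.
  - intros b Hb.
    set (C := fun y => Series (fun m => a m y * (b - b0) ^ m)).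
    assert (E : g b x * w x = C x).
    { assert (HC : forall t, Rabs t < r -> is_series (fun y => C y * t ^ y) (G b t)).
      { intros t Ht. destruct (HG b t) as (M & HM & EG); auto; [lra|].
        rewrite EG, <- (dseries_swap _ _ HM).
        assert (HM' := summable2_swap _ _ HM).
        eapply is_series_ext; [|apply Series_correct, (summable2_rows _ _ HM')].
        intros y. unfold C. rewrite <- Series_scal_r.
        apply Series_ext; intros m. unfold dscale; ring. }
      assert (E1 : forall t, Rabs t < Rmin d r ->
        PSeries (fun y => g b y * w y) t = PSeries C t).
      { intros t Ht.
        rewrite (is_series_unique _ _ (HC t ltac:(lra)) : PSeries C t = _).
        apply is_series_unique. eapply is_series_ext; [|apply HS; lra].
        intros y. unfold Re, Im; simpl; ring. }
      set (t1 := Rmin d r / 2).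
      assert (T1 : Rabs t1 < Rmin d r) by (unfold t1; rewrite Rabs_pos_eq; lra).
      assert (T0 : 0 < t1) by (unfold t1; lra).
      apply (PSeries_ext_recip (fun y => g b y * w y) C x).
      - apply (CV_radius_pos_of_ex_series _ t1 T0). exists (G b t1).
        eapply is_series_ext; [|apply HS; lra]. intros y. unfold Re, Im; simpl; ring.
      - apply (CV_radius_pos_of_ex_series _ t1 T0). exists (G b t1).
        apply HC; lra.
      - exists (mkposreal _ R0). intros t Ht. apply E1.
        replace t with (t - 0) by ring. exact Ht. }
    unfold PSeries. rewrite (Series_ext _ (fun m => a m x * (b - b0) ^ m * / w x)).
    + rewrite Series_scal_r. fold (C x). rewrite <- E. field. auto.
    + intros m; ring.
Qed.

Lemma analytic_generating_function_power_series (w : nat -> R) (g : R -> nat -> C) :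
  (forall x, w x <> 0) -> analytic_generating_function w g ->
  locally_power_series (fun b x => Re (g b x)) /\
  locally_power_series (fun b x => Im (g b x)).
Proof.
  intros Hw (U & G & HU & HU0 & HG).
  assert (K : forall b0, exists d r (c : nat -> nat -> C), 0 < d /\ 0 < r /\
    (forall b t, Rabs (b - b0) < d -> Rabs t < d ->
       is_series (V := C_R_NormedModule)
         (fun y => Cmult (g b y) (RtoC (w y * t ^ y))) (G b t)) /\
    (forall b t, Rabs (b - b0) < r -> Rabs t < r ->
       is_double_series
         (fun m n => Cmult (c m n) (RtoC ((b - b0) ^ m * t ^ n))) (G b t))).
  { intros b0. destruct (HU (b0, 0) (HU0 b0)) as [d Hd].
    destruct (proj2 (HG b0 0 (HU0 b0))) as (c & r & Hr & Hc).
    exists d, r, c. split; [apply cond_pos|]. split; auto. split.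
    - intros b t Hb Ht. apply HG. apply Hd. split; [exact Hb|].
      change (Rabs (t - 0) < d). now rewrite Rminus_0_r.
    - intros b t Hb Ht. specialize (Hc b t Hb).
      rewrite Rminus_0_r in Hc. auto. }
  split; intros b0; destruct (K b0) as (d & r & c & Hd & Hr & K1 & K2).
  - apply (coefficients_power_series w (fun b x => Re (g b x)) b0 d r
             (fun b t => Re (G b t)) (fun i j => Re (c i j))); auto.
    + intros b t Hb Ht. destruct (proj1 (is_series_C _ _) (K1 b t Hb Ht)) as [A _].
      eapply is_series_ext; [|exact A]. intros y. unfold Re, Im; simpl; ring.
    + intros b t Hb Ht.
      destruct (proj1 (is_double_series_C _ _) (K2 b t Hb Ht)) as (M & A & _ & E & _).
      assert (Q : forall i j, Re (Cmult (c i j) (RtoC ((b - b0) ^ i * t ^ j))) =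
                 dscale (fun i j => Re (c i j)) (b - b0) t i j)
        by (intros; unfold dscale, Re, Im; simpl; ring).
      exists M. split.
      * eapply summable2_ext; [|exact A]. intros; symmetry; apply Q.
      * rewrite E. apply dseries_ext, Q.
  - apply (coefficients_power_series w (fun b x => Im (g b x)) b0 d r
             (fun b t => Im (G b t)) (fun i j => Im (c i j))); auto.
    + intros b t Hb Ht. destruct (proj1 (is_series_C _ _) (K1 b t Hb Ht)) as [_ A].
      eapply is_series_ext; [|exact A]. intros y. unfold Re, Im; simpl; ring.
    + intros b t Hb Ht.
      destruct (proj1 (is_double_series_C _ _) (K2 b t Hb Ht)) as (M & _ & A & _ & E).
      assert (Q : forall i j, Im (Cmult (c i j) (RtoC ((b - b0) ^ i * t ^ j))) =
                 dscale (fun i j => Im (c i j)) (b - b0) t i j)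
        by (intros; unfold dscale, Re, Im; simpl; ring).
      exists M. split.
      * eapply summable2_ext; [|exact A]. intros; symmetry; apply Q.
      * rewrite E. apply dseries_ext, Q.
Qed.

Lemma is_solution_unique (w u v : nat -> R) (f : nat -> C) (g1 g2 : R -> nat -> C) :
  (forall x, w x <> 0) ->
  is_solution w (jacobi_op u v) f g1 -> is_solution w (jacobi_op u v) f g2 -> g1 = g2.
Proof.
  intros Hw (I1 & D1 & A1) (I2 & D2 & A2).
  destruct (analytic_generating_function_power_series w g1 Hw A1) as [R1 J1].
  destruct (analytic_generating_function_power_series w g2 Hw A2) as [R2 J2].
  assert (S : forall g : R -> nat -> C,
    (forall b x, is_derive (V := C_R_NormedModule) (fun s => g s x) b
                   (jacobi_op u v (g b) x)) ->
    jacobi_solution u v (fun b x => Re (g b x)) /\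
    jacobi_solution u v (fun b x => Im (g b x))).
  { intros g D. split; intros b x; destruct (proj1 (is_derive_C _ _ _) (D b x)) as [A B].
    - rewrite Re_jacobi_op in A. exact A.
    - rewrite Im_jacobi_op in B. exact B. }
  apply functional_extensionality; intros b. apply functional_extensionality; intros x.
  apply injective_projections.
  - apply (jacobi_solution_unique u v (fun b x => Re (g1 b x)) (fun b x => Re (g2 b x)));
      auto; try (apply S; auto). intros y. rewrite I1, I2; auto.
  - apply (jacobi_solution_unique u v (fun b x => Im (g1 b x)) (fun b x => Im (g2 b x)));
      auto; try (apply S; auto). intros y. rewrite I1, I2; auto.
Qed.

(** * The functional equation of Gamma *)

(** The integral over [a, b] grows with the interval, so the improper integral is the supremum of
    these integrals. *)
Lemma is_RInt_gen_nonneg_bounded (f : R -> R) (M : R) :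
  (forall t, 0 < t -> continuous f t) -> (forall t, 0 < t -> 0 <= f t) ->
  (forall a b, 0 < a -> a <= b -> RInt f a b <= M) ->
  exists L, is_RInt_gen f (at_right 0) (Rbar_locally p_infty) L /\
    forall a b, 0 < a -> a <= b -> RInt f a b <= L.
Proof.
  intros Hc H0 HM.
  assert (Ex : forall a b, 0 < a -> a <= b -> ex_RInt f a b).
  { intros a b Ha Hab. apply (ex_RInt_continuous (V := R_CompleteNormedModule)).
    intros z Hz. apply Hc. rewrite Rmin_left in Hz by auto. lra. }
  destruct (completeness (fun y => exists a b, 0 < a /\ a <= b /\ y = RInt f a b))
    as [L [HL1 HL2]].
  - exists M. intros y (a & b & Ha & Hab & ->). auto.
  - exists (RInt f 1 1), 1, 1. repeat split; lra.
  - exists L. split.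
    + intros P [eps HP].
      destruct (Classical_Prop.classic (exists a b, 0 < a /\ a <= b /\ L - eps < RInt f a b))
        as [(a0 & b0 & Ha0 & Hab0 & HL)|Hn].
      * apply (Filter_prod _ _ _ (fun a => 0 < a < a0) (fun b => b0 < b)).
        -- exists (mkposreal a0 Ha0). intros y Hy Hy0.
           unfold ball in Hy; simpl in Hy. unfold AbsRing_ball, abs, minus, plus, opp in Hy.
           simpl in Hy. apply Rabs_def2 in Hy. lra.
        -- exists b0. auto.
        -- intros a b Ha Hb. simpl. exists (RInt f a b). split.
           ++ apply (RInt_correct (V := R_CompleteNormedModule)). apply Ex; lra.
           ++ apply HP.
              assert (U : RInt f a b <= L) by (apply HL1; exists a, b; repeat split; lra).
              assert (V : RInt f a0 b0 <= RInt f a b).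
              { rewrite <- (RInt_Chasles f a a0 b), <- (RInt_Chasles f a0 b0 b)
                  by (apply Ex; lra).
                assert (0 <= RInt f a a0).
                { apply RInt_ge_0; try lra; [apply Ex; lra|]. intros; apply H0; lra. }
                assert (0 <= RInt f b0 b).
                { apply RInt_ge_0; try lra; [apply Ex; lra|]. intros; apply H0; lra. }
                unfold plus; simpl; lra. }
              unfold ball; simpl. unfold AbsRing_ball, abs, minus, plus, opp; simpl.
              apply Rabs_def1; lra.
      * exfalso. assert (L <= L - eps); [|generalize (cond_pos eps); lra].
        apply HL2. intros y (a & b & Ha & Hab & ->).
        apply Rnot_lt_le. intros Hlt. apply Hn. exists a, b. auto.
    + intros a b Ha Hab. apply HL1. exists a, b. auto.
Qed.

Definition Gamma_integrand (x t : R) : R := Rpower t (x - 1) * exp (- t).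

(** The inequality 1 + v <= exp v at v = ln (t / (2 x)), multiplied by x. The factor 2 makes the
    growth exp (t / 2), which leaves half of the decay of exp (- t). *)
Lemma Rpower_le_exp (x t : R) :
  0 < x -> 0 < t -> Rpower t x <= exp (x * ln (2 * x) - x) * exp (t / 2).
Proof.
  intros Hx Ht. unfold Rpower. rewrite <- exp_plus.
  assert (E : x * ln t <= x * ln (2 * x) - x + t / 2).
  { assert (H := exp_ineq1_le (ln (t / (2 * x)))).
    rewrite exp_ln in H by (apply Rdiv_lt_0_compat; lra).
    rewrite ln_div in H by lra.
    assert (x * (1 + (ln t - ln (2 * x))) <= x * (t / (2 * x)))
      by (apply Rmult_le_compat_l; lra).
    replace (x * (t / (2 * x))) with (t / 2) in H0 by (field; lra). lra. }
  destruct E as [E|E]; [left; apply exp_increasing; auto | right; now rewrite E].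
Qed.

Lemma Gamma_integrand_continuous (x t : R) : 0 < t -> continuous (Gamma_integrand x) t.
Proof.
  intros Ht. apply (ex_derive_continuous (V := R_NormedModule)). unfold Gamma_integrand, Rpower.
  auto_derive. auto.
Qed.

Lemma Gamma_integrand_pos (x t : R) : 0 < Gamma_integrand x t.
Proof. apply Rmult_lt_0_compat; apply exp_pos. Qed.

(* The integrand is dominated by a multiple of the derivative of the bounded
   function t^x / (1 + t^x), which controls both ends at once. *)
Lemma Gamma_integrand_bounded (x : R) :
  0 < x -> exists M, forall a b, 0 < a -> a <= b -> RInt (Gamma_integrand x) a b <= M.
Proof.
  intros Hx. set (K := exp (x * ln (2 * x) - x)).
  assert (HK : 0 < K) by apply exp_pos.
  (* Since t^x <= K exp (t / 2), also 1 + t^x <= (1 + K) exp (t / 2), so exp (- t) (1 + t^x)^2 <= (1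
     + K)^2; the x cancels the factor from differentiating t^x. Up to a constant, [H] below is c t^x
     / (1 + t^x), with values in an interval of length c. *)
  set (c := (1 + K) ^ 2 / x).
  assert (Hc : 0 < c) by (apply Rdiv_lt_0_compat; [apply pow_lt|]; lra).
  set (H := fun t => - c / (1 + Rpower t x)).
  set (h := fun t => c * (x * Rpower t (x - 1)) / (1 + Rpower t x) ^ 2).
  assert (HP : forall t, 0 < Rpower t x) by (intros; apply exp_pos).
  assert (D : forall t, 0 < t -> is_derive H t (h t)).
  { intros t Ht. unfold H, h.
    assert (E : Rpower t (x - 1) = Rpower t x / t).
    { unfold Rminus. rewrite Rpower_plus, Rpower_Ropp, Rpower_1 by auto. reflexivity. }
    rewrite E. specialize (HP t). unfold Rpower in HP |- *. auto_derive.
    - split; auto. split; auto. lra.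
    - field. split; lra. }
  assert (Ch : forall t, 0 < t -> continuous h t).
  { intros t Ht. apply (ex_derive_continuous (V := R_NormedModule)). unfold h. specialize (HP t).
    unfold Rpower in HP |- *. auto_derive. repeat split; auto.
    apply Rgt_not_eq. simpl. rewrite Rmult_1_r. apply Rmult_lt_0_compat; lra. }
  exists c. intros a b Ha Hab.
  assert (I : is_RInt h a b (H b - H a)).
  { apply (is_RInt_derive (V := R_CompleteNormedModule) H h);
      intros t; rewrite Rmin_left by auto; intros Ht; [apply D | apply Ch]; lra. }
  apply Rle_trans with (RInt h a b).
  - apply RInt_le; auto.
    + apply (ex_RInt_continuous (V := R_CompleteNormedModule)). intros t.
      rewrite Rmin_left by auto. intros Ht. apply Gamma_integrand_continuous; lra.
    + eexists; exact I.
    + intros t Ht. unfold Gamma_integrand, h.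
      assert (Bt := Rpower_le_exp x t Hx ltac:(lra)). fold K in Bt.
      assert (Pt := HP t). set (P := Rpower t x) in *.
      assert (Pq : 0 < Rpower t (x - 1)) by apply exp_pos.
      set (q := Rpower t (x - 1)) in *.
      assert (Ee : exp (- t) * exp (t / 2) ^ 2 = 1).
      { simpl. rewrite Rmult_1_r, <- !exp_plus, <- exp_0. f_equal. field. }
      assert (E1 : 1 <= exp (t / 2)).
      { rewrite <- exp_0. left; apply exp_increasing; lra. }
      set (e := exp (t / 2)) in *. set (m := exp (- t)) in *.
      assert (Pm : 0 < m) by apply exp_pos.
      apply Rmult_le_reg_r with ((1 + P) ^ 2); [apply pow_lt; lra|].
      replace (c * (x * q) / (1 + P) ^ 2 * (1 + P) ^ 2) with (q * (1 + K) ^ 2)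
        by (unfold c; field; split; lra).
      rewrite Rmult_assoc. apply Rmult_le_compat_l; [lra|].
      replace ((1 + K) ^ 2) with (m * ((1 + K) * e) ^ 2)
        by (transitivity ((1 + K) ^ 2 * (m * e ^ 2)); [ring | rewrite Ee; ring]).
      apply Rmult_le_compat_l; [lra|]. apply pow_incr. nra.
  - rewrite (is_RInt_unique _ _ _ _ I). unfold H.
    assert (A := HP a). assert (B := HP b).
    assert (0 < c / (1 + Rpower b x)) by (apply Rdiv_lt_0_compat; lra).
    assert (c / (1 + Rpower a x) <= c).
    { apply Rmult_le_reg_r with (1 + Rpower a x); [lra|].
      replace (c / (1 + Rpower a x) * (1 + Rpower a x)) with c by (field; lra). nra. }
    unfold Rdiv in *. lra.
Qed.

Lemma Gamma_spec (x : R) :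
  0 < x ->
  is_RInt_gen (Gamma_integrand x) (at_right 0) (Rbar_locally p_infty) (Gamma x) /\
  0 < Gamma x.
Proof.
  intros Hx. destruct (Gamma_integrand_bounded x Hx) as [M HM].
  destruct (is_RInt_gen_nonneg_bounded (Gamma_integrand x) M) as (L & HL & Hb); auto.
  - intros; apply Gamma_integrand_continuous; auto.
  - intros; left; apply Gamma_integrand_pos.
  - assert (E : Gamma x = L).
    { change (Gamma x) with (RInt_gen (V := R_CompleteNormedModule)
        (Gamma_integrand x) (at_right 0) (Rbar_locally p_infty)).
      apply is_RInt_gen_unique. exact HL. }
    rewrite E. split; auto.
    apply Rlt_le_trans with (RInt (Gamma_integrand x) 1 2); [|apply Hb; lra].
    apply RInt_gt_0; [lra| |].
    + intros; apply Gamma_integrand_pos.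
    + intros; apply Gamma_integrand_continuous; lra.
Qed.

Lemma is_lim_Rpower_exp_0 (x : R) :
  0 < x -> filterlim (fun t => Rpower t x * exp (- t)) (at_right 0) (locally 0).
Proof.
  intros Hx.
  apply filterlim_ext with (fun t => exp (x * ln t + - t)).
  { intros t. unfold Rpower. now rewrite exp_plus. }
  apply filterlim_comp with (Rbar_locally m_infty); [|apply is_lim_exp_m].
  intros P [N HN].
  assert (Hpos : 0 < exp (N / x)) by apply exp_pos.
  exists (mkposreal _ Hpos). intros t Ht Ht0. apply HN.
  unfold ball in Ht; simpl in Ht. unfold AbsRing_ball, abs, minus, plus, opp in Ht.
  simpl in Ht. apply Rabs_def2 in Ht.
  assert (ln t < N / x).
  { rewrite <- (ln_exp (N / x)). apply ln_increasing; lra. }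
  assert (x * ln t < x * (N / x)) by (apply Rmult_lt_compat_l; auto).
  replace (x * (N / x)) with N in H0 by (field; lra). lra.
Qed.

Lemma is_lim_Rpower_exp_p (x : R) :
  0 < x ->
  filterlim (fun t => Rpower t x * exp (- t)) (Rbar_locally p_infty) (locally 0).
Proof.
  intros Hx. set (K := exp (x * ln (2 * x) - x)).
  apply (filterlim_le_le (fun _ => 0) _ (fun t => K * exp (- (t / 2))) (Finite 0)).
  - exists 0. intros t Ht. split.
    + apply Rmult_le_pos; left; apply exp_pos.
    + apply Rle_trans with (K * exp (t / 2) * exp (- t)).
      * apply Rmult_le_compat_r; [left; apply exp_pos | apply Rpower_le_exp; auto].
      * rewrite Rmult_assoc, <- exp_plus. right. f_equal. f_equal. field.
  - apply filterlim_const.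
  - change (is_lim (fun t => K * exp (- (t / 2))) p_infty 0).
    evar_last; [apply is_lim_scal_l|].
    + apply (is_lim_comp exp (fun t => - (t / 2)) p_infty 0 m_infty).
      * apply is_lim_exp_m.
      * apply (is_lim_opp (fun t => t / 2) p_infty p_infty).
        change (is_lim (fun t => t * / 2) p_infty p_infty).
        evar_last; [apply is_lim_scal_r, is_lim_id|].
        simpl. destruct (Rle_dec 0 (/ 2)) as [H|H]; [|lra].
        destruct (Rle_lt_or_eq_dec 0 (/ 2) H); auto; lra.
      * exists 0; intros; discriminate.
    + simpl. f_equal; ring.
Qed.

(** Integration by parts: t^x exp (- t) vanishes at both ends, and its derivative is the difference
    of the two integrands. *)
Lemma Gamma_succ (x : R) : 0 < x -> Gamma (x + 1) = x * Gamma x.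
Proof.
  intros Hx. destruct (Gamma_spec x Hx) as [HG _].
  set (h := fun t => Rpower t x * exp (- t)).
  assert (D : forall t, 0 < t -> is_derive h t (x * Gamma_integrand x t - Gamma_integrand (x + 1) t)).
  { intros t Ht. unfold h, Gamma_integrand.
    replace (x + 1 - 1) with x by ring.
    assert (E : Rpower t (x - 1) = Rpower t x / t).
    { unfold Rminus. rewrite Rpower_plus, Rpower_Ropp, Rpower_1 by auto. reflexivity. }
    rewrite E. unfold Rpower. auto_derive; auto. field; lra. }
  assert (Pos : filter_prod (at_right 0) (Rbar_locally p_infty)
    (fun ab => forall t, Rmin (fst ab) (snd ab) <= t <= Rmax (fst ab) (snd ab) -> 0 < t)).
  { apply (Filter_prod _ _ _ (fun a => 0 < a) (fun b => 0 < b)).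
    - exists (mkposreal 1 Rlt_0_1). auto.
    - exists 0. auto.
    - intros a b Ha Hb t [Ht _]. simpl in Ht.
      apply Rlt_le_trans with (2 := Ht). apply Rmin_glb_lt; auto. }
  assert (I : is_RInt_gen (Derive h) (at_right 0) (Rbar_locally p_infty) (0 - 0)).
  { apply is_RInt_gen_Derive.
    - revert Pos. apply filter_imp. intros ab H t Ht. eexists; apply D; auto.
    - revert Pos. apply filter_imp. intros ab H t Ht. specialize (H t Ht).
      apply (continuous_ext_loc _ (fun t => x * Gamma_integrand x t - Gamma_integrand (x + 1) t)).
      + exists (mkposreal t H). intros y Hy. symmetry. apply is_derive_unique, D.
        unfold ball in Hy; simpl in Hy. unfold AbsRing_ball, abs, minus, plus, opp in Hy.
        simpl in Hy. apply Rabs_def2 in Hy. lra.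
      + apply (continuous_minus (V := R_NormedModule)).
        * apply (continuous_scal_r (V := R_NormedModule) x), Gamma_integrand_continuous; auto.
        * apply Gamma_integrand_continuous; auto.
    - apply is_lim_Rpower_exp_0; auto.
    - apply is_lim_Rpower_exp_p; auto. }
  assert (J := is_RInt_gen_minus (V := R_NormedModule) _ _ _ _
                 (is_RInt_gen_scal (V := R_NormedModule) _ x _ HG) I).
  replace (x * Gamma x) with (minus (scal x (Gamma x)) (0 - 0))
    by (unfold minus, plus, opp, scal; simpl; unfold mult; simpl; ring).
  change (Gamma (x + 1)) with (RInt_gen (V := R_CompleteNormedModule)
    (Gamma_integrand (x + 1)) (at_right 0) (Rbar_locally p_infty)).
  apply is_RInt_gen_unique.
  eapply is_RInt_gen_ext; [|exact J].
  revert Pos. apply filter_imp. intros ab H t Ht.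
  rewrite (is_derive_unique _ _ _ (D t (H t ltac:(lra)))).
  unfold minus, plus, opp, scal; simpl; unfold mult; simpl.
  unfold Gamma_integrand. ring.
Qed.

(** * Exponentials of operators *)

(** Here [u m] stands for the m-th derivative of [u 0]; this is the Taylor polynomial at 0 with n
    terms. *)
Fixpoint taylor (u : nat -> R -> R) (n : nat) (b : R) : R :=
  match n with
  | O => 0
  | S n => taylor u n b + u n 0 * (b ^ n / INR (fact n))
  end.

Lemma is_derive_pow_fact (n : nat) (b : R) :
  is_derive (fun s => s ^ S n / INR (fact (S n))) b (b ^ n / INR (fact n)).
Proof.
  auto_derive; auto.
  change (1 * (INR (S n) * b ^ n) * / INR (S n * fact n) = b ^ n / INR (fact n)).
  rewrite mult_INR. field.
  split; [apply INR_fact_neq_0 | apply not_0_INR; discriminate].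
Qed.

Lemma is_derive_taylor (u : nat -> R -> R) (n : nat) (b : R) :
  is_derive (taylor u (S n)) b (taylor (fun m => u (S m)) n b).
Proof.
  induction n as [|n IH].
  - simpl. auto_derive; auto.
  - change (is_derive (fun b => taylor u (S n) b + u (S n) 0 * (b ^ S n / INR (fact (S n)))) b
      (taylor (fun m => u (S m)) n b + u (S n) 0 * (b ^ n / INR (fact n)))).
    apply (is_derive_plus (V := R_NormedModule)); [exact IH|].
    apply is_derive_scal, is_derive_pow_fact.
Qed.

Lemma derive_bound (f g f' g' : R -> R) (b : R) :
  0 <= b -> (forall s, 0 <= s <= b -> is_derive f s (f' s)) ->
  (forall s, 0 <= s <= b -> is_derive g s (g' s)) ->
  (forall s, 0 <= s <= b -> f' s <= g' s) -> f 0 <= g 0 -> f b <= g b.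
Proof.
  intros Hb Df Dg H H0.
  destruct (MVT_gen (fun s => g s - f s) 0 b (fun s => g' s - f' s)) as (c & Hc & E).
  - rewrite Rmin_left, Rmax_right by auto. intros s Hs.
    apply (is_derive_minus (V := R_NormedModule)); [apply Dg | apply Df]; lra.
  - rewrite Rmin_left, Rmax_right by auto. intros s Hs.
    apply continuity_pt_filterlim.
    apply (continuous_minus (V := R_NormedModule) g f);
      apply (ex_derive_continuous (V := R_NormedModule)); eexists; [apply Dg | apply Df]; lra.
  - rewrite Rmin_left, Rmax_right in Hc by auto. specialize (H c Hc).
    assert (0 <= (g' c - f' c) * (b - 0)) by (apply Rmult_le_pos; lra). lra.
Qed.

(** Induction on n: the bound for the shifted family of derivatives, whose constant is B K, is
    integrated by [derive_bound], once for each sign. *)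
Lemma taylor_remainder (n : nat) : forall (u : nat -> R -> R) (B K b : R),
  0 <= b -> 
  (forall m s, 0 <= s <= b -> is_derive (u m) s (u (S m) s)) ->
  (forall m s, 0 <= s <= b -> Rabs (u m s) <= B * K ^ m) ->
  Rabs (u 0%nat b - taylor u n b) <= B * K ^ n * (b ^ n / INR (fact n)).
Proof.
  induction n as [|n IH]; intros u B K b Hb Hd HB.
  - simpl. specialize (HB 0%nat b ltac:(lra)). simpl in HB. rewrite Rminus_0_r. lra.
  - assert (H : forall s, 0 <= s <= b ->
      Rabs (u 1%nat s - taylor (fun m => u (S m)) n s) <= B * K * K ^ n * (s ^ n / INR (fact n))).
    { intros s Hs. apply (IH (fun m => u (S m)) (B * K) K s).
      - lra.
      - intros m r Hr. apply Hd; lra.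
      - intros m r Hr. specialize (HB (S m) r ltac:(lra)). simpl in HB. lra. }
    assert (Df : forall s, 0 <= s <= b ->
      is_derive (fun s => u 0%nat s - taylor u (S n) s) s
        (u 1%nat s - taylor (fun m => u (S m)) n s)).
    { intros s Hs. apply (is_derive_minus (V := R_NormedModule)).
      - apply Hd; auto.
      - apply is_derive_taylor. }
    assert (Dg : forall s, is_derive (fun s => B * K ^ S n * (s ^ S n / INR (fact (S n)))) s
      (B * K * K ^ n * (s ^ n / INR (fact n)))).
    { intros s.
      replace (B * K * K ^ n * (s ^ n / INR (fact n))) with
        (B * K ^ S n * (s ^ n / INR (fact n))) by (simpl; ring).
      apply is_derive_scal, is_derive_pow_fact. }
    assert (T0 : u 0%nat 0 - taylor u (S n) 0 = 0).
    { clear. induction n as [|n IH]; [simpl; field|].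
      change (u 0%nat 0 - (taylor u (S n) 0 + u (S n) 0 * (0 ^ S n / INR (fact (S n)))) = 0).
      rewrite pow_i by lia. unfold Rdiv. lra. }
    assert (Z : B * K ^ S n * (0 ^ S n / INR (fact (S n))) = 0).
    { rewrite (pow_i (S n)) by lia. unfold Rdiv. ring. }
    apply Rabs_le. split.
    + apply Ropp_le_cancel. rewrite Ropp_involutive.
      apply (derive_bound (fun s => - (u 0%nat s - taylor u (S n) s))
               (fun s => B * K ^ S n * (s ^ S n / INR (fact (S n))))
               (fun s => - (u 1%nat s - taylor (fun m => u (S m)) n s))
               (fun s => B * K * K ^ n * (s ^ n / INR (fact n))) b Hb).
      * intros s Hs. apply (is_derive_opp (V := R_NormedModule)). auto.
      * intros; apply Dg.
      * intros s Hs. specialize (H s Hs). apply Rabs_le_between in H. lra.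
      * rewrite T0, Z. lra.
    + apply (derive_bound (fun s => u 0%nat s - taylor u (S n) s)
               (fun s => B * K ^ S n * (s ^ S n / INR (fact (S n))))
               (fun s => u 1%nat s - taylor (fun m => u (S m)) n s)
               (fun s => B * K * K ^ n * (s ^ n / INR (fact n))) b Hb Df
               (fun s _ => Dg s)).
      * intros s Hs. specialize (H s Hs). apply Rabs_le_between in H. lra.
      * rewrite T0, Z. lra.
Qed.

Lemma is_series_taylor (u : nat -> R -> R) (B K : R) :
  (forall m s, 0 <= s <= 1 -> is_derive (u m) s (u (S m) s)) ->
  (forall m s, 0 <= s <= 1 -> Rabs (u m s) <= B * K ^ m) ->
  is_series (fun n => / INR (fact n) * u n 0) (u 0%nat 1).
Proof.
  intros Hd HB. change (is_lim_seq (sum_n (fun n => / INR (fact n) * u n 0)) (u 0%nat 1)).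
  assert (E : forall n, sum_n (fun n => / INR (fact n) * u n 0) n = taylor u (S n) 1).
  { induction n as [|n IH].
    - rewrite sum_O. simpl. field.
    - rewrite sum_Sn, IH.
      change (taylor u (S n) 1 + / INR (fact (S n)) * u (S n) 0 =
              taylor u (S n) 1 + u (S n) 0 * (1 ^ S n / INR (fact (S n)))).
      rewrite pow1. field. apply INR_fact_neq_0. }
  assert (L : is_lim_seq (fun n => B * (/ INR (fact n) * K ^ n)) 0).
  { replace (Finite 0) with (Rbar_mult B 0) by (simpl; f_equal; ring).
    apply is_lim_seq_scal_l.
    assert (X := ex_series_lim_0 (fun n => / INR (fact n) * K ^ n)). apply X.
    exists (exp K). apply is_pseries_R, is_exp_Reals. }
  apply is_lim_seq_incr_1 in L.
  assert (L2 : is_lim_seq (fun n => u 0%nat 1 - taylor u (S n) 1) 0).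
  { apply is_lim_seq_abs_0.
    eapply is_lim_seq_le_le; [|apply (is_lim_seq_const 0)|exact L].
    intros n. split; [apply Rabs_pos|].
    eapply Rle_trans; [apply (taylor_remainder (S n) u B K 1); auto; lra|].
    rewrite pow1. right. field. apply INR_fact_neq_0. }
  assert (L3 := is_lim_seq_minus' _ _ _ _ (is_lim_seq_const (u 0%nat 1)) L2).
  replace (u 0%nat 1 - 0) with (u 0%nat 1) in L3 by ring.
  eapply is_lim_seq_ext; [|exact L3]. intros n. rewrite E. simpl. ring.
Qed.

(** The way in which exponential series get evaluated: the terms are Taylor coefficients at 0 of a
    curve whose derivatives grow at most geometrically, and the sum is the curve at time 1. *)
Lemma CSeries_taylor (U : nat -> R -> C) (B K : R) :
  (forall m s, 0 <= s <= 1 -> is_derive (V := C_R_NormedModule) (U m) s (U (S m) s)) ->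
  (forall m s, 0 <= s <= 1 -> Cmod (U m s) <= B * K ^ m) ->
  CSeries (fun n => Cmult (RtoC (/ INR (fact n))) (U n 0)) = U 0%nat 1.
Proof.
  intros Hd HB. apply injective_projections; simpl.
  - apply is_series_unique. eapply is_series_ext;
      [|apply (is_series_taylor (fun n s => Re (U n s)) B K)].
    + intros n. unfold Re; simpl. ring.
    + intros m s Hs. apply is_derive_C, Hd, Hs.
    + intros m s Hs. eapply Rle_trans; [apply Rabs_Re_le_Cmod | auto].
  - apply is_series_unique. eapply is_series_ext;
      [|apply (is_series_taylor (fun n s => Im (U n s)) B K)].
    + intros n. unfold Im; simpl. ring.
    + intros m s Hs. apply is_derive_C, Hd, Hs.
    + intros m s Hs. eapply Rle_trans; [apply Rabs_Im_le_Cmod | auto].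
Qed.

(** * Exponentials of diagonal and lowering operators *)

Definition cexp (z : C) : C := (exp (Re z) * cos (Im z), exp (Re z) * sin (Im z)).

Lemma cexp_plus (z1 z2 : C) : cexp (Cplus z1 z2) = Cmult (cexp z1) (cexp z2).
Proof.
  unfold cexp, Re, Im; simpl. rewrite exp_plus, cos_plus, sin_plus.
  unfold Cmult; simpl. f_equal; ring.
Qed.

Lemma cexp_RtoC (x : R) : cexp (RtoC x) = RtoC (exp x).
Proof. unfold cexp, Re, Im; simpl. rewrite cos_0, sin_0. unfold RtoC. f_equal; ring. Qed.

Lemma cexp_i_PI_INR (n : nat) : cexp (Cmult Ci (RtoC (PI * INR n))) = RtoC ((-1) ^ n).
Proof.
  induction n as [|n IH].
  - replace (Cmult Ci (RtoC (PI * INR 0))) with (RtoC 0)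
      by (unfold Cmult, Ci, RtoC; simpl; f_equal; ring).
    rewrite cexp_RtoC, exp_0. reflexivity.
  - replace (Cmult Ci (RtoC (PI * INR (S n)))) with
      (Cplus (Cmult Ci (RtoC (PI * INR n))) (Cmult Ci (RtoC PI)))
      by (rewrite S_INR; unfold Cmult, Cplus, Ci, RtoC; simpl; f_equal; ring).
    rewrite cexp_plus, IH.
    assert (E : cexp (Cmult Ci (RtoC PI)) = RtoC (-1)).
    { unfold cexp, Re, Im, Ci, RtoC, Cmult; simpl.
      replace (0 * PI - 1 * 0) with 0 by ring. replace (0 * 0 + 1 * PI) with PI by ring.
      rewrite exp_0, cos_PI, sin_PI. f_equal; ring. }
    rewrite E, <- RtoC_mult. f_equal. simpl; ring.
Qed.

Lemma CSeries_exp (d z : C) :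
  CSeries (fun n => Cmult (RtoC (/ INR (fact n))) (Cmult (Cpow d n) z)) = Cmult (cexp d) z.
Proof.
  (* The n-th derivative in s of z e^{s d}. *)
  set (U := fun (n : nat) (s : R) => Cmult (Cmult (Cpow d n) z) (cexp (Cmult (RtoC s) d))).
  assert (U0 : forall n, U n 0 = Cmult (Cpow d n) z).
  { intros n. unfold U. replace (Cmult (RtoC 0) d) with (RtoC 0).
    - rewrite cexp_RtoC, exp_0. ring.
    - ring. }
  transitivity (U 0%nat 1).
  2:{ unfold U. simpl. replace (Cmult (RtoC 1) d) with d by ring. ring. }
  rewrite <- (CSeries_taylor U (Cmod z * exp (Rabs (Re d))) (Cmod d)).
  - f_equal. apply functional_extensionality; intros n. now rewrite U0.
  - intros m s _.
    replace (U (S m) s) with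
      (Cmult (Cmult (Cmult (Cpow d m) z) d) (cexp (Cmult (RtoC s) d)))
      by (unfold U; simpl; ring).
    unfold U. set (k := Cmult (Cpow d m) z).
    apply is_derive_C. destruct k as [k1 k2], d as [d1 d2].
    unfold cexp, Re, Im; simpl.
    split; auto_derive; auto; unfold Rminus; ring.
  - intros m s Hs. unfold U. rewrite !Cmod_mult, Cmod_pow.
    replace (Cmod (cexp (Cmult (RtoC s) d))) with (exp (s * Re d)).
    + replace (Cmod z * exp (Rabs (Re d)) * Cmod d ^ m) with
        (Cmod d ^ m * Cmod z * exp (Rabs (Re d))) by ring.
      apply Rmult_le_compat_l.
      * apply Rmult_le_pos; [apply pow_le|]; apply Cmod_ge_0.
      * assert (X : s * Re d <= Rabs (Re d)).
        { apply Rle_trans with (1 := Rle_abs _). rewrite Rabs_mult, (Rabs_pos_eq s) by lra.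
          assert (Y := Rabs_pos (Re d)). nra. }
        destruct X as [X|X]; [left; apply exp_increasing; auto | right; now rewrite X].
    + unfold cexp, Cmod, Re, Im; simpl.
      replace (s * fst d - 0 * snd d) with (s * fst d) by ring.
      set (e := exp _). set (a := s * snd d + 0 * fst d).
      replace (_ + _) with (e ^ 2 * (Rsqr (sin a) + Rsqr (cos a)))
        by (unfold Rsqr; ring).
      rewrite sin2_cos2, Rmult_1_r, sqrt_pow2; auto. left; apply exp_pos.
Qed.

Lemma opexp_diag {T : Type} (A : op T) (d : T -> C) :
  (forall f x, A f x = Cmult (d x) (f x)) ->
  forall f x, opexp A f x = Cmult (cexp (d x)) (f x).
Proof.
  intros H f x. rewrite <- CSeries_exp. unfold opexp. f_equal.
  apply functional_extensionality; intros n. f_equal.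
  induction n as [|n IH]; simpl; [ring|]. rewrite H, IH. ring.
Qed.

Lemma CSeries_finite (u : nat -> C) (N : nat) :
  (forall n, (N < n)%nat -> u n = RtoC 0) -> CSeries u = sum_n u N.
Proof.
  intros H.
  assert (K : forall a : nat -> R, (forall n, (N < n)%nat -> a n = 0) -> Series a = sum_n a N).
  { intros a Ha. apply is_series_unique.
    change (is_lim_seq (sum_n a) (sum_n a N)).
    apply is_lim_seq_incr_n with N.
    apply is_lim_seq_ext with (fun _ => sum_n a N); [|apply is_lim_seq_const].
    induction n as [|n IH]; [reflexivity|].
    change (S n + N)%nat with (S (n + N)). rewrite sum_Sn, <- IH, Ha by lia.
    symmetry. apply Rplus_0_r. }
  apply injective_projections.
  - etransitivity; [|symmetry; apply (Re_sum_n u N)].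
    apply K. intros n Hn. now rewrite H.
  - etransitivity; [|symmetry; apply (Im_sum_n u N)].
    apply K. intros n Hn. now rewrite H.
Qed.

Lemma sum_n_head {G : AbelianMonoid} (a : nat -> G) (n : nat) :
  sum_n a (S n) = plus (a 0%nat) (sum_n (fun k => a (S k)) n).
Proof.
  induction n as [|n IH]; [now rewrite sum_Sn, !sum_O|].
  rewrite sum_Sn, IH, sum_Sn. symmetry. apply plus_assoc.
Qed.

Lemma sum_n_rev {G : AbelianMonoid} (a : nat -> G) (n : nat) :
  sum_n (fun k => a (n - k)%nat) n = sum_n a n.
Proof.
  induction n as [|n IH]; [now rewrite !sum_O|].
  rewrite sum_n_head, sum_Sn, <- IH. apply plus_comm.
Qed.

Definition binom_coef (n m : nat) : R :=
  if (m <=? n)%nat then INR (fact n) / (INR (fact m) * INR (fact (n - m))) else 0.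

Lemma iter_Kminus (f : nat -> C) (n x : nat) :
  Nat.iter n Kminus f x =
  if (n <=? x)%nat then Cmult (RtoC (INR (fact x) / INR (fact (x - n)))) (f (x - n)%nat)
  else RtoC 0.
Proof.
  revert x. induction n as [|n IH]; intros x.
  - simpl. rewrite Nat.sub_0_r. unfold Rdiv. rewrite Rinv_r by apply INR_fact_neq_0. ring.
  - simpl Nat.iter. unfold Kminus at 1. destruct x as [|x]; [simpl; ring|].
    unfold prev. rewrite IH. change (S n <=? S x)%nat with (n <=? x)%nat.
    change (S x - S n)%nat with (x - n)%nat.
    destruct (n <=? x)%nat; [|ring].
    rewrite Cmult_assoc, <- RtoC_mult. do 2 f_equal.
    rewrite fact_simpl, mult_INR. unfold Rdiv. ring.
Qed.

(** The n-th term involves f (x - n), so the series stops at n = x; read backwards it is the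
    binomial transform of f. *)
Lemma opexp_Kminus (f : nat -> C) (x : nat) :
  opexp Kminus f x = sum_n (fun m => Cmult (RtoC (binom_coef x m)) (f m)) x.
Proof.
  unfold opexp. rewrite (CSeries_finite _ x).
  - rewrite <- (sum_n_rev (fun m => Cmult (RtoC (binom_coef x m)) (f m)) x).
    apply sum_n_ext_loc; intros n Hn. rewrite iter_Kminus.
    replace (n <=? x)%nat with true by (symmetry; apply Nat.leb_le; auto).
    rewrite Cmult_assoc, <- RtoC_mult. do 2 f_equal.
    unfold binom_coef. replace (x - n <=? x)%nat with true by (symmetry; apply Nat.leb_le; lia).
    replace (x - (x - n))%nat with n by lia. field.
    split; apply INR_fact_neq_0.
  - intros n Hn. rewrite iter_Kminus.
    replace (n <=? x)%nat with false by (symmetry; apply Nat.leb_gt; auto). ring.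
Qed.

(** * The weights and the evolved monomials *)

(** Coefficients of W_nu(t) = (1 - dl t)^(- nu / dl), read as e^{nu t} when dl = 0. For nu = N and
    dl = -1 they are the binomial coefficients of (1 + t)^N. *)
Fixpoint wt (nu dl : R) (n : nat) : R :=
  match n with
  | O => 1
  | S m => wt nu dl m * (nu + dl * INR m) / INR (S m)
  end.

Lemma wt_succ (nu dl : R) (n : nat) :
  INR (S n) * wt nu dl (S n) = (nu + dl * INR n) * wt nu dl n.
Proof.
  change (wt nu dl (S n)) with (wt nu dl n * (nu + dl * INR n) / INR (S n)).
  field. apply not_0_INR; discriminate.
Qed.

Lemma wt_pos (nu dl : R) (n : nat) : 0 < nu -> 0 <= dl -> 0 < wt nu dl n.
Proof.
  intros Hn Hd. induction n as [|n IH]; [simpl; lra|].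
  change (0 < wt nu dl n * (nu + dl * INR n) / INR (S n)).
  apply Rdiv_lt_0_compat; [|apply lt_0_INR; lia].
  apply Rmult_lt_0_compat; auto. assert (H := pos_INR n). nra.
Qed.

Lemma is_lim_wt_ratio (nu dl : R) :
  0 < nu -> 0 <= dl ->
  is_lim_seq (fun n => Rabs (wt nu dl (S n) / wt nu dl n)) dl.
Proof.
  intros Hn Hd.
  apply is_lim_seq_ext with (fun n => dl + (nu - dl) * / INR (S n)).
  - intros n. assert (W := wt_pos nu dl n Hn Hd).
    assert (P : 0 < INR (S n)) by (apply lt_0_INR; lia). assert (Q := pos_INR n).
    change (wt nu dl (S n)) with (wt nu dl n * (nu + dl * INR n) / INR (S n)).
    replace (wt nu dl n * (nu + dl * INR n) / INR (S n) / wt nu dl n)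
      with ((nu + dl * INR n) / INR (S n)) by (field; lra).
    rewrite Rabs_pos_eq.
    + rewrite S_INR in *. field. lra.
    + left; apply Rdiv_lt_0_compat; auto. nra.
  - replace (Finite dl) with (Finite (dl + (nu - dl) * 0)) by (f_equal; ring).
    apply is_lim_seq_plus'; [apply is_lim_seq_const|].
    apply is_lim_seq_mult'; [apply is_lim_seq_const|].
    apply (is_lim_seq_incr_1 (fun n => / INR n)).
    replace (Finite 0) with (Rbar_inv p_infty) by reflexivity.
    apply is_lim_seq_inv; [apply is_lim_seq_INR | discriminate].
Qed.

(** The ratio of successive weights tends to dl, so the radius is 1 / dl, or infinite when dl =
    0. *)
Lemma CV_radius_wt (nu dl : R) :
  0 < nu -> 0 <= dl <= 1 -> Rbar_le 1 (CV_radius (wt nu dl)).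
Proof.
  intros Hn [Hd0 Hd1].
  assert (N0 : forall n, wt nu dl n <> 0)
    by (intros n; generalize (wt_pos nu dl n Hn Hd0); lra).
  assert (L := is_lim_wt_ratio nu dl Hn Hd0).
  destruct (Req_dec dl 0) as [E|E].
  - subst dl. rewrite (CV_radius_infinite_DAlembert _ N0 L). exact I.
  - assert (P : 0 < dl) by lra.
    rewrite (CV_radius_finite_DAlembert _ dl N0 P L). simpl.
    rewrite <- Rinv_1. apply Rinv_le_contravar; auto.
Qed.

(* The coefficients satisfy W' = nu W + u W', so W(u) (1 - u)^nu is constant. *)
Lemma PSeries_wt_1 (nu u : R) :
  0 < nu -> Rabs u < 1 -> PSeries (wt nu 1) u = Rpower (1 - u) (- nu).
Proof.
  intros Hn Hu. set (w := wt nu 1).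
  assert (HR : forall x, Rabs x < 1 -> Rbar_lt (Rabs x) (CV_radius w)).
  { intros x Hx. apply Rbar_lt_le_trans with 1; [exact Hx|]. apply CV_radius_wt; lra. }
  assert (D : forall x, Rabs x < 1 ->
    (1 - x) * PSeries (PS_derive w) x = nu * PSeries w x).
  { intros x Hx.
    assert (E : PSeries (PS_derive w) x = nu * PSeries w x + x * PSeries (PS_derive w) x).
    { rewrite <- PSeries_incr_1, <- PSeries_scal, <- PSeries_plus.
      - apply PSeries_ext. intros n.
        change (INR (S n) * wt nu 1 (S n) = nu * wt nu 1 n + PS_incr_1 (PS_derive w) n).
        rewrite wt_succ. destruct n as [|n].
        + change (PS_incr_1 (PS_derive w) 0) with 0. simpl INR. ring.
        + change (PS_incr_1 (PS_derive w) (S n)) with (INR (S n) * wt nu 1 (S n)). ring.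
      - apply ex_pseries_scal; [apply Rmult_comm|]. apply CV_radius_inside, HR, Hx.
      - apply ex_pseries_incr_1, ex_pseries_derive, HR, Hx. }
    lra. }
  set (phi := fun x => PSeries w x * Rpower (1 - x) nu).
  assert (Dphi : forall x, Rabs x < 1 -> is_derive phi x 0).
  { intros x Hx. assert (Hx' := Rabs_def2 _ _ Hx).
    assert (D1 := is_derive_PSeries w x (HR x Hx)).
    assert (D2 : is_derive (fun x => Rpower (1 - x) nu) x (- nu / (1 - x) * Rpower (1 - x) nu)).
    { unfold Rpower. auto_derive; [lra|]. unfold Rminus. field. lra. }
    assert (D3 := is_derive_mult _ _ _ _ _ D1 D2 Rmult_comm).
    replace 0 with (plus (mult (PSeries (PS_derive w) x) (Rpower (1 - x) nu))
                     (mult (PSeries w x) (- nu / (1 - x) * Rpower (1 - x) nu))); [exact D3|].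
    unfold plus, mult; simpl. specialize (D x Hx).
    replace (PSeries (PS_derive w) x) with (nu * PSeries w x / (1 - x)).
    - field; lra.
    - rewrite <- D. field; lra. }
  assert (E : phi u = 1).
  { assert (P0 : phi 0 = 1).
    { unfold phi. rewrite PSeries_0, Rminus_0_r. unfold Rpower. rewrite ln_1, Rmult_0_r, exp_0.
      unfold w; simpl; ring. }
    apply Rabs_def2 in Hu. rewrite <- P0.
    destruct (Rtotal_order u 0) as [H|[H|H]].
    - apply (eq_is_derive phi u 0); auto. intros t Ht. apply Dphi, Rabs_def1; lra.
    - now rewrite H.
    - symmetry. apply (eq_is_derive phi 0 u); auto. intros t Ht. apply Dphi, Rabs_def1; lra. }
  unfold phi in E. rewrite Rpower_Ropp.
  assert (P : 0 < Rpower (1 - u) nu) by apply exp_pos.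
  apply Rmult_eq_reg_r with (Rpower (1 - u) nu); [|lra].
  fold w. rewrite E. field. lra.
Qed.

(** With g the value at the centre, G^(- nu) = g^(- nu) (1 - (1 - G / g))^(- nu), the composition of
    the binomial series [wt nu 1] with a function vanishing at the centre. *)
Lemma real_analytic2_Rpower_neg (G : R -> R -> R) (nu b0 t0 : R) :
  0 < nu -> 0 < G b0 t0 -> real_analytic2 G b0 t0 ->
  (exists d, 0 < d /\ forall b t, Rabs (b - b0) < d -> Rabs (t - t0) < d ->
     Rabs (1 - G b t / G b0 t0) < 1) ->
  real_analytic2 (fun b t => Rpower (G b t) (- nu)) b0 t0.
Proof.
  intros Hn HG0 HG (d & Hd & Hnear). set (g := G b0 t0) in *.
  assert (A : real_analytic2 (fun b t => 1 - G b t / g) b0 t0).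
  { apply real_analytic2_ext with (fun b t => 1 + - / g * G b t).
    - intros; field; lra.
    - apply real_analytic2_plus; [apply real_analytic2_const|].
      apply real_analytic2_scal; auto. }
  apply (real_analytic2_ext_loc
    (fun b t => Rpower g (- nu) * PSeries (wt nu 1) (1 - G b t / g)) _ b0 t0 d Hd).
  - intros b t Hb Ht. rewrite PSeries_wt_1 by auto.
    assert (N := Rabs_def2 _ _ (Hnear b t Hb Ht)).
    replace (1 - (1 - G b t / g)) with (G b t / g) by ring.
    rewrite Rpower_mult_distr; auto; [|lra]. f_equal. field; lra.
  - apply real_analytic2_scal. apply real_analytic2_PSeries; auto.
    fold g. replace (1 - g / g) with 0 by (field; lra). rewrite Rabs_R0.
    apply Rbar_lt_le_trans with 1; [exact Rlt_0_1 | apply CV_radius_wt; lra].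
Qed.

Lemma real_analytic2_exp (G : R -> R -> R) (b0 t0 : R) :
  real_analytic2 G b0 t0 -> real_analytic2 (fun b t => exp (G b t)) b0 t0.
Proof.
  intros H. apply real_analytic2_ext with (fun b t => PSeries (fun n => / INR (fact n)) (G b t)).
  - intros; symmetry; apply is_pseries_unique, is_exp_Reals.
  - apply real_analytic2_PSeries; auto.
    replace (CV_radius (fun n => / INR (fact n))) with p_infty; [exact I|].
    symmetry. apply CV_radius_infinite_DAlembert.
    + intros n. apply Rinv_neq_0_compat, INR_fact_neq_0.
    + apply is_lim_seq_ext with (fun n => / INR (S n)).
      * intros n. rewrite fact_simpl, mult_INR.
        assert (P : 0 < INR (S n)) by (apply lt_0_INR; lia).
        assert (Q := INR_fact_lt_0 n).
        rewrite Rabs_pos_eq.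
        -- field; lra.
        -- left. apply Rdiv_lt_0_compat; apply Rinv_0_lt_compat; auto.
           apply Rmult_lt_0_compat; auto.
      * apply (is_lim_seq_incr_1 (fun n => / INR n)).
        replace (Finite 0) with (Rbar_inv p_infty) by reflexivity.
        apply is_lim_seq_inv; [apply is_lim_seq_INR | discriminate].
Qed.

(* Coefficients of (c t - d) H(t), those of H being h. *)
Definition shiftmul (c d : R) (h : nat -> R) (n : nat) : R :=
  c * prevR h n - d * h n.

(* On generating functions weighted by [wt nu dl], the operator
   -p X^+ + q X^- becomes (q dl t^2 - p) d/dt + q nu t. *)
Definition gen_jacobi (p q nu dl : R) : (nat -> R) -> nat -> R :=
  jacobi (fun n => - p * INR (S n)) (fun n => q * (nu + dl * (INR n - 1))).

(** For dl <> 0 the last equation is that of z = c^(- nu / dl); as a differential equation it also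
    covers dl = 0, where z is a Gaussian. The data are required at a single time because c has zeros
    in the trigonometric case. *)
Definition flow_data (p q nu dl : R) (c s z : R -> R) (b : R) : Prop :=
  c b <> 0 /\ is_derive c b (p * q * dl * s b) /\ is_derive s b (c b) /\
  is_derive z b (- (nu * p * q * (s b / c b)) * z b).

Definition base (nu dl z a : R) (n : nat) : R := z * wt nu dl n * a ^ n.

(** The evolution of the monomial t^0, namely z W_nu(q T t). The quotient T = s / c enters only
    through its Riccati equation; [wt_succ], used at n and at n - 1, brings all terms to the same
    weight. *)
Lemma is_derive_base (p q nu dl : R) (z T : R -> R) (b : R) (n : nat) :
  is_derive z b (- (nu * p * q * T b) * z b) ->
  is_derive T b (1 - p * q * dl * T b ^ 2) ->
  is_derive (fun s => base nu dl (z s) (q * T s) n) b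
    (gen_jacobi p q nu dl (base nu dl (z b) (q * T b)) n).
Proof.
  intros Hz HT. unfold base, gen_jacobi, jacobi.
  assert (E1 := wt_succ nu dl n).
  evar_last.
  - auto_derive; [split; [eexists; exact Hz | split; [eexists; exact HT | exact I]]|].
    rewrite (is_derive_unique (fun x : R => z x) _ _ Hz), (is_derive_unique (fun x : R => T x) _ _ HT).
      reflexivity.
  - cbv beta.
    replace (- p * INR (S n) * (z b * wt nu dl (S n) * (q * T b) ^ S n)) with
      (- p * z b * (q * T b) ^ S n * (INR (S n) * wt nu dl (S n))) by ring.
    rewrite E1. destruct n as [|m].
    + simpl. ring.
    + unfold prevR. assert (E2 := wt_succ nu dl m).
      rewrite (S_INR m). rewrite (S_INR m) in E2.
      replace (q * (nu + dl * (INR m + 1 - 1)) * (z b * wt nu dl m * (q * T b) ^ m)) with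
        (q * z b * (q * T b) ^ m * ((nu + dl * INR m) * wt nu dl m)) by ring.
      rewrite <- E2. rewrite <- (S_INR m). simpl Init.Nat.pred. rewrite (S_INR m).
      rewrite <- !tech_pow_Rmult. ring.
Qed.

(** P = c t - p s satisfies dP/db = (q dl t^2 - p) dP/dt - q dl t P. Multiplication by P therefore
    turns a solution for the index nu + dl into one for nu. *)
Lemma is_derive_shiftmul (p q nu dl : R) (c s : R -> R) (h : R -> nat -> R) (b : R) :
  is_derive c b (p * q * dl * s b) -> is_derive s b (c b) ->
  (forall n, is_derive (fun r => h r n) b (gen_jacobi p q (nu + dl) dl (h b) n)) ->
  forall n, is_derive (fun r => shiftmul (c r) (p * s r) (h r) n) b
              (gen_jacobi p q nu dl (shiftmul (c b) (p * s b) (h b)) n).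
Proof.
  intros Hc Hs Hh n. unfold shiftmul.
  assert (Hp : is_derive (fun r => prevR (h r) n) b
            (prevR (gen_jacobi p q (nu + dl) dl (h b)) n)).
  { destruct n as [|n]; [exact (is_derive_const (V := R_NormedModule) 0 b) | apply Hh]. }
  evar_last.
  - apply (is_derive_minus (V := R_NormedModule)).
    + apply (is_derive_mult c (fun r => prevR (h r) n)); [exact Hc | exact Hp | exact Rmult_comm].
    + apply (is_derive_mult (fun r => p * s r) (fun r => h r n));
        [apply is_derive_scal; exact Hs | apply Hh | exact Rmult_comm].
  - unfold minus, plus, opp, mult; simpl. unfold gen_jacobi, jacobi.
    destruct n as [|[|n]]; unfold prevR; rewrite ?S_INR; simpl INR; ring.
Qed.

Lemma is_derive_iter_shiftmul (p q dl : R) (c s : R -> R) (b : R) (y : nat) :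
  is_derive c b (p * q * dl * s b) -> is_derive s b (c b) ->
  forall (nu : R) (h : R -> nat -> R),
  (forall n, is_derive (fun r => h r n) b (gen_jacobi p q (nu + dl * INR y) dl (h b) n)) ->
  forall n, is_derive (fun r => Nat.iter y (shiftmul (c r) (p * s r)) (h r) n) b
              (gen_jacobi p q nu dl (Nat.iter y (shiftmul (c b) (p * s b)) (h b)) n).
Proof.
  intros Hc Hs. induction y as [|y IH]; intros nu h Hh.
  - intros n. simpl in *. replace nu with (nu + dl * 0) by ring. apply Hh.
  - apply (is_derive_shiftmul p q nu dl c s
             (fun r => Nat.iter y (shiftmul (c r) (p * s r)) (h r)) b Hc Hs).
    apply IH. intros n. rewrite S_INR in Hh.
    replace (nu + dl + dl * INR y) with (nu + dl * (INR y + 1)) by ring. apply Hh.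
Qed.

(* Taylor coefficients in t of z c^{-y} (c t - p s)^y W(q s t / c), where W has the
   coefficients [wt (nu + dl y) dl]: for dl <> 0 this is
   (c t - p s)^y (c - q dl s t)^{- nu / dl - y}. *)
Definition evolved_gen (p q nu dl c s z : R) (y : nat) : nat -> R :=
  Nat.iter y (shiftmul c (p * s)) (base (nu + dl * INR y) dl (z / c ^ y) (q * (s / c))).

Lemma is_derive_evolved_gen (p q nu dl : R) (c s z : R -> R) (b : R) (y n : nat) :
  flow_data p q nu dl c s z b ->
  is_derive (fun r => evolved_gen p q nu dl (c r) (s r) (z r) y n) b
    (gen_jacobi p q nu dl (evolved_gen p q nu dl (c b) (s b) (z b) y) n).
Proof.
  intros (Hc0 & Hc & Hs & Hz).
  apply (is_derive_iter_shiftmul p q dl c s b y Hc Hs nu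
    (fun r => base (nu + dl * INR y) dl (z r / c r ^ y) (q * (s r / c r)))).
  intros m.
  apply (is_derive_base p q (nu + dl * INR y) dl (fun r => z r / c r ^ y)
           (fun r => s r / c r) b m).
  (* As c' / c = p q dl s / c, dividing z by c^y replaces nu by nu + dl y in its equation. *)
  - evar_last.
    + auto_derive; [split; [eexists; exact Hz|]; split; [eexists; exact Hc|];
        split; [apply pow_nonzero; exact Hc0 | exact I]|].
      rewrite (is_derive_unique (fun x : R => z x) _ _ Hz), (is_derive_unique (fun x : R => c x) _ _ Hc).
      reflexivity.
    + cbv beta. destruct y as [|y].
      * simpl. field. auto.
      * simpl Init.Nat.pred. simpl pow. field. split; auto. apply pow_nonzero; auto.
  - evar_last.
    + auto_derive; [split; [eexists; exact Hs|]; split; [eexists; exact Hc|];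
        split; [exact Hc0 | exact I]|].
      rewrite (is_derive_unique (fun x : R => s x) _ _ Hs), (is_derive_unique (fun x : R => c x) _ _ Hc).
      reflexivity.
    + cbv beta. field. auto.
Qed.

Lemma is_series_shiftmul (c d : R) (h : nat -> R) (t l : R) :
  is_series (fun n => h n * t ^ n) l ->
  is_series (fun n => shiftmul c d h n * t ^ n) ((c * t - d) * l).
Proof.
  intros H.
  assert (P : is_series (fun n => prevR h n * t ^ n) (t * l)).
  { apply is_series_decr_1.
    change (is_series (fun k => h k * (t * t ^ k)) (t * l + - (0 * 1))).
    replace (t * l + - (0 * 1)) with (t * l) by ring.
    eapply is_series_ext; [|apply (is_series_scal (V := R_NormedModule) t _ _ H)].
    intros n. unfold scal; simpl; unfold mult; simpl. ring. }
  replace ((c * t - d) * l) with (minus (scal c (t * l)) (scal d l))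
    by (unfold minus, plus, opp, scal; simpl; unfold mult; simpl; ring).
  eapply is_series_ext; [|apply (is_series_minus (V := R_NormedModule)
     _ _ _ _ (is_series_scal (V := R_NormedModule) c _ _ P)
     (is_series_scal (V := R_NormedModule) d _ _ H))].
  intros n. unfold shiftmul, plus, opp, scal; simpl; unfold mult; simpl. ring.
Qed.

Lemma is_series_evolved_gen (p q nu dl c s z t : R) (y : nat) :
  Rbar_lt (Rabs (q * (s / c) * t)) (CV_radius (wt (nu + dl * INR y) dl)) ->
  is_series (fun n => evolved_gen p q nu dl c s z y n * t ^ n)
    ((c * t - p * s) ^ y * (z / c ^ y * PSeries (wt (nu + dl * INR y) dl) (q * (s / c) * t))).
Proof.
  intros H. unfold evolved_gen.
  assert (B : is_series (fun n => base (nu + dl * INR y) dl (z / c ^ y) (q * (s / c)) n * t ^ n)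
    (z / c ^ y * PSeries (wt (nu + dl * INR y) dl) (q * (s / c) * t))).
  { apply CV_radius_inside, PSeries_correct, is_pseries_R in H.
    eapply is_series_ext; [|apply (is_series_scal (V := R_NormedModule) (z / c ^ y) _ _ H)].
    intros n. unfold base, scal; simpl; unfold mult; simpl.
    rewrite Rpow_mult_distr. ring. }
  revert B. generalize (z / c ^ y * PSeries (wt (nu + dl * INR y) dl) (q * (s / c) * t)) as l.
  generalize (base (nu + dl * INR y) dl (z / c ^ y) (q * (s / c))) as h. clear H.
  induction y as [|y IH]; intros h l B.
  - simpl. rewrite Rmult_1_l. exact B.
  - simpl Nat.iter. simpl pow. rewrite Rmult_assoc.
    apply is_series_shiftmul, IH, B.
Qed.

(** * The value of the flow at the final time *)

(** The coefficient form of W_nu' = nu W_{nu + dl}. *)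
Lemma wt_shift (nu dl : R) (n : nat) :
  INR (S n) * wt nu dl (S n) = nu * wt (nu + dl) dl n.
Proof.
  induction n as [|n IH].
  - simpl. field.
  - rewrite wt_succ.
    assert (P : INR (S n) <> 0) by (apply not_0_INR; discriminate).
    apply Rmult_eq_reg_l with (INR (S n)); auto.
    replace (INR (S n) * ((nu + dl * INR (S n)) * wt nu dl (S n))) with
      ((nu + dl * INR (S n)) * (INR (S n) * wt nu dl (S n))) by ring.
    rewrite IH.
    replace (INR (S n) * (nu * wt (nu + dl) dl (S n))) with
      (nu * (INR (S n) * wt (nu + dl) dl (S n))) by ring.
    rewrite wt_succ, S_INR. ring.
Qed.

(** The coefficient form of W_nu = (1 - dl t) W_{nu + dl}. *)
Lemma wt_step (nu dl : R) (n : nat) :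
  wt nu dl (S n) = wt (nu + dl) dl (S n) - dl * wt (nu + dl) dl n.
Proof.
  assert (P : INR (S n) <> 0) by (apply not_0_INR; discriminate).
  apply Rmult_eq_reg_l with (INR (S n)); auto.
  rewrite wt_shift, Rmult_minus_distr_l, wt_succ, S_INR. ring.
Qed.

Lemma wt_split (nu dl : R) (m j : nat) :
  wt nu dl (m + j) * INR (fact (m + j)) =
  wt nu dl m * INR (fact m) * (wt (nu + dl * INR m) dl j * INR (fact j)).
Proof.
  induction j as [|j IH].
  - rewrite Nat.add_0_r. simpl. ring.
  - rewrite Nat.add_succ_r, !fact_simpl, !mult_INR.
    replace (wt nu dl (S (m + j)) * (INR (S (m + j)) * INR (fact (m + j)))) with
      (INR (S (m + j)) * wt nu dl (S (m + j)) * INR (fact (m + j))) by ring.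
    replace (wt (nu + dl * INR m) dl (S j) * (INR (S j) * INR (fact j))) with
      (INR (S j) * wt (nu + dl * INR m) dl (S j) * INR (fact j)) by ring.
    rewrite !wt_succ, plus_INR.
    replace ((nu + dl * (INR m + INR j)) * wt nu dl (m + j) * INR (fact (m + j))) with
      ((nu + dl * (INR m + INR j)) * (wt nu dl (m + j) * INR (fact (m + j)))) by ring.
    rewrite IH. ring.
Qed.

(** In terms of weighted generating functions: the binomial transform e^{K^-} sends t^m to t^m W_{nu
    + dl m}(t). *)
Lemma wt_binomial (nu dl : R) (n m : nat) :
  (m <= n)%nat -> wt nu dl m <> 0 ->
  wt (nu + dl * INR m) dl (n - m)%nat = binom_coef n m * wt nu dl n / wt nu dl m.
Proof.
  intros Hm H0. unfold binom_coef.
  replace (m <=? n)%nat with true by (symmetry; apply Nat.leb_le; auto).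
  assert (E := wt_split nu dl m (n - m)). replace (m + (n - m))%nat with n in E by lia.
  assert (A := INR_fact_neq_0 m). assert (B := INR_fact_neq_0 (n - m)).
  apply Rmult_eq_reg_r with (wt nu dl m * INR (fact m) * INR (fact (n - m))).
  - transitivity (wt nu dl n * INR (fact n)); [rewrite E; ring|]. field; auto.
  - repeat apply Rmult_integral_contrapositive_currified; auto.
Qed.

(* [bin r y m] is the coefficient of X^m in (r + X)^y. *)
Fixpoint bin (r : R) (y : nat) : nat -> R :=
  match y with
  | O => fun m => match m with O => 1 | _ => 0 end
  | S y => fun m => r * bin r y m + prevR (bin r y) m
  end.

Lemma bin_lt (r : R) (y m : nat) : (y < m)%nat -> bin r y m = 0.
Proof.
  revert m. induction y as [|y IH]; intros [|m] H; try lia; auto.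
  simpl. rewrite !IH by lia. ring.
Qed.

Lemma bin_add (r : R) (x n : nat) :
  bin r (x + n) x = INR (fact (x + n)) / (INR (fact x) * INR (fact n)) * r ^ n.
Proof.
  remember (x + n)%nat as y eqn:E. revert x n E.
  induction y as [|y IH]; intros x n E.
  - assert (x = 0%nat) by lia. assert (n = 0%nat) by lia. subst. simpl. field.
  - assert (F := INR_fact_neq_0). destruct x as [|x].
    + simpl bin. rewrite (IH 0%nat y) by lia. simpl in E. subst n.
      rewrite Rplus_0_r. simpl pow. field. auto.
    + destruct n as [|n].
      * change (r * bin r y (S x) + bin r y x = INR (fact (S y)) / (INR (fact (S x)) * INR (fact 0)) * 1).
        rewrite bin_lt by lia. rewrite (IH x 0%nat) by lia.
        assert (y = x) by lia. subst y. simpl (fact 0). simpl pow. simpl (INR 1).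
        field. auto.
      * change (r * bin r y (S x) + bin r y x = INR (fact (S y)) / (INR (fact (S x)) * INR (fact (S n))) * (r * r ^ n)).
        rewrite (IH (S x) n), (IH x (S n)) by lia.
        assert (P : INR y = INR x + INR n + 1).
        { rewrite <- plus_INR, <- S_INR. f_equal. lia. }
        rewrite !fact_simpl, !mult_INR, !S_INR, P. simpl pow.
        assert (X := pos_INR x). assert (N := pos_INR n).
        field. repeat split; auto; lra.
Qed.

Lemma sum_n_lin (x y : R) (a b : nat -> R) (n : nat) :
  sum_n (fun m => x * a m + y * b m) n = x * sum_n a n + y * sum_n b n.
Proof.
  rewrite <- !sum_n_Rmult_l.
  exact (sum_n_plus (G := R_AbelianMonoid) (fun m => x * a m) (fun m => y * b m) n).
Qed.

Lemma sum_n_RSn (a : nat -> R) (n : nat) : sum_n a (S n) = sum_n a n + a (S n).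
Proof. exact (sum_Sn (G := R_AbelianMonoid) a n). Qed.

Lemma sum_n_Rhead (a : nat -> R) (n : nat) :
  sum_n a (S n) = a 0%nat + sum_n (fun k => a (S k)) n.
Proof. exact (sum_n_head (G := R_AbelianMonoid) a n). Qed.

(* r - t = r (1 - dl t) - (1 - dl r) t, and (1 - dl t) lowers the index of
   [wt] by dl: the coefficients of (r - t)^y W_{nu + dl y}(t). *)
Lemma iter_shiftmul_bin (r nu dl : R) (y n : nat) :
  Nat.iter y (shiftmul (-1) (- r)) (wt (nu + dl * INR y) dl) n =
  sum_n (fun m => bin r y m * ((- (1 - dl * r)) ^ m * wt (nu + dl * INR m) dl (n - m)%nat)) n.
Proof.
  set (rho := 1 - dl * r).
  revert nu n. induction y as [|y IH]; intros nu n.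
  - simpl Nat.iter. simpl bin. rewrite sum_n_single.
    + simpl INR. rewrite Nat.sub_0_r. simpl pow. ring.
    + intros; ring.
  - assert (EX : forall n, Nat.iter y (shiftmul (-1) (- r)) (wt (nu + dl * INR (S y)) dl) n =
      sum_n (fun m => bin r y m * ((- rho) ^ m * wt (nu + dl + dl * INR m) dl (n - m)%nat)) n).
    { intros k. rewrite <- IH. do 2 f_equal. rewrite S_INR. ring. }
    simpl Nat.iter. unfold shiftmul at 1. destruct n as [|k].
    + rewrite EX. simpl prevR. rewrite !sum_O. simpl. ring.
    + simpl prevR. rewrite !EX.
      rewrite (sum_n_ext (fun m => bin r (S y) m * _)
        (fun m => r * (bin r y m * ((- rho) ^ m * wt (nu + dl * INR m) dl (S k - m)%nat)) +
                  1 * (prevR (bin r y) m * ((- rho) ^ m * wt (nu + dl * INR m) dl (S k - m)%nat))))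
        by (intros m; simpl bin; R_eq; ring).
      (* With the term m = S k split off and the shifted sum reindexed, all sums run over 0, ..., k
         and can be compared term by term with [wt_step]. *)
      rewrite sum_n_lin, (sum_n_Rhead (fun m => prevR _ m * _)), !sum_n_RSn.
      cbv beta. rewrite !Nat.sub_diag. cbn [prevR wt].
      transitivity (r * (bin r y (S k) * ((- rho) ^ S k * 1)) +
        sum_n (fun m => -1 * (bin r y m * ((- rho) ^ m * wt (nu + dl + dl * INR m) dl (k - m)%nat)) +
          r * (bin r y m * ((- rho) ^ m * wt (nu + dl + dl * INR m) dl (S k - m)%nat))) k).
      { rewrite sum_n_lin. simpl pow. ring. }
      transitivity (r * (bin r y (S k) * ((- rho) ^ S k * 1)) +
        sum_n (fun m => r * (bin r y m * ((- rho) ^ m * wt (nu + dl * INR m) dl (S k - m)%nat)) +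
           1 * (bin r y m * ((- rho) ^ S m * wt (nu + dl * INR (S m)) dl (S k - S m)%nat))) k).
      * f_equal. apply sum_n_ext_loc. intros m Hm.
        change (S k - S m)%nat with (k - m)%nat.
        replace (S k - m)%nat with (S (k - m)) by lia.
        rewrite (wt_step (nu + dl * INR m)).
        replace (nu + dl * INR m + dl) with (nu + dl + dl * INR m) by ring.
        replace (nu + dl * INR (S m)) with (nu + dl + dl * INR m) by (rewrite S_INR; ring).
        simpl pow. unfold rho. R_eq. ring.
      * rewrite sum_n_lin. simpl pow. ring.
Qed.

(** Each of the y factors c t - c r equals - c (r - t), whence the sign. *)
Lemma iter_shiftmul_scal (c r k : R) (h : nat -> R) (y n : nat) :
  (-1) ^ y * Nat.iter y (shiftmul c (c * r)) (fun n => k * h n) n =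
  c ^ y * k * Nat.iter y (shiftmul (-1) (- r)) h n.
Proof.
  revert n. induction y as [|y IH]; intros n; [simpl; ring|].
  simpl Nat.iter. unfold shiftmul at 1 3. destruct n as [|n]; simpl prevR; simpl pow.
  - transitivity (c * r * ((-1) ^ y * Nat.iter y (shiftmul c (c * r)) (fun n => k * h n) 0%nat)).
    + ring.
    + rewrite IH. ring.
  - transitivity (c * r * ((-1) ^ y * Nat.iter y (shiftmul c (c * r)) (fun n => k * h n) (S n))
      - c * ((-1) ^ y * Nat.iter y (shiftmul c (c * r)) (fun n => k * h n) n)).
    + ring.
    + rewrite !IH. ring.
Qed.

(** At the final time W(q s t / c) becomes W(t) and c t - p s becomes c (t - r); the powers of c
    cancel, and the sign on the left comes from exp(i pi X^0). *)
Lemma evolved_gen_final (p q nu dl c s z r : R) (y n : nat) :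
  c <> 0 -> q * (s / c) = 1 -> p * (s / c) = r ->
  (-1) ^ y * evolved_gen p q nu dl c s z y n =
  z * sum_n (fun m => bin r y m * ((- (1 - dl * r)) ^ m * wt (nu + dl * INR m) dl (n - m)%nat)) n.
Proof.
  intros Hc Hq Hp. unfold evolved_gen. rewrite <- iter_shiftmul_bin.
  replace (p * s) with (c * r) by (rewrite <- Hp; field; auto).
  replace (base (nu + dl * INR y) dl (z / c ^ y) (q * (s / c))) with
    (fun n => z / c ^ y * wt (nu + dl * INR y) dl n).
  - rewrite iter_shiftmul_scal. field. apply pow_nonzero; auto.
  - apply functional_extensionality; intros m. unfold base. rewrite Hq, pow1. ring.
Qed.

Lemma evolved_gen_init (p q nu dl : R) (y n : nat) :
  evolved_gen p q nu dl 1 0 1 y n = delta y 1 n.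
Proof.
  unfold evolved_gen. rewrite Rmult_0_r.
  replace (q * (0 / 1)) with 0 by (unfold Rdiv; ring). rewrite pow1.
  assert (B : forall n, base (nu + dl * INR y) dl (1 / 1) 0 n = delta 0 1 n).
  { intros [|m]; unfold base, delta; [simpl; field|].
    rewrite pow_i by lia. cbn [Nat.eqb]. ring. }
  revert B. generalize (base (nu + dl * INR y) dl (1 / 1) 0) as h. intros h B.
  revert n. induction y as [|y IH]; intros n; [apply B|].
  simpl Nat.iter. unfold shiftmul at 1. destruct n as [|n]; simpl prevR.
  - unfold delta; simpl. ring.
  - rewrite IH. unfold delta. simpl. ring.
Qed.

(** For dl = -1 the factor W_{N - y} is a polynomial of degree N - y, and each of the y linear
    factors raises the degree by at most one. *)
Lemma evolved_gen_degree (p q dl c s z : R) (N y n : nat) :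
  (y <= N)%nat -> (N < n)%nat -> dl = -1 -> evolved_gen p q (INR N) dl c s z y n = 0.
Proof.
  intros Hy Hn ->. unfold evolved_gen.
  assert (W : forall k n, (k < n)%nat -> wt (INR k) (-1) n = 0).
  { intros k m Hm. induction Hm as [|m Hm IH].
    - change (wt (INR k) (-1) k * (INR k + -1 * INR k) / INR (S k) = 0). unfold Rdiv; ring.
    - change (wt (INR k) (-1) m * (INR k + -1 * INR m) / INR (S m) = 0).
      rewrite IH. unfold Rdiv; ring. }
  replace (INR N + -1 * INR y) with (INR (N - y)) by (rewrite minus_INR by auto; ring).
  assert (B : forall m, (N - y < m)%nat ->
    base (INR (N - y)) (-1) (z / c ^ y) (q * (s / c)) m = 0).
  { intros m Hm. unfold base. rewrite W by auto. ring. }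
  revert B. generalize (base (INR (N - y)) (-1) (z / c ^ y) (q * (s / c))) as h.
  assert (G : forall d h, (forall m, (d < m)%nat -> h m = 0) ->
    forall y m, (d + y < m)%nat -> Nat.iter y (shiftmul c (p * s)) h m = 0).
  { intros d h Hh. induction y0 as [|y0 IH]; intros m Hm; [apply Hh; lia|].
    simpl Nat.iter. unfold shiftmul at 1. destruct m as [|m]; [lia|]. simpl prevR.
    rewrite !IH by lia. ring. }
  intros h B. apply (G _ _ B). lia.
Qed.

(** Value at n of the evolved indicator function of y: its generating function starts as wt_y t^y,
    and a coefficient is divided by wt_n to recover the value. *)
Definition evolved_coef (p q nu dl c s z : R) (y n : nat) : R :=
  wt nu dl y * evolved_gen p q nu dl c s z y n / wt nu dl n.

(** The disjunction is for the top state n = N when dl = -1: the next weight is 0, so the value at n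
    + 1 is a quotient by 0. The operator ignores that value, whereas the equation for the
    coefficients contains the coefficient of t^(n + 1), which must then vanish. *)
Lemma is_derive_evolved_coef (p q nu dl : R) (c s z : R -> R) (b : R) (y n : nat) :
  flow_data p q nu dl c s z b -> wt nu dl n <> 0 ->
  (nu + dl * INR n <> 0 \/ evolved_gen p q nu dl (c b) (s b) (z b) y (S n) = 0) ->
  is_derive (fun r => evolved_coef p q nu dl (c r) (s r) (z r) y n) b
    (jacobi (fun n => - p * (nu + dl * INR n)) (fun n => q * INR n)
       (evolved_coef p q nu dl (c b) (s b) (z b) y) n).
Proof.
  intros HF Hn Hz.
  assert (D := is_derive_evolved_gen p q nu dl c s z b y n HF).
  assert (D' := is_derive_scal _ _ (wt nu dl y / wt nu dl n) _ D).
  evar_last.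
  - eapply is_derive_ext; [|exact D']. intros r. unfold evolved_coef. R_eq. field. auto.
  - cbv beta. unfold gen_jacobi, jacobi, evolved_coef.
    set (H := evolved_gen p q nu dl (c b) (s b) (z b) y) in *.
    rewrite Rmult_plus_distr_l. f_equal.
    + destruct (Req_dec (nu + dl * INR n) 0) as [E|E].
      * destruct Hz as [Hz|Hz]; [contradiction|]. rewrite Hz, E. unfold Rdiv. ring.
      * change (wt nu dl (S n)) with (wt nu dl n * (nu + dl * INR n) / INR (S n)).
        field. repeat split; auto. apply not_0_INR; discriminate.
    + destruct n as [|m]; unfold prevR; [ring|].
      assert (P : INR (S m) <> 0) by (apply not_0_INR; discriminate).
      change (wt nu dl (S m)) with (wt nu dl m * (nu + dl * INR m) / INR (S m)) in Hn |- *.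
      assert (A : wt nu dl m <> 0) by (intros A; apply Hn; rewrite A; unfold Rdiv; ring).
      assert (B : nu + dl * INR m <> 0) by (intros B; apply Hn; rewrite B; unfold Rdiv; ring).
      replace (INR (S m) - 1) with (INR m) by (rewrite S_INR; ring).
      field. auto.
Qed.

Definition evolved (p q nu dl : R) (c s z : R -> R) (a : nat -> C) (Y : nat) (b : R) (n : nat) : C :=
  sum_n (fun y => Cmult (RtoC (evolved_coef p q nu dl (c b) (s b) (z b) y n)) (a y)) Y.

Lemma jacobi_op_sum (u v : nat -> R) (k : nat -> nat -> R) (a : nat -> C) (Y n : nat) :
  jacobi_op u v (fun n => sum_n (fun y => Cmult (RtoC (k y n)) (a y)) Y) n =
  sum_n (fun y => Cmult (RtoC (jacobi u v (k y) n)) (a y)) Y.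
Proof.
  induction Y as [|Y IH].
  - rewrite sum_O. unfold jacobi_op, jacobi. rewrite !sum_O.
    destruct n as [|n]; simpl prev; simpl prevR; rewrite ?sum_O;
      rewrite RtoC_plus, !RtoC_mult; ring.
  - rewrite sum_Sn, <- IH. unfold jacobi_op, jacobi. rewrite !sum_Sn.
    unfold plus; simpl.
    destruct n as [|n]; simpl prev; simpl prevR; rewrite ?sum_Sn; unfold plus; simpl;
      rewrite RtoC_plus, !RtoC_mult; ring.
Qed.

Lemma is_derive_evolved (p q nu dl : R) (c s z : R -> R) (a : nat -> C) (Y : nat) (b : R) (n : nat) :
  flow_data p q nu dl c s z b -> wt nu dl n <> 0 ->
  (forall y, (y <= Y)%nat ->
     nu + dl * INR n <> 0 \/ evolved_gen p q nu dl (c b) (s b) (z b) y (S n) = 0) ->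
  is_derive (V := C_R_NormedModule) (fun r => evolved p q nu dl c s z a Y r n) b
    (jacobi_op (fun n => - p * (nu + dl * INR n)) (fun n => q * INR n)
       (evolved p q nu dl c s z a Y b) n).
Proof.
  intros HF Hn Hz. unfold evolved at 2. rewrite jacobi_op_sum.
  apply (is_derive_sum_n (V := C_R_NormedModule)
    (fun y r => Cmult (RtoC (evolved_coef p q nu dl (c r) (s r) (z r) y n)) (a y))).
  intros y Hy.
  assert (D := is_derive_evolved_coef p q nu dl c s z b y n HF Hn (Hz y Hy)).
  apply is_derive_C. destruct (a y) as [a1 a2]. split.
  - evar_last; [eapply is_derive_ext; [|exact (is_derive_scal _ _ a1 _ D)]|].
    + intros r. unfold Re; simpl. R_eq. ring.
    + unfold Re; simpl. ring.
  - evar_last; [eapply is_derive_ext; [|exact (is_derive_scal _ _ a2 _ D)]|].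
    + intros r. unfold Im; simpl. R_eq. ring.
    + unfold Im; simpl. ring.
Qed.

Lemma sum_n_zero (u : nat -> C) (Y : nat) :
  (forall y, (y <= Y)%nat -> u y = RtoC 0) -> sum_n u Y = RtoC 0.
Proof.
  induction Y as [|Y IH]; intros H; [rewrite sum_O; apply H; lia|].
  rewrite sum_Sn, IH, H by (intros; try apply H; lia). apply Cplus_0_l.
Qed.

Lemma sum_n_pick (u : nat -> C) (n Y : nat) :
  (n <= Y)%nat -> (forall y, y <> n -> u y = RtoC 0) -> sum_n u Y = u n.
Proof.
  induction Y as [|Y IH]; intros Hn H.
  - assert (n = 0%nat) by lia. subst. apply sum_O.
  - rewrite sum_Sn. destruct (Nat.eq_dec n (S Y)) as [->|E].
    + rewrite sum_n_zero; [apply Cplus_0_l|]. intros y Hy. apply H. lia.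
    + rewrite IH, (H (S Y)) by (auto; lia). apply Cplus_0_r.
Qed.

Lemma evolved_init (p q nu dl : R) (c s z : R -> R) (a : nat -> C) (Y n : nat) :
  c 0 = 1 -> s 0 = 0 -> z 0 = 1 -> wt nu dl n <> 0 ->
  (forall y, (Y < y)%nat -> a y = RtoC 0) ->
  evolved p q nu dl c s z a Y 0 n = a n.
Proof.
  intros Hc Hs Hz Hn Ha. unfold evolved. rewrite Hc, Hs, Hz.
  assert (K : forall y, evolved_coef p q nu dl 1 0 1 y n = delta y 1 n).
  { intros y. unfold evolved_coef. rewrite evolved_gen_init. unfold delta.
    destruct (Nat.eqb_spec n y) as [->|E]; field; auto. }
  destruct (Nat.le_gt_cases n Y) as [H|H].
  - rewrite (sum_n_pick _ n); auto.
    + rewrite K. unfold delta. rewrite Nat.eqb_refl. apply Cmult_1_l.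
    + intros y Hy. rewrite K. unfold delta.
      destruct (Nat.eqb_spec n y) as [E|E]; [congruence|]. apply Cmult_0_l.
  - rewrite sum_n_zero; [symmetry; apply Ha; auto|].
    intros y Hy. rewrite K. unfold delta.
    destruct (Nat.eqb_spec n y) as [E|E]; [lia|]. apply Cmult_0_l.
Qed.

(** * The exponential of the raising operator and the factored side *)

Definition Xplus (nu dl : R) : op nat :=
  fun f x => Cmult (RtoC (nu + dl * INR x)) (f (S x)).

Fixpoint rising (nu dl : R) (x n : nat) : R :=
  match n with O => 1 | S n => (nu + dl * INR x) * rising nu dl (S x) n end.

Lemma wt_rising (nu dl : R) (x n : nat) :
  wt nu dl x * INR (fact x) * rising nu dl x n = wt nu dl (x + n) * INR (fact (x + n)).
Proof.
  revert x. induction n as [|n IH]; intros x; simpl rising.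
  - rewrite Nat.add_0_r. ring.
  - replace (x + S n)%nat with (S x + n)%nat by lia. rewrite <- IH.
    rewrite fact_simpl, mult_INR.
    transitivity ((nu + dl * INR x) * wt nu dl x * (INR (fact x) * rising nu dl (S x) n)).
    + ring.
    + rewrite <- wt_succ. ring.
Qed.

Lemma iter_Xplus (nu dl r : R) (f : nat -> C) (n x : nat) :
  Nat.iter n (opscal (RtoC r) (Xplus nu dl)) f x =
  Cmult (RtoC (r ^ n * rising nu dl x n)) (f (x + n)%nat).
Proof.
  revert x. induction n as [|n IH]; intros x; simpl Nat.iter.
  - rewrite Nat.add_0_r. simpl. rewrite Rmult_1_r. symmetry. apply Cmult_1_l.
  - unfold opscal at 1, Xplus at 1. rewrite IH. simpl rising. simpl pow.
    replace (x + S n)%nat with (S x + n)%nat by lia. rewrite !RtoC_mult. ring.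
Qed.

Lemma sum_n_shift (b : nat -> C) (x Y : nat) :
  (forall y, (y < x)%nat -> b y = RtoC 0) -> (forall y, (Y < y)%nat -> b y = RtoC 0) ->
  sum_n (fun n => b (x + n)%nat) Y = sum_n b Y.
Proof.
  revert b. induction x as [|x IH]; intros b H1 H2; [reflexivity|].
  transitivity (sum_n (fun y => b (S y)) Y).
  - apply (IH (fun y => b (S y))).
    + intros y Hy. apply H1; lia.
    + intros y Hy. apply H2; lia.
  - assert (E := sum_n_head b Y). rewrite sum_Sn, (H2 (S Y)), (H1 0%nat) in E by lia.
    etransitivity; [symmetry; apply Cplus_0_l|].
    etransitivity; [symmetry; exact E|]. apply Cplus_0_r.
Qed.

(** On weighted generating functions the raising operator is d/dt, so its exponential is the
    translation t -> t + r and t^y contributes the coefficient of t^x in (r + t)^y. *)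
Lemma opexp_Xplus (nu dl r : R) (f : nat -> C) (Y x : nat) :
  wt nu dl x <> 0 -> (forall y, (Y < y)%nat -> f y = RtoC 0) ->
  opexp (opscal (RtoC r) (Xplus nu dl)) f x =
  sum_n (fun y => Cmult (RtoC (bin r y x * wt nu dl y / wt nu dl x)) (f y)) Y.
Proof.
  intros Hx Hf. unfold opexp. rewrite (CSeries_finite _ Y).
  - rewrite <- (sum_n_shift (fun y => Cmult (RtoC (bin r y x * wt nu dl y / wt nu dl x)) (f y)) x Y).
    + apply sum_n_ext; intros n. rewrite iter_Xplus, Cmult_assoc, <- RtoC_mult.
      do 2 f_equal. rewrite bin_add.
      assert (A := INR_fact_neq_0 n). assert (B := INR_fact_neq_0 x).
      assert (E := wt_rising nu dl x n).
      apply Rmult_eq_reg_r with (INR (fact n) * (wt nu dl x * INR (fact x))).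
      * transitivity (r ^ n * (wt nu dl x * INR (fact x) * rising nu dl x n)); [field; auto|].
        rewrite E. field. auto.
      * repeat apply Rmult_integral_contrapositive_currified; auto.
    + intros y Hy. rewrite bin_lt by auto. unfold Rdiv. rewrite !Rmult_0_l. apply Cmult_0_l.
    + intros y Hy. rewrite Hf by auto. apply Cmult_0_r.
  - intros n Hn. rewrite iter_Xplus, Hf by lia. rewrite !Cmult_0_r. reflexivity.
Qed.

Lemma sum_n_Cmult_l (c : C) (u : nat -> C) (n : nat) :
  sum_n (fun k => Cmult c (u k)) n = Cmult c (sum_n u n).
Proof. exact (sum_n_mult_l (K := C_Ring) c u n). Qed.

Lemma sum_n_Cmult_r (c : C) (u : nat -> C) (n : nat) :
  sum_n (fun k => Cmult (u k) c) n = Cmult (sum_n u n) c.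
Proof. exact (sum_n_mult_r (K := C_Ring) c u n). Qed.

Lemma RtoC_sum_n (u : nat -> R) (n : nat) :
  RtoC (sum_n u n) = sum_n (fun k => RtoC (u k)) n.
Proof.
  induction n as [|n IH]; [now rewrite !sum_O|].
  rewrite !sum_Sn, <- IH. apply RtoC_plus.
Qed.

(** [lam] is the phase common to exp(i pi X^0) and to the middle factor. The right-hand side sends
    t^y to (r + t)^y, then t^m to z lam (- (1 - dl r) t)^m, then to the same constant times t^m
    W_{nu + dl m}(t): this is the expansion in [evolved_gen_final]. *)
Lemma evolved_final (p q nu dl : R) (c s z : R -> R) (f : nat -> C) (lam : C) (d : nat -> C)
  (A : op nat) (Y : nat) (b r : R) (n : nat) :
  c b <> 0 -> q * (s b / c b) = 1 -> p * (s b / c b) = r ->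
  (forall m, (m <= n)%nat -> wt nu dl m <> 0) ->
  (forall y, (Y < y)%nat -> f y = RtoC 0) ->
  (forall g x, A g x = Cmult (d x) (g x)) ->
  (forall m, cexp (d m) = Cmult (RtoC (z b * (- (1 - dl * r)) ^ m)) lam) ->
  evolved p q nu dl c s z (fun y => Cmult (RtoC ((-1) ^ y)) (Cmult lam (f y))) Y b n =
  opexp Kminus (opexp A (opexp (opscal (RtoC r) (Xplus nu dl)) f)) n.
Proof.
  intros Hc Hq Hp Hw Hf HA Hd. rewrite opexp_Kminus.
  transitivity (sum_n (fun m => sum_n (fun y =>
    Cmult (RtoC (binom_coef n m * (z b * (- (1 - dl * r)) ^ m) * (bin r y m * wt nu dl y / wt nu dl m)))
      (Cmult lam (f y))) Y) n).
  2:{ apply sum_n_ext_loc; intros m Hm.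
      rewrite (opexp_diag A d HA), (opexp_Xplus nu dl r f Y m) by auto.
      rewrite Hd, <- !sum_n_Cmult_l. apply sum_n_ext; intros y.
      rewrite !RtoC_mult. C_eq. ring. }
  rewrite sum_n_switch. apply sum_n_ext; intros y.
  rewrite sum_n_Cmult_r, Cmult_assoc, <- RtoC_mult, <- RtoC_sum_n. do 2 f_equal.
  unfold evolved_coef.
  replace (wt nu dl y * evolved_gen p q nu dl (c b) (s b) (z b) y n / wt nu dl n * (-1) ^ y) with
    (wt nu dl y / wt nu dl n * ((-1) ^ y * evolved_gen p q nu dl (c b) (s b) (z b) y n))
    by (unfold Rdiv; ring).
  rewrite (evolved_gen_final p q nu dl (c b) (s b) (z b) r y n Hc Hq Hp).
  rewrite <- Rmult_assoc, <- sum_n_Rmult_l. apply sum_n_ext_loc; intros m Hm.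
  rewrite (wt_binomial nu dl n m) by auto. R_eq. field. auto.
Qed.

(** * The flow as an exponential *)

Lemma is_series_sum_n_lim (u : nat -> nat -> R) (l : nat -> R) (m : nat) :
  (forall i, is_series (u i) (l i)) ->
  is_series (fun j => sum_n (fun i => u i j) m) (sum_n l m).
Proof.
  intros H. rewrite (sum_n_ext l (fun i => Series (u i))).
  - apply is_series_sum_n. intros i. eexists; apply H.
  - intros i. symmetry. apply is_series_unique, H.
Qed.

Definition evolved_gen_sum (p q nu dl c s z : R) (y : nat) (t : R) : R :=
  (c * t - p * s) ^ y * (z / c ^ y * PSeries (wt (nu + dl * INR y) dl) (q * (s / c) * t)).

Lemma is_solution_evolved (w : nat -> R) (p q nu dl : R) (c s z : R -> R) (a : nat -> C) (Y : nat) :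
  0 < nu -> 0 <= dl <= 1 -> (forall n, w n = wt nu dl n) ->
  (forall b, flow_data p q nu dl c s z b) -> c 0 = 1 -> s 0 = 0 -> z 0 = 1 ->
  (forall b t, real_analytic2 (fun b _ => c b) b t) ->
  (forall b t, real_analytic2 (fun b _ => / c b) b t) ->
  (forall b t, real_analytic2 (fun b _ => s b) b t) ->
  (forall b t, real_analytic2 (fun b _ => z b) b t) ->
  (forall y, (Y < y)%nat -> a y = RtoC 0) ->
  is_solution w (jacobi_op (fun n => - p * (nu + dl * INR n)) (fun n => q * INR n)) a
    (evolved p q nu dl c s z a Y).
Proof.
  intros Hnu Hdl Hw HF Hc0 Hs0 Hz0 Ac Aic As Az Ha.
  assert (W : forall n, wt nu dl n <> 0) by (intros n; generalize (wt_pos nu dl n Hnu); lra).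
  assert (HR : forall y v, Rabs v < 1 -> Rbar_lt (Rabs v) (CV_radius (wt (nu + dl * INR y) dl))).
  { intros y v Hv. apply Rbar_lt_le_trans with 1; [exact Hv|]. apply CV_radius_wt; auto.
    assert (P := pos_INR y). nra. }
  split; [|split].
  - apply functional_extensionality; intros n. apply evolved_init; auto.
  - intros b x. apply is_derive_evolved; auto. intros y _. left.
    assert (P := pos_INR x). nra.
  (* The set where the argument of W lies in the unit disc, on which all the series W_{nu + dl y}
     converge; it contains t = 0 at every time. *)
  - exists (fun bt => Rabs (q * (s (fst bt) / c (fst bt)) * snd bt) < 1).
    exists (fun b t => sum_n (fun y => Cmult (RtoC (wt nu dl y *
              evolved_gen_sum p q nu dl (c b) (s b) (z b) y t)) (a y)) Y).
    split; [|split].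
    + apply (open_comp (fun bt : R * R => Rabs (q * (s (fst bt) / c (fst bt)) * snd bt))
               (fun v : R => v < 1)).
      * intros [b t] _. apply (continuous_comp
          (fun bt : R * R => q * (s (fst bt) / c (fst bt)) * snd bt) Rabs);
          [|apply continuous_Rabs].
        apply (continuous_mult (fun bt : R * R => q * (s (fst bt) / c (fst bt))) snd);
          [|apply continuous_snd].
        apply (continuous_comp (V := R_UniformSpace) fst (fun b => q * (s b / c b)));
          [apply continuous_fst|].
        destruct (HF b) as (N0 & Dc & Ds & _). simpl.
        apply (ex_derive_continuous (V := R_NormedModule)).
        auto_derive. repeat split; [eexists; exact Ds | eexists; exact Dc | exact N0].
      * apply open_lt.
    + intros b. simpl. rewrite Rmult_0_r, Rabs_R0. apply Rlt_0_1.
    + intros b t Hbt. simpl in Hbt. split.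
      * assert (S : forall y k, is_series (fun n => wt nu dl y * k *
                  (evolved_gen p q nu dl (c b) (s b) (z b) y n * t ^ n))
                  (wt nu dl y * k * evolved_gen_sum p q nu dl (c b) (s b) (z b) y t)).
        { intros y k. apply (is_series_scal (V := R_NormedModule) (wt nu dl y * k)).
          apply is_series_evolved_gen. apply HR. exact Hbt. }
        apply is_series_C. unfold evolved. split.
        -- rewrite Re_sum_n.
           rewrite (sum_n_ext _ (fun y => wt nu dl y * Re (a y) *
                      evolved_gen_sum p q nu dl (c b) (s b) (z b) y t))
             by (intros y; unfold Re; simpl; R_eq; ring).
           eapply is_series_ext; [|apply (is_series_sum_n_lim _ _ Y (fun y => S y (Re (a y))))].
           intros n. cbv beta.
           transitivity (Re (sum_n (fun y => Cmult (RtoC (evolved_coef p q nu dl (c b) (s b) (z b) y n)) (a y)) Y)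
                         * (w n * t ^ n)); [|unfold Re; simpl; ring].
           rewrite Re_sum_n, Rmult_comm, <- sum_n_Rmult_l. apply sum_n_ext; intros y.
           rewrite Hw. unfold evolved_coef, Re; simpl. R_eq. field. auto.
        -- rewrite Im_sum_n.
           rewrite (sum_n_ext _ (fun y => wt nu dl y * Im (a y) *
                      evolved_gen_sum p q nu dl (c b) (s b) (z b) y t))
             by (intros y; unfold Im; simpl; R_eq; ring).
           eapply is_series_ext; [|apply (is_series_sum_n_lim _ _ Y (fun y => S y (Im (a y))))].
           intros n. cbv beta.
           transitivity (Im (sum_n (fun y => Cmult (RtoC (evolved_coef p q nu dl (c b) (s b) (z b) y n)) (a y)) Y)
                         * (w n * t ^ n)); [|unfold Im; simpl; ring].
           rewrite Im_sum_n, Rmult_comm, <- sum_n_Rmult_l. apply sum_n_ext; intros y.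
           rewrite Hw. unfold evolved_coef, Im; simpl. R_eq. field. auto.
      * assert (P : forall y, real_analytic2
                  (fun b t => evolved_gen_sum p q nu dl (c b) (s b) (z b) y t) b t).
        { intros y. unfold evolved_gen_sum.
          apply real_analytic2_mult; [|apply real_analytic2_mult].
          - apply real_analytic2_pow.
            apply real_analytic2_ext with (fun b t => c b * t + - p * s b);
              [intros; ring|].
            apply real_analytic2_plus; [apply real_analytic2_mult; auto using real_analytic2_snd|].
            apply real_analytic2_scal; auto.
          - apply real_analytic2_ext with (fun b t => z b * (/ c b) ^ y).
            + intros b' t'. unfold Rdiv. now rewrite pow_inv.
            + apply real_analytic2_mult; auto.
              apply (real_analytic2_pow (fun b _ => / c b)); auto.
          - apply (real_analytic2_PSeries (wt (nu + dl * INR y) dl)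
                     (fun b t => q * (s b / c b) * t)).
            + apply real_analytic2_mult; [|apply real_analytic2_snd].
              apply real_analytic2_scal. apply real_analytic2_mult; auto.
            + apply HR. exact Hbt. }
        apply analytic_at_of_real.
        -- apply real_analytic2_ext with (fun b t => sum_n (fun y => wt nu dl y * Re (a y) *
                      evolved_gen_sum p q nu dl (c b) (s b) (z b) y t) Y).
           ++ intros b' t'. rewrite Re_sum_n. apply sum_n_ext; intros y.
              unfold Re; simpl; R_eq; ring.
           ++ apply real_analytic2_sum_n. intros y. apply real_analytic2_scal; auto.
        -- apply real_analytic2_ext with (fun b t => sum_n (fun y => wt nu dl y * Im (a y) *
                      evolved_gen_sum p q nu dl (c b) (s b) (z b) y t) Y).
           ++ intros b' t'. rewrite Im_sum_n. apply sum_n_ext; intros y.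
              unfold Im; simpl; R_eq; ring.
           ++ apply real_analytic2_sum_n. intros y. apply real_analytic2_scal; auto.
Qed.

Lemma is_flow_evolved (w : nat -> R) (p q nu dl : R) (c s z : R -> R) (f : nat -> C)
  (lam : C) (d : nat -> C) (D : op nat) (b r : R) :
  0 < nu -> 0 <= dl <= 1 -> (forall n, w n = wt nu dl n) ->
  (forall b, flow_data p q nu dl c s z b) -> c 0 = 1 -> s 0 = 0 -> z 0 = 1 ->
  (forall b t, real_analytic2 (fun b _ => c b) b t) ->
  (forall b t, real_analytic2 (fun b _ => / c b) b t) ->
  (forall b t, real_analytic2 (fun b _ => s b) b t) ->
  (forall b t, real_analytic2 (fun b _ => z b) b t) ->
  finitely_supported f ->
  q * (s b / c b) = 1 -> p * (s b / c b) = r ->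
  (forall g x, D g x = Cmult (d x) (g x)) ->
  (forall m, cexp (d m) = Cmult (RtoC (z b * (- (1 - dl * r)) ^ m)) lam) ->
  is_flow w (jacobi_op (fun n => - p * (nu + dl * INR n)) (fun n => q * INR n)) b
    (fun y => Cmult (RtoC ((-1) ^ y)) (Cmult lam (f y)))
    (opexp Kminus (opexp D (opexp (opscal (RtoC r) (Xplus nu dl)) f))).
Proof.
  intros Hnu Hdl Hw HF Hc0 Hs0 Hz0 Ac Aic As Az [Y HY] Hq Hp HD Hd.
  assert (W : forall n, wt nu dl n <> 0) by (intros n; generalize (wt_pos nu dl n Hnu); lra).
  set (a := fun y => Cmult (RtoC ((-1) ^ y)) (Cmult lam (f y))).
  assert (Hf : forall y, (Y < y)%nat -> f y = RtoC 0) by (intros; apply HY; lia).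
  assert (S : is_solution w (jacobi_op (fun n => - p * (nu + dl * INR n)) (fun n => q * INR n)) a
    (evolved p q nu dl c s z a Y)).
  { apply is_solution_evolved; auto. intros y Hy. unfold a. rewrite Hf by auto.
    rewrite !Cmult_0_r. reflexivity. }
  exists (evolved p q nu dl c s z a Y). split; [split; auto|].
  - intros g Hg. apply (is_solution_unique w _ _ a _ _ (fun n => eq_ind_r (fun v => v <> 0) (W n) (Hw n)) S Hg).
  - apply functional_extensionality; intros n.
    apply (evolved_final p q nu dl c s z f lam d D Y b r n); auto. apply HF.
Qed.

(** The condition u N = 0 closes the system on the coordinates 0, ..., N: the value at N + 1 enters
    with coefficient 0. *)
Lemma is_derive_jacobi_op_le (u v : nat -> R) (N : nat) (h : R -> nat -> C) (dh : nat -> C) (b : R) :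
  u N = 0 ->
  (forall x, (x <= N)%nat -> is_derive (V := C_R_NormedModule) (fun s => h s x) b (dh x)) ->
  forall x, (x <= N)%nat ->
    is_derive (V := C_R_NormedModule) (fun s => jacobi_op u v (h s) x) b (jacobi_op u v dh x).
Proof.
  intros Hu H.
  assert (K : forall (h : R -> nat -> R) (dh : nat -> R),
    (forall x, (x <= N)%nat -> is_derive (fun s => h s x) b (dh x)) ->
    forall x, (x <= N)%nat -> is_derive (fun s => jacobi u v (h s) x) b (jacobi u v dh x)).
  { clear h dh H. intros h dh H x Hx. unfold jacobi.
    apply (is_derive_plus (V := R_NormedModule)).
    - destruct (Nat.eq_dec x N) as [->|E].
      + rewrite Hu, Rmult_0_l. eapply is_derive_ext;
          [|exact (is_derive_const (V := R_NormedModule) 0 b)].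
        intros s. cbv beta. R_eq. ring.
      + apply is_derive_scal, H. lia.
    - apply is_derive_scal. destruct x as [|x]; simpl.
      + exact (is_derive_const (V := R_NormedModule) 0 b).
      + apply H; lia. }
  intros x Hx. apply is_derive_C. rewrite Re_jacobi_op, Im_jacobi_op. split.
  - eapply is_derive_ext; [intros s; symmetry; apply Re_jacobi_op|].
    apply (K (fun s y => Re (h s y)) (fun y => Re (dh y))); auto.
    intros y Hy. apply is_derive_C, H, Hy.
  - eapply is_derive_ext; [intros s; symmetry; apply Im_jacobi_op|].
    apply (K (fun s y => Im (h s y)) (fun y => Im (dh y))); auto.
    intros y Hy. apply is_derive_C, H, Hy.
Qed.

Lemma Cmod_jacobi_op_le (u v : nat -> R) (N : nat) (h : nat -> C) (K M : R) :
  u N = 0 -> 0 <= M -> (forall x, (x <= N)%nat -> Rabs (u x) + Rabs (v x) <= K) ->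
  (forall x, (x <= N)%nat -> Cmod (h x) <= M) ->
  forall x, (x <= N)%nat -> Cmod (jacobi_op u v h x) <= M * K.
Proof.
  intros Hu HM HK H x Hx. unfold jacobi_op.
  eapply Rle_trans; [apply Cmod_triangle|]. rewrite !Cmod_mult, !Cmod_R.
  assert (A : Rabs (u x) * Cmod (h (S x)) <= Rabs (u x) * M).
  { destruct (Nat.eq_dec x N) as [->|E].
    - rewrite Hu, Rabs_R0. lra.
    - apply Rmult_le_compat_l; [apply Rabs_pos|]. apply H; lia. }
  assert (B : Rabs (v x) * Cmod (prev h x) <= Rabs (v x) * M).
  { apply Rmult_le_compat_l; [apply Rabs_pos|]. destruct x as [|x]; simpl.
    - rewrite Cmod_0. auto.
    - apply H; lia. }
  specialize (HK x Hx). nra.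
Qed.

Lemma bounded_on_unit_interval (h : R -> C) :
  (forall s, 0 <= s <= 1 -> ex_derive (V := C_R_NormedModule) h s) ->
  exists M, forall s, 0 <= s <= 1 -> Cmod (h s) <= M.
Proof.
  intros H.
  assert (K : forall g : R -> R, (forall s, 0 <= s <= 1 -> ex_derive g s) ->
    exists M, forall s, 0 <= s <= 1 -> Rabs (g s) <= M).
  { intros g Hg. destruct (continuity_ab_maj (fun s => Rabs (g s)) 0 1) as (m & Hm & _).
    - lra.
    - intros s Hs. apply continuity_pt_filterlim.
      apply (continuous_comp g Rabs); [|apply continuous_Rabs].
      apply (ex_derive_continuous (V := R_NormedModule)), Hg, Hs.
    - exists (Rabs (g m)). exact Hm. }
  destruct (K (fun s => Re (h s))) as [M1 H1].
  { intros s Hs. destruct (H s Hs) as [l Hl]. exists (Re l). apply is_derive_C, Hl. }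
  destruct (K (fun s => Im (h s))) as [M2 H2].
  { intros s Hs. destruct (H s Hs) as [l Hl]. exists (Im l). apply is_derive_C, Hl. }
  exists (M1 + M2). intros s Hs. eapply Rle_trans; [apply Cmod_le_Rabs|].
  apply Rplus_le_compat; auto.
Qed.

Lemma uniform_bound (P : nat -> R -> Prop) (N : nat) :
  (forall x M M', P x M -> M <= M' -> P x M') ->
  (forall x, (x <= N)%nat -> exists M, P x M) ->
  exists M, 0 <= M /\ forall x, (x <= N)%nat -> P x M.
Proof.
  intros Hmon. induction N as [|N IH]; intros H.
  - destruct (H 0%nat) as [M HM]; auto. exists (Rmax 0 M). split; [apply Rmax_l|].
    intros x Hx. replace x with 0%nat by lia. apply Hmon with M; auto. apply Rmax_r.
  - destruct IH as (M & HM0 & HM); [intros; apply H; lia|].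
    destruct (H (S N)) as [M' HM']; auto. exists (Rmax M M'). split.
    + apply Rle_trans with M; auto. apply Rmax_l.
    + intros x Hx. destruct (Nat.eq_dec x (S N)) as [->|E].
      * apply Hmon with M'; auto. apply Rmax_r.
      * apply Hmon with M; [apply HM; lia | apply Rmax_l].
Qed.

(** On the coordinates 0, ..., N the operator is a finite matrix of row norm at most K, so the n-th
    derivative of a solution is bounded by M K^n on [0, 1] and [CSeries_taylor] applies. *)
Lemma opexp_jacobi_flow (u v : nat -> R) (N : nat) (g : R -> nat -> C) (x : nat) :
  u N = 0 -> (x <= N)%nat ->
  (forall s y, 0 <= s <= 1 -> (y <= N)%nat ->
     is_derive (V := C_R_NormedModule) (fun r => g r y) s (jacobi_op u v (g s) y)) ->
  opexp (jacobi_op u v) (g 0) x = g 1 x.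
Proof.
  intros Hu Hx Hg.
  destruct (uniform_bound (fun x M => Rabs (u x) + Rabs (v x) <= M) N) as (K & HK0 & HK).
  { intros y M M' H1 H2. lra. }
  { intros y _. eexists. apply Rle_refl. }
  destruct (uniform_bound (fun x M => forall s, 0 <= s <= 1 -> Cmod (g s x) <= M) N)
    as (M & HM0 & HM).
  { intros y M M' H1 H2 s Hs. specialize (H1 s Hs). lra. }
  { intros y Hy. apply (bounded_on_unit_interval (fun s => g s y)).
    intros s Hs. eexists. apply Hg; auto. }
  apply (CSeries_taylor (fun n s => Nat.iter n (jacobi_op u v) (g s) x) M K).
  - intros n s Hs. revert x Hx. induction n as [|n IH]; intros x Hx; [apply Hg; auto|].
    apply (is_derive_jacobi_op_le u v N (fun r => Nat.iter n (jacobi_op u v) (g r))); auto.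
  - intros n s Hs. revert x Hx. induction n as [|n IH]; intros x Hx.
    + simpl. rewrite Rmult_1_r. auto.
    + simpl Nat.iter.
      replace (M * K ^ S n) with (M * K ^ n * K) by (simpl; ring).
      apply Cmod_jacobi_op_le with N; auto.
      apply Rmult_le_pos; auto. apply pow_le; auto.
Qed.

(** * The discrete-series and Heisenberg cases *)

Lemma weightK_wt (k : R) (n : nat) : 0 < k -> weightK k n = wt (2 * k) 1 n.
Proof.
  intros Hk. destruct (Gamma_spec (2 * k)) as [_ G0]; [lra|].
  unfold weightK. induction n as [|n IH].
  - simpl. rewrite Rplus_0_r. field. lra.
  - change (wt (2 * k) 1 (S n)) with (wt (2 * k) 1 n * (2 * k + 1 * INR n) / INR (S n)).
    rewrite <- IH. assert (P := pos_INR n).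
    replace (2 * k + INR (S n)) with (2 * k + INR n + 1) by (rewrite S_INR; ring).
    rewrite Gamma_succ by lra. rewrite fact_simpl, mult_INR. field.
    repeat split; try lra; try apply INR_fact_neq_0. apply not_0_INR; discriminate.
Qed.

Lemma weighta_wt (n : nat) : weighta n = wt 1 0 n.
Proof.
  unfold weighta. induction n as [|n IH]; [simpl; field|].
  change (wt 1 0 (S n)) with (wt 1 0 n * (1 + 0 * INR n) / INR (S n)).
  rewrite <- IH, fact_simpl, mult_INR. field.
  split; [apply INR_fact_neq_0 | apply not_0_INR; discriminate].
Qed.

Lemma near_ratio (c : R -> R) (b0 : R) :
  0 < c b0 -> continuous c b0 ->
  exists d, 0 < d /\ forall b : R, Rabs (b - b0) < d -> Rabs (1 - c b / c b0) < 1.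
Proof.
  intros H0 Hc.
  destruct (proj1 (filterlim_locally _ _) Hc (mkposreal _ H0)) as [d Hd].
  exists d. split; [apply cond_pos|]. intros b Hb. specialize (Hd b Hb).
  assert (Hd' : Rabs (c b - c b0) < c b0) by exact Hd.
  replace (1 - c b / c b0) with (- ((c b - c b0) / c b0)) by (field; lra).
  rewrite Rabs_Ropp. unfold Rdiv. rewrite Rabs_mult, (Rabs_pos_eq (/ c b0)).
  - apply Rmult_lt_reg_r with (c b0); auto. rewrite Rmult_assoc, Rinv_l by lra. lra.
  - left. apply Rinv_0_lt_compat; auto.
Qed.

Lemma real_analytic2_Rpower_fst (c : R -> R) (nu b0 t0 : R) :
  0 < nu -> 0 < c b0 -> continuous c b0 -> real_analytic2 (fun b _ => c b) b0 t0 ->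
  real_analytic2 (fun b _ => Rpower (c b) (- nu)) b0 t0.
Proof.
  intros Hn H0 Hc Ha.
  apply (real_analytic2_Rpower_neg (fun b _ => c b)); auto.
  destruct (near_ratio c b0 H0 Hc) as (d & Hd & H).
  exists d. auto.
Qed.

(** The phase splits into (-1)^m and e^{i pi k}. The imaginary part +pi of the logarithms makes the
    second one equal to the phase in [cexp_parity], so it factors out of both sides of the
    identities. *)
Lemma cexp_INR_shift (x k : R) (m : nat) :
  cexp (Cmult (Cplus (RtoC x) (Cmult Ci (RtoC PI))) (RtoC (INR m + k))) =
  Cmult (RtoC (exp (x * k) * (- exp x) ^ m)) (cexp (Cmult Ci (RtoC (PI * k)))).
Proof.
  replace (Cmult (Cplus (RtoC x) (Cmult Ci (RtoC PI))) (RtoC (INR m + k))) with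
    (Cplus (Cplus (RtoC (x * k + INR m * x)) (Cmult Ci (RtoC (PI * INR m))))
       (Cmult Ci (RtoC (PI * k)))).
  - rewrite !cexp_plus, cexp_RtoC, cexp_i_PI_INR. f_equal.
    rewrite <- RtoC_mult. f_equal. rewrite exp_plus.
    replace (- exp x) with (exp x * -1) by ring. rewrite Rpow_mult_distr.
    replace (exp (INR m * x)) with (exp x ^ m).
    + ring.
    + rewrite <- Rpower_pow by apply exp_pos. unfold Rpower. now rewrite ln_exp.
  - unfold Cmult, Cplus, Ci, RtoC; simpl. f_equal; ring.
Qed.

Lemma cexp_parity (k : R) (y : nat) :
  cexp (Cmult (Cmult Ci (RtoC PI)) (RtoC (INR y + k))) =
  Cmult (RtoC ((-1) ^ y)) (cexp (Cmult Ci (RtoC (PI * k)))).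
Proof.
  replace (Cmult (Cmult Ci (RtoC PI)) (RtoC (INR y + k))) with
    (Cmult (Cplus (RtoC 0) (Cmult Ci (RtoC PI))) (RtoC (INR y + k))) by ring.
  rewrite cexp_INR_shift. rewrite Rmult_0_l, exp_0, Rmult_1_l. reflexivity.
Qed.

(** cosh (b / sqrt p) and, below, sqrt p sinh (b / sqrt p): the solutions of s' = c, c' = s / p with
    c = 1 and s = 0 at time 0. *)
Definition hyp_cos (p b : R) : R := (exp (b / sqrt p) + exp (- (b / sqrt p))) / 2.
Definition hyp_sin (p b : R) : R := sqrt p * ((exp (b / sqrt p) - exp (- (b / sqrt p))) / 2).

Lemma hyp_cos_pos (p b : R) : 0 < hyp_cos p b.
Proof.
  unfold hyp_cos. assert (A := exp_pos (b / sqrt p)). assert (B := exp_pos (- (b / sqrt p))). lra.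
Qed.

Lemma is_derive_hyp_cos (p b : R) : 0 < p -> is_derive (hyp_cos p) b (/ p * hyp_sin p b).
Proof.
  intros Hp. assert (S := sqrt_lt_R0 p Hp). assert (E := sqrt_sqrt p ltac:(lra)).
  unfold hyp_cos, hyp_sin. auto_derive; auto.
  set (r := sqrt p) in *. replace p with (r * r). unfold Rdiv. field. lra.
Qed.

Lemma is_derive_hyp_sin (p b : R) : 0 < p -> is_derive (hyp_sin p) b (hyp_cos p b).
Proof.
  intros Hp. assert (S := sqrt_lt_R0 p Hp).
  unfold hyp_cos, hyp_sin. auto_derive; auto. unfold Rdiv. field. lra.
Qed.

Lemma real_analytic2_exp_lin (k b t : R) : real_analytic2 (fun b _ => exp (k * b)) b t.
Proof. apply real_analytic2_exp, real_analytic2_scal, real_analytic2_fst. Qed.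

Lemma real_analytic2_hyp_cos (p b t : R) : real_analytic2 (fun b _ => hyp_cos p b) b t.
Proof.
  apply real_analytic2_ext with
    (fun b _ => / 2 * (exp (/ sqrt p * b) + exp (- / sqrt p * b))).
  - intros x _. unfold hyp_cos, Rdiv.
    replace (- (x * / sqrt p)) with (- / sqrt p * x) by ring.
    rewrite (Rmult_comm x). ring.
  - apply real_analytic2_scal, real_analytic2_plus; apply real_analytic2_exp_lin.
Qed.

Lemma real_analytic2_hyp_sin (p b t : R) : real_analytic2 (fun b _ => hyp_sin p b) b t.
Proof.
  apply real_analytic2_ext with
    (fun b _ => sqrt p / 2 * (exp (/ sqrt p * b) + -1 * exp (- / sqrt p * b))).
  - intros x _. unfold hyp_sin, Rdiv.
    replace (- (x * / sqrt p)) with (- / sqrt p * x) by ring.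
    rewrite (Rmult_comm x). ring.
  - apply real_analytic2_scal, real_analytic2_plus; [|apply real_analytic2_scal];
      apply real_analytic2_exp_lin.
Qed.

(** From E^2 = (1 + u) / (1 - u): at the point arctanh u one has tanh = u and cosh^2 = 1 / (1 -
    u^2). *)
Lemma arctanh_values (u : R) :
  0 < u < 1 ->
  let E := exp (arctanh u) in
  (E - / E) = u * (E + / E) /\ ((E + / E) / 2) ^ 2 = / (1 - u ^ 2) /\ 0 < E.
Proof.
  intros Hu E. assert (P : 0 < E) by apply exp_pos.
  assert (Q : E * E = (1 + u) / (1 - u)).
  { unfold E. rewrite <- exp_plus. unfold arctanh.
    replace (ln ((1 + u) / (1 - u)) / 2 + ln ((1 + u) / (1 - u)) / 2)
      with (ln ((1 + u) / (1 - u))) by field.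
    apply exp_ln, Rdiv_lt_0_compat; lra. }
  split; [|split]; auto.
  - apply Rmult_eq_reg_r with E; [|lra].
    replace ((E - / E) * E) with (E * E - 1) by (field; lra).
    replace (u * (E + / E) * E) with (u * (E * E + 1)) by (field; lra).
    rewrite Q. field. lra.
  - replace (((E + / E) / 2) ^ 2) with ((E * E + 2 + / (E * E)) / 4) by (field; lra).
    rewrite Q. field. nra.
Qed.

Lemma K_flow_factorization (k p : R) (f : nat -> C) :
  0 < k -> 0 < p -> p < 1 -> finitely_supported f ->
  is_flow (weightK k)
    (opadd (opscal (RtoC (-1)) (Kplus k)) (opscal (RtoC (1 / p)) Kminus))
    (sqrt p * arctanh (sqrt p))
    (opexp (opscal (Cmult Ci (RtoC PI)) (Kzero k)) f)
    (opexp Kminus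
       (opexp (opscal (log_pm1 p) (Kzero k)) (opexp (opscal (RtoC p) (Kplus k)) f))).
Proof.
  intros Hk Hp0 Hp1 Hf.
  assert (S := sqrt_lt_R0 p Hp0). assert (ES := sqrt_sqrt p ltac:(lra)).
  assert (S1 : sqrt p < 1) by (rewrite <- sqrt_1; apply sqrt_lt_1; lra).
  replace (opadd _ _) with
    (jacobi_op (fun n => - (1) * (2 * k + 1 * INR n)) (fun n => 1 / p * INR n)).
  2:{ apply functional_extensionality; intros g. apply functional_extensionality; intros x.
      unfold jacobi_op, opadd, opscal, Kplus, Kminus.
      rewrite !RtoC_mult, !RtoC_plus, Rmult_1_l. rewrite RtoC_opp.
      change (RtoC (-1)) with (RtoC (- (1))). rewrite RtoC_opp. ring. }
  replace (opexp (opscal (Cmult Ci (RtoC PI)) (Kzero k)) f) with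
    (fun y => Cmult (RtoC ((-1) ^ y)) (Cmult (cexp (Cmult Ci (RtoC (PI * k)))) (f y))).
  2:{ apply functional_extensionality; intros y.
      rewrite (opexp_diag _ (fun y => Cmult (Cmult Ci (RtoC PI)) (RtoC (INR y + k))))
        by (intros; unfold opscal, Kzero; ring).
      rewrite cexp_parity. ring. }
  replace (Kplus k) with (Xplus (2 * k) 1).
  2:{ apply functional_extensionality; intros g. apply functional_extensionality; intros x.
      unfold Xplus, Kplus. now rewrite Rmult_1_l. }
  set (b := sqrt p * arctanh (sqrt p)).
  assert (Eb : b / sqrt p = arctanh (sqrt p)) by (unfold b; field; lra).
  destruct (arctanh_values (sqrt p)) as (T1 & T2 & T3); [lra|].
  set (E := exp (arctanh (sqrt p))) in *.
  assert (HE : exp (- arctanh (sqrt p)) = / E) by apply exp_Ropp.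
  assert (Hc : hyp_cos p b = (E + / E) / 2) by (unfold hyp_cos; rewrite Eb, HE; reflexivity).
  assert (Hs : hyp_sin p b = p * hyp_cos p b).
  { unfold hyp_sin. rewrite Hc, Eb, HE. fold E. rewrite T1.
    transitivity (sqrt p * sqrt p * ((E + / E) / 2)); [field; lra | now rewrite ES]. }
  assert (C0 := hyp_cos_pos p b).
  assert (Hsc : hyp_sin p b / hyp_cos p b = p) by (rewrite Hs; field; lra).
  assert (Cont : forall b, continuous (hyp_cos p) b).
  { intros b'. apply (ex_derive_continuous (V := R_NormedModule)).
    eexists; apply is_derive_hyp_cos; auto. }
  (* The general coefficients are 1 and 1 / p, and r = s / c = p at the final time. With nu = 2k and
     dl = 1 the amplitude c^(- nu / dl) is c^(- 2k). *)
  apply (is_flow_evolved (weightK k) 1 (1 / p) (2 * k) 1 (hyp_cos p) (hyp_sin p)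
           (fun b => Rpower (hyp_cos p b) (- (2 * k))) f (cexp (Cmult Ci (RtoC (PI * k))))
           (fun m => Cmult (log_pm1 p) (RtoC (INR m + k)))); try lra.
  - intros n. apply weightK_wt; auto.
  - intros b'. assert (P := hyp_cos_pos p b'). split; [lra|]. split; [|split].
    + replace (1 * (1 / p) * 1 * hyp_sin p b') with (/ p * hyp_sin p b') by (field; lra).
      apply is_derive_hyp_cos; auto.
    + apply is_derive_hyp_sin; auto.
    + assert (D := is_derive_hyp_cos p b' Hp0). unfold Rpower. evar_last.
      * auto_derive; [split; [eexists; exact D | split; [exact P | exact I]]|].
        rewrite (is_derive_unique (fun x : R => hyp_cos p x) _ _ D). reflexivity.
      * cbv beta. field. split; lra.
  - unfold hyp_cos. replace (0 / sqrt p) with 0 by (field; lra). rewrite Ropp_0, exp_0. field.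
  - unfold hyp_sin. replace (0 / sqrt p) with 0 by (field; lra). rewrite Ropp_0, exp_0. field.
  - unfold hyp_cos. replace (0 / sqrt p) with 0 by (field; lra). rewrite Ropp_0, exp_0.
    replace ((1 + 1) / 2) with 1 by field. unfold Rpower. now rewrite ln_1, Rmult_0_r, exp_0.
  - intros; apply real_analytic2_hyp_cos.
  - intros b' t'. apply real_analytic2_ext with (fun b _ => Rpower (hyp_cos p b) (- (1))).
    + intros x _. rewrite Rpower_Ropp, Rpower_1; auto. apply hyp_cos_pos.
    + apply real_analytic2_Rpower_fst; auto using hyp_cos_pos, real_analytic2_hyp_cos. lra.
  - intros; apply real_analytic2_hyp_sin.
  - intros b' t'. apply real_analytic2_Rpower_fst; auto using hyp_cos_pos, real_analytic2_hyp_cos. lra.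
  - exact Hf.
  - rewrite Hsc. field. lra.
  - intros g x. unfold opscal, Kzero. ring.
  - intros m. unfold log_pm1. rewrite cexp_INR_shift, exp_ln by lra. do 2 f_equal.
    rewrite Rmult_1_l. f_equal.
    (* At the final time cosh^2 = 1 / (1 - p), so the amplitude is (1 - p)^k, the modulus of e^{k
       log(p - 1)}. *)
    assert (L : 2 * ln (hyp_cos p b) = - ln (1 - p)).
    { rewrite <- ln_Rinv by lra. replace (/ (1 - p)) with (hyp_cos p b ^ 2).
      - simpl. rewrite Rmult_1_r, ln_mult by auto. ring.
      - rewrite Hc, T2. do 2 f_equal. simpl. rewrite Rmult_1_r. auto. }
    unfold Rpower. f_equal.
    replace (- (2 * k) * ln (hyp_cos p b)) with (- k * (2 * ln (hyp_cos p b))) by ring.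
    rewrite L. ring.
Qed.

Lemma a_flow_factorization (p : R) (f : nat -> C) :
  0 < p -> finitely_supported f ->
  is_flow weighta (opadd (opscal (RtoC (- p)) adag) aop) 1
    (opexp (opscal (Cmult Ci (RtoC PI)) (opcomp aop adag)) f)
    (opexp aop
       (opexp
          (opadd (opscal (RtoC (- p / 2)) opid)
             (opscal (Cmult Ci (RtoC PI)) (opcomp aop adag)))
          (opexp (opscal (RtoC p) adag) f))).
Proof.
  intros Hp Hf.
  assert (Num : forall (g : nat -> C) x, opcomp aop adag g x = Cmult (RtoC (INR x)) (g x)).
  { intros g [|x]; unfold opcomp, aop, adag, prev; [simpl; ring|reflexivity]. }
  replace (opadd (opscal (RtoC (- p)) adag) aop) with
    (jacobi_op (fun n => - p * (1 + 0 * INR n)) (fun n => 1 * INR n)).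
  2:{ apply functional_extensionality; intros g. apply functional_extensionality; intros x.
      unfold jacobi_op, opadd, opscal, adag, aop.
      replace (- p * (1 + 0 * INR x)) with (- p) by ring. now rewrite Rmult_1_l. }
  assert (L1 : cexp (RtoC 0) = RtoC 1) by (rewrite cexp_RtoC, exp_0; reflexivity).
  assert (Li : cexp (Cmult Ci (RtoC (PI * 0))) = RtoC 1).
  { rewrite <- L1. f_equal. rewrite Rmult_0_r. ring. }
  replace (opexp (opscal (Cmult Ci (RtoC PI)) (opcomp aop adag)) f) with
    (fun y => Cmult (RtoC ((-1) ^ y)) (Cmult (RtoC 1) (f y))).
  2:{ apply functional_extensionality; intros y.
      rewrite (opexp_diag _ (fun y => Cmult (Cmult Ci (RtoC PI)) (RtoC (INR y + 0)))).
      - rewrite cexp_parity, Li. ring.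
      - intros g x. unfold opscal. rewrite Num, Rplus_0_r. ring. }
  replace adag with (Xplus 1 0) at 2.
  2:{ apply functional_extensionality; intros g. apply functional_extensionality; intros x.
      unfold Xplus, adag. rewrite Rmult_0_l, Rplus_0_r. ring. }
  change aop with Kminus at 1.
  assert (Q : forall b t, real_analytic2 (fun b _ => - p * b ^ 2 / 2) b t).
  { intros b t. apply real_analytic2_ext with (fun b _ => - p / 2 * b ^ 2).
    - intros; field.
    - apply real_analytic2_scal. apply (real_analytic2_pow (fun b _ => b)), real_analytic2_fst. }
  (* For dl = 0 the characteristics are affine, and z' = - p b z gives the Gaussian amplitude, whose
     value at time 1 is the factor e^{-p/2}. *)
  apply (is_flow_evolved weighta p 1 1 0 (fun _ => 1) (fun b => b)
           (fun b => exp (- p * b ^ 2 / 2)) f (RtoC 1)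
           (fun m => Cplus (RtoC (- p / 2)) (Cmult (Cmult Ci (RtoC PI)) (RtoC (INR m + 0)))));
    try lra; auto.
  - apply weighta_wt.
  - intros b. split; [lra|]. split; [|split].
    + evar_last; [apply (is_derive_const (V := R_NormedModule) 1 b)|]. unfold zero; simpl. ring.
    + apply (is_derive_id b).
    + auto_derive; auto. change (- p * (b * (b * 1)) * / 2) with (- p * b ^ 2 / 2). field.
  - rewrite pow_i by lia. replace (- p * 0 / 2) with 0 by field. apply exp_0.
  - intros; apply real_analytic2_const.
  - intros; apply real_analytic2_const.
  - intros; apply real_analytic2_fst.
  - intros; apply real_analytic2_exp, Q.
  - intros g x. unfold opadd, opscal, opid. rewrite Num, Rplus_0_r. ring.
  - intros m. rewrite cexp_plus, cexp_parity, Li, cexp_RtoC.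
    rewrite Cmult_assoc, <- RtoC_mult.
    replace (- p * 1 ^ 2 / 2) with (- p / 2) by (simpl; field).
    replace (- (1 - 0 * p)) with (-1) by ring. reflexivity.
Qed.

(** * The finite-dimensional case *)

(** These weights are binomial coefficients, so they vanish only beyond N. *)
Lemma wt_neg1_neq0 (N n : nat) : (n <= N)%nat -> wt (INR N) (-1) n <> 0.
Proof.
  induction n as [|n IH]; intros H; [simpl; lra|].
  change (wt (INR N) (-1) n * (INR N + -1 * INR n) / INR (S n) <> 0).
  assert (A : INR n < INR N) by (apply lt_INR; lia).
  unfold Rdiv. repeat apply Rmult_integral_contrapositive_currified.
  - apply IH; lia.
  - lra.
  - apply Rinv_neq_0_compat, not_0_INR. discriminate.
Qed.

Definition trig_cos (q b : R) : R := cos (sqrt q * b).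
Definition trig_sin (q b : R) : R := sin (sqrt q * b) / sqrt q.

Lemma flow_data_trig (q b : R) (N : nat) :
  0 < q -> trig_cos q b <> 0 ->
  flow_data 1 q (INR N) (-1) (trig_cos q) (trig_sin q) (fun b => trig_cos q b ^ N) b.
Proof.
  intros Hq Hc. assert (Hsq := sqrt_lt_R0 q Hq). assert (E := sqrt_sqrt q ltac:(lra)).
  split; [exact Hc|]. unfold trig_cos, trig_sin in *. set (r := sqrt q) in *.
  split; [|split].
  - auto_derive; auto. rewrite <- E. field. lra.
  - auto_derive; auto. field. lra.
  - auto_derive; auto. rewrite <- E. destruct N as [|N].
    + simpl. ring.
    + simpl Init.Nat.pred. rewrite <- tech_pow_Rmult. field. split; auto. lra.
Qed.

Lemma scal_C (x : R) (v : C) :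
  scal x (v : C_R_NormedModule) = Cmult (RtoC x) v.
Proof.
  destruct v as [v1 v2]. unfold Cmult, RtoC. simpl.
  unfold scal; simpl. unfold prod_scal; simpl. unfold scal; simpl. unfold mult; simpl.
  f_equal; ring.
Qed.

(** The item for 2j = N with functions extended to all of nat; only the values at x <= N are
    claimed. The time beta is absorbed into the operator, since [opexp] evaluates a curve at time
    1. *)
Lemma J_exp_factorization_nat (N : nat) (p : R) (f : nat -> C) (x : nat) :
  0 < p -> p < 1 -> (forall y, (N < y)%nat -> f y = RtoC 0) -> (x <= N)%nat ->
  let beta := sqrt (p / (1 - p)) * atan (sqrt (p / (1 - p))) in
  opexp (jacobi_op (fun n => beta * (- (1) * (INR N + -1 * INR n)))
           (fun n => beta * ((1 - p) / p * INR n)))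
    (fun y => cexp (Cmult (Cmult Ci (RtoC PI)) (RtoC (INR y + - (INR N / 2)))) * f y)%C x =
  opexp Kminus
    (opexp (fun g n => (log_inv_pm1 p * RtoC (INR n + - (INR N / 2))) * g n)%C
       (opexp (opscal (RtoC (p / (1 - p))) (Xplus (INR N) (-1))) f)) x.
Proof.
  intros Hp0 Hp1 Hf Hx beta. set (q := (1 - p) / p).
  assert (Hq : 0 < q) by (apply Rdiv_lt_0_compat; lra).
  assert (Er : p / (1 - p) = / q) by (unfold q; field; lra).
  assert (Hsq := sqrt_lt_R0 q Hq). assert (ES := sqrt_sqrt q ltac:(lra)).
  assert (Eq : sqrt (p / (1 - p)) = / sqrt q) by (rewrite Er; apply sqrt_inv).
  set (th := atan (/ sqrt q)).
  assert (Eb : sqrt q * beta = th) by (unfold beta, th; rewrite Eq; field; lra).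
  assert (Hr : 0 < / sqrt q) by (apply Rinv_0_lt_compat; auto).
  assert (Hth : 0 < th < PI / 2).
  { split; [|apply atan_bound]. rewrite <- atan_0. apply atan_increasing; auto. }
  set (lam := cexp (Cmult Ci (RtoC (PI * - (INR N / 2))))).
  set (a := fun y => Cmult (RtoC ((-1) ^ y)) (Cmult lam (f y))).
  set (g := evolved 1 q (INR N) (-1) (trig_cos q) (trig_sin q) (fun b => trig_cos q b ^ N) a N).
  (* The angle s th runs from 0 to an arctangent, so it stays below pi / 2 and no zero of the cosine
     is met up to time beta. *)
  assert (Hc : forall s, 0 <= s <= 1 -> 0 < trig_cos q (s * beta)).
  { intros s Hs. unfold trig_cos. replace (sqrt q * (s * beta)) with (s * th) by (rewrite <- Eb; ring).
    apply cos_gt_0; nra. }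
  assert (Hcb : 0 < trig_cos q beta) by (rewrite <- (Rmult_1_l beta); apply Hc; lra).
  assert (T0 : trig_cos q 0 = 1) by (unfold trig_cos; rewrite Rmult_0_r; apply cos_0).
  assert (Ha : forall y, (N < y)%nat -> a y = RtoC 0).
  { intros y Hy. unfold a. rewrite Hf, !Cmult_0_r by auto. reflexivity. }
  transitivity (g beta x).
  - transitivity (opexp (jacobi_op (fun n => beta * (- (1) * (INR N + -1 * INR n)))
           (fun n => beta * (q * INR n))) (g (0 * beta)) x).
    + f_equal. apply functional_extensionality; intros y. rewrite Rmult_0_l.
      rewrite cexp_parity.
      transitivity (a y); [unfold a, lam; ring|]. symmetry.
      destruct (Nat.le_gt_cases y N) as [Hy|Hy].
      * apply evolved_init; auto.
        -- unfold trig_sin. rewrite Rmult_0_r, sin_0. unfold Rdiv; ring.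
        -- rewrite T0. apply pow1.
        -- apply wt_neg1_neq0; auto.
      (* Beyond N the denominator [wt] is 0, but the numerator is 0 by degree, so the quotient is 0
         with either convention for the inverse. *)
      * rewrite Ha by auto. apply sum_n_zero. intros i Hi. unfold evolved_coef.
        rewrite evolved_gen_degree with (N := N) by auto.
        unfold Rdiv. rewrite Rmult_0_r, Rmult_0_l. apply Cmult_0_l.
    + transitivity (g (1 * beta) x); [|now rewrite Rmult_1_l].
      apply (opexp_jacobi_flow _ _ N (fun s => g (s * beta))); auto.
      * ring.
      * intros s y Hs Hy.
        assert (D := is_derive_evolved 1 q (INR N) (-1) (trig_cos q) (trig_sin q) (fun b => trig_cos q b ^ N) a N
          (s * beta) y (flow_data_trig q (s * beta) N Hq ltac:(generalize (Hc s Hs); lra))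
          (wt_neg1_neq0 N y Hy)).
        assert (Z : forall i, (i <= N)%nat -> INR N + -1 * INR y <> 0 \/
          evolved_gen 1 q (INR N) (-1) (trig_cos q (s * beta)) (trig_sin q (s * beta)) (trig_cos q (s * beta) ^ N) i (S y) = 0).
        { intros i Hi. destruct (Nat.eq_dec y N) as [->|E].
          - right. apply evolved_gen_degree with (N := N); auto.
          - left. assert (INR y < INR N) by (apply lt_INR; lia). lra. }
        specialize (D Z).
        assert (Dl : is_derive (fun s : R => s * beta) s beta) by (auto_derive; auto; ring).
        assert (D' := is_derive_comp (V := C_R_NormedModule) (fun b => g b y)
                        (fun s => s * beta) s _ _ D Dl).
        evar_last; [exact D'|].
        unfold jacobi_op. fold g.
        rewrite !(RtoC_mult beta).
        rewrite scal_C. C_eq. ring.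
  - apply (evolved_final 1 q (INR N) (-1) (trig_cos q) (trig_sin q) (fun b => trig_cos q b ^ N) f lam
      (fun n => Cmult (log_inv_pm1 p) (RtoC (INR n + - (INR N / 2)))) _ N beta (p / (1 - p)) x); auto.
    + lra.
    + unfold trig_sin, trig_cos. rewrite Eb. replace (sin th / sqrt q / cos th) with (tan th / sqrt q).
      * unfold th. rewrite tan_atan.
        replace (/ sqrt q / sqrt q) with (/ (sqrt q * sqrt q)) by (field; lra).
        rewrite ES. field. lra.
      * unfold tan. field. unfold trig_cos in Hcb. rewrite Eb in Hcb. split; lra.
    + rewrite Rmult_1_l, Er. unfold trig_sin, trig_cos. rewrite Eb.
      replace (sin th / sqrt q / cos th) with (tan th / sqrt q).
      * unfold th. rewrite tan_atan.
        replace (/ sqrt q / sqrt q) with (/ (sqrt q * sqrt q)) by (field; lra).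
        now rewrite ES.
      * unfold tan. field. unfold trig_cos in Hcb. rewrite Eb in Hcb. split; lra.
    + intros m Hm. apply wt_neg1_neq0; lia.
    + intros m.
      replace (log_inv_pm1 p) with (Cplus (RtoC (- ln (1 - p))) (Cmult Ci (RtoC PI)))
        by (unfold log_inv_pm1; now rewrite RtoC_opp).
      rewrite cexp_INR_shift. fold lam. do 2 f_equal.
      (* cos^2 = 1 / (1 + tan^2) with tan^2 = 1 / q = p / (1 - p). *)
      assert (C2 : trig_cos q beta * trig_cos q beta = 1 - p).
      { unfold trig_cos. rewrite Eb. assert (T := tan_atan (/ sqrt q)). fold th in T.
        assert (Cp : 0 < cos th) by (unfold trig_cos in Hcb; rewrite Eb in Hcb; exact Hcb).
        unfold tan in T. assert (S2 := sin2_cos2 th). unfold Rsqr in S2.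
        assert (Es : sin th = cos th * / sqrt q) by (rewrite <- T; field; lra).
        rewrite Es in S2.
        replace (cos th * / sqrt q * (cos th * / sqrt q)) with
          (cos th * cos th * / (sqrt q * sqrt q)) in S2 by (field; lra).
        rewrite ES in S2. unfold q in S2.
        set (k := cos th * cos th) in *.
        replace (k * / ((1 - p) / p) + k) with (k / (1 - p)) in S2 by (field; lra).
        transitivity (k / (1 - p) * (1 - p)); [field; lra | rewrite S2; ring]. }
      assert (L : 2 * ln (trig_cos q beta) = ln (1 - p)).
      { rewrite <- C2, ln_mult by auto. ring. }
      f_equal.
      * rewrite <- Rpower_pow by auto. unfold Rpower. f_equal. rewrite <- L. field.
      * f_equal. rewrite exp_Ropp, exp_ln by lra. field. lra.
Qed.

(* Transfer from functions on nat to functions on {0, ..., N} *)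
From mathcomp Require Import ssreflect ssrfun ssrbool eqtype ssrnat fintype.

(** A relation rather than extension by zero: the lowering operator on nat moves mass from N to N +
    1, so [F] has to be free beyond N for agreement to be preserved. *)
Definition agree {N : nat} (f : 'I_N.+1 -> C) (F : nat -> C) : Prop :=
  forall i : 'I_N.+1, F (nat_of_ord i) = f i.

Lemma opexp_agree {N : nat} (A : op 'I_N.+1) (A' : op nat) (f : 'I_N.+1 -> C) (F : nat -> C) :
  (forall f F, agree f F -> agree (A f) (A' F)) ->
  agree f F -> agree (opexp A f) (opexp A' F).
Proof.
intros HA Hf i. unfold opexp. f_equal. apply functional_extensionality; intros n. f_equal.
revert i. change (agree (Nat.iter n A f) (Nat.iter n A' F)).
induction n as [|n IH]; [exact Hf | apply HA; exact IH].
Qed.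

Lemma ord_le {N : nat} (i : 'I_N.+1) : (nat_of_ord i <= N)%coq_nat.
Proof. by move: (ltn_ord i); rewrite ltnS => /leP. Qed.

Lemma ext0_agree {N : nat} (f : 'I_N.+1 -> C) : agree f (ext0 f).
Proof. by move=> i; rewrite /ext0 valK. Qed.

Lemma ext0_out {N : nat} (f : 'I_N.+1 -> C) (y : nat) :
  (N < y)%coq_nat -> ext0 f y = RtoC 0.
Proof.
move=> /ltP H. rewrite /ext0 insubF //. by rewrite ltnS leqNgt H.
Qed.

Lemma agree_ext0 {N : nat} (f : 'I_N.+1 -> C) (F : nat -> C) (y : nat) :
  agree f F -> (y <= N)%coq_nat -> ext0 f y = F y.
Proof.
move=> H /leP Hy. have Hy' : (y < N.+1)%N by rewrite ltnS.
by rewrite /ext0 insubT -(H (Ordinal Hy')).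
Qed.

Lemma Jplus_agree {N : nat} (f : 'I_N.+1 -> C) (F : nat -> C) :
  agree f F -> agree (Jplus N f) (Xplus (INR N) (-1) F).
Proof.
move=> H i. rewrite /Xplus /Jplus.
have -> : (INR N + -1 * INR i = INR N - INR i)%R by ring.
(* At the top index the coefficient N - i vanishes, which hides the uncontrolled value of [F] at N +
   1. *)
case: (Nat.eq_dec (nat_of_ord i) N) => [E|E].
- by rewrite E Rminus_diag !Cmult_0_l.
- rewrite (agree_ext0 f F _ H) //. have := ord_le i. lia.
Qed.

Lemma Jminus_agree {N : nat} (f : 'I_N.+1 -> C) (F : nat -> C) :
  agree f F -> agree (Jminus N f) (Kminus F).
Proof.
move=> H i. rewrite /Kminus /Jminus. have := ord_le i.
case: (nat_of_ord i) => [|x] Hx //=. rewrite (agree_ext0 f F _ H) //. lia.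
Qed.

Lemma J_exp_factorization (N : nat) (p : R) (f : 'I_N.+1 -> C) :
  (0 < p)%R -> (p < 1)%R ->
  opexp
    (opscal (RtoC (sqrt (p / (1 - p)) * atan (sqrt (p / (1 - p)))))
       (opadd (opscal (RtoC (-1)) (Jplus N)) (opscal (RtoC ((1 - p) / p)) (Jminus N))))
    (opexp (opscal (Cmult Ci (RtoC PI)) (Jzero N)) f)
  = opexp (Jminus N)
      (opexp (opscal (log_inv_pm1 p) (Jzero N))
         (opexp (opscal (RtoC (p / (1 - p))) (Jplus N)) f)).
Proof.
move=> Hp0 Hp1. apply: functional_extensionality => i.
have JZ (z : C) (h : 'I_N.+1 -> C) (H : nat -> C) : agree h H ->
    agree (opscal z (Jzero N) h)
      (fun n => (z * RtoC (INR n + - (INR N / 2))) * H n)%C.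
  move=> Hh j. rewrite /opscal /Jzero (Hh j). unfold Rminus. ring.
have HB (h : 'I_N.+1 -> C) (H : nat -> C) : agree h H ->
    agree (opscal (RtoC (sqrt (p / (1 - p)) * atan (sqrt (p / (1 - p)))))
        (opadd (opscal (RtoC (-1)) (Jplus N)) (opscal (RtoC ((1 - p) / p)) (Jminus N))) h)
      (jacobi_op
        (fun n => (sqrt (p / (1 - p)) * atan (sqrt (p / (1 - p)))) *
                  (- (1) * (INR N + -1 * INR n)))%R
        (fun n => (sqrt (p / (1 - p)) * atan (sqrt (p / (1 - p)))) *
                  ((1 - p) / p * INR n))%R H).
  move=> Hh j.
  rewrite /opscal /opadd -(Jplus_agree _ _ Hh j) -(Jminus_agree _ _ Hh j).
  rewrite /jacobi_op /Xplus /Kminus !RtoC_mult.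
  have -> : (- (1) = -1)%R by ring.
  ring.
have HP (h : 'I_N.+1 -> C) (H : nat -> C) : agree h H ->
    agree (opscal (RtoC (p / (1 - p))) (Jplus N) h)
      (opscal (RtoC (p / (1 - p))) (Xplus (INR N) (-1)) H).
  by move=> Hh j; rewrite /opscal (Jplus_agree _ _ Hh j).
have E1 := opexp_agree _ _ _ _ (JZ (Cmult Ci (RtoC PI))) (ext0_agree f).
rewrite -(opexp_agree _ _ _ _ HB E1 i).
have R1 := opexp_agree _ _ _ _ HP (ext0_agree f).
have R2 := opexp_agree _ _ _ _ (JZ (log_inv_pm1 p)) R1.
rewrite -(opexp_agree _ _ _ _ (@Jminus_agree N) R2 i).
rewrite -(J_exp_factorization_nat N p (ext0 f) i Hp0 Hp1 (ext0_out f) (ord_le i)).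
congr (opexp _ _ _). apply functional_extensionality; intros y. apply (opexp_diag _ (fun n => Cmult (Cmult Ci (RtoC PI)) (RtoC (INR n + - (INR N / 2))))). by [].
Qed.

Open Scope R_scope.
Open Scope C_scope.

Theorem theorem3p4 :
  (forall k p alpha beta : R,
     (0 < k)%R -> (0 < p)%R -> (p < 1)%R ->
     alpha = PI -> beta = (sqrt p * arctanh (sqrt p))%R ->
     forall f : nat -> C, finitely_supported f ->
       is_flow (weightK k)
         (opadd (opscal (-1) (Kplus k)) (opscal (RtoC (1 / p)) Kminus))
         beta
         (opexp (opscal (Ci * RtoC alpha) (Kzero k)) f)
         (opexp Kminus
            (opexp (opscal (log_pm1 p) (Kzero k))
               (opexp (opscal (RtoC p) (Kplus k)) f))))
  /\
  (forall (twoj : nat) (p alpha beta : R),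
     (1 <= twoj)%coq_nat -> (0 < p)%R -> (p < 1)%R ->
     alpha = PI ->
     beta = (sqrt (p / (1 - p)) * atan (sqrt (p / (1 - p))))%R ->
     forall f : 'I_twoj.+1 -> C,
       opexp
         (opscal (RtoC beta)
            (opadd (opscal (-1) (Jplus twoj))
                   (opscal (RtoC ((1 - p) / p)) (Jminus twoj))))
         (opexp (opscal (Ci * RtoC alpha) (Jzero twoj)) f)
       = opexp (Jminus twoj)
           (opexp (opscal (log_inv_pm1 p) (Jzero twoj))
              (opexp (opscal (RtoC (p / (1 - p))) (Jplus twoj)) f)))
  /\
  (forall p alpha beta : R,
     (0 < p)%R -> alpha = PI -> beta = 1%R ->
     forall f : nat -> C, finitely_supported f ->
       is_flow weighta
         (opadd (opscal (RtoC (- p)) adag) aop)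
         beta
         (opexp (opscal (Ci * RtoC alpha) (opcomp aop adag)) f)
         (opexp aop
            (opexp
               (opadd (opscal (RtoC (- p / 2)) opid)
                      (opscal (Ci * RtoC PI) (opcomp aop adag)))
               (opexp (opscal (RtoC p) adag) f)))).

Proof.
split; [|split].
- move=> k p alpha beta Hk Hp0 Hp1 -> -> f Hf. exact: K_flow_factorization.
- move=> N p alpha beta _ Hp0 Hp1 -> -> f. exact: J_exp_factorization.
- move=> p alpha beta Hp -> -> f Hf. exact: a_flow_factorization.
Qed.
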